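(* Let $T>0$ and let $P$ be a simplified reachability Gramian with associated positive definite matrix $\mathcal U$ and parameter $\delta>0$. Let $x$ be the solution of $$dx(t)=[f(x(t))+Bu(t)+G(x(t))u(t)]\,dt+[\Gamma(x(t))+M(u(t))]\,dw(t),\qquad x(0)=x_0 .$$ Let $(p_k)_{k=1,\dots,n}$ be an orthonormal basis of $\mathbb R^n$ of eigenvectors of $P$ with eigenvalues $\lambda_k=\lambda_k(\delta)>0$. If $x_0=0$ and the vector $\tilde u$ of multiplicative controls is deterministic, then for every $k\in\{1,\dots,n\}$ $$\sup_{t\in[0,T]}\mathbb E\langle x(t),p_k\rangle^2\le\lambda_k\exp\{\|\tilde u\|_{L^2_T}^2/\delta^2\}\,\|\mathcal U^{1/2}u\|_{L^2_T}^2 .$$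
   Context: Setting: $(\Omega,\mathcal F,(\mathcal F_t)_{t\ge0},\mathbb P)$ is a filtered probability space with right-continuous, complete filtration. $w=(w_1,\dots,w_q)^\top$ is an $\mathbb R^q$-valued, $(\mathcal F_t)$-adapted Wiener process whose increments $w(t+h)-w(t)$ are independent of $\mathcal F_t$ for $t,h\ge0$, with $\mathbb E[w(t)w(t)^\top]=Kt$, $K=(k_{ij})_{i,j=1,\dots,q}$. $G(x)=[g_1(x)\ \cdots\ g_m(x)]$, $\Gamma(x)=[\gamma_1(x)\ \cdots\ \gamma_q(x)]$, where $f,g_i,\gamma_j:\mathbb R^n\to\mathbb R^n$ vanish at $0$, each $g_i$ is either identically zero or non-constant, and the functions are regular enough (e.g. locally Lipschitz with a growth condition) that the state equation has a unique global solution. $B,M_1,\dots,M_q\in\mathbb R^{n\times m}$ and $M(u)=[M_1u\ \cdots\ M_qu]$. The control $u$ is $\mathbb R^m$-valued, $(\mathcal F_t)$-adapted, with $u\in L^2_T$, where $\|v\|_{L^2_T}^2:=\mathbb E\int_0^T\|v(t)\|^2dt$. $\|\cdot\|$, $\langle\cdot,\cdot\rangle$ are the Euclidean norm and inner product, $\|\cdot\|_F$ the Frobenius norm. Positive (semi)definite matrices are symmetric. Multiplicative controls: $\tilde u=(\tilde u_1,\dots,\tilde u_m)^\top$ with $\tilde u_i\equiv0$ if $g_i\equiv0$ and $\tilde u_i=u_i$ otherwise. For positive semidefinite $X\in\mathbb R^{n\times n}$, $\delta>0$, put $V_X(x)=x^\top Xx$ and $$LV_X(x,y;\delta)=2\langle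 x-y,X(f(x)-f(y))\rangle+\delta^2\|X^{1/2}(G(x)-G(y))\|_F^2+\|X^{1/2}(\Gamma(x)-\Gamma(y))K^{1/2}\|_F^2 .$$ For a positive definite matrix $\mathcal U\in\mathbb R^{m\times m}$ (free parameter) set $$U_X=\mathcal U-\sum_{i,j=1}^qM_i^\top XM_jk_{ij},\qquad S_X(x,y)=B^\top X(x-y)+\sum_{i,j=1}^qM_i^\top X(\gamma_j(x)-\gamma_j(y))k_{ij}.$$ A positive definite $P\in\mathbb R^{n\times n}$ is a simplified reachability Gramian (with associated $\mathcal U$ and parameter $\delta>0$) if $U_{P^{-1}}$ is positive definite and $$LV_{P^{-1}}(x,0;\delta)\le-S_{P^{-1}}(x,0)^\top U_{P^{-1}}^{-1}S_{P^{-1}}(x,0)\quad\text{for all }x\in\mathbb R^n.$$ *)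

(* Defs.v *)
From HB Require Import structures.
From mathcomp Require Import all_boot all_order all_algebra.
From mathcomp Require Import all_classical all_reals all_analysis.

Set Implicit Arguments.
Unset Strict Implicit.
Unset Printing Implicit Defensive.

Import Order.TTheory GRing.Theory Num.Theory.
Import numFieldNormedType.Exports.

Local Open Scope classical_set_scope.
Local Open Scope ring_scope.

Section Matrices.
Variable R : realType.

Definition dotv n (u v : 'cV[R]_n) : R := \sum_i u i 0 * v i 0.

Definition sqnorm n (v : 'cV[R]_n) : R := dotv v v.

Definition sqfrob m n (A : 'M[R]_(m, n)) : R := \sum_i \sum_j A i j ^+ 2.

Definition psd n (A : 'M[R]_n) : Prop :=
  A^T = A /\ forall v : 'cV[R]_n, 0 <= dotv v (A *m v).

Definition posdef n (A : 'M[R]_n) : Prop :=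
  A^T = A /\ forall v : 'cV[R]_n, v != 0 -> 0 < dotv v (A *m v).

(* The positive semidefinite square root, which is unique and exists for every
   positive semidefinite [A]; [0] is a junk value for the other matrices. *)
Definition sqrtmx n (A : 'M[R]_n) : 'M[R]_n :=
  xget 0 [set S : 'M[R]_n | psd S /\ S *m S = A].

(* Measurability for the Borel sigma-algebra of R^n, generated by its opens. *)
Definition borel_map n k (h : 'cV[R]_n -> 'cV[R]_k) : Prop :=
  forall (i : 'I_k) (C : set R), measurable C ->
    <<s [set O : set 'cV[R]_n | open O] >> [set z | C (h z i 0)].

(* The law N(a, v) on R; [normal_prob] is not a Dirac mass at zero variance. *)
Definition gaussian_law (a v : R) (C : set R) : \bar R :=
  if v == 0 then dirac a C else normal_prob a (Num.sqrt v) C.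

End Matrices.

Section System.
Variables (R : realType) (n m q : nat).

(* Coefficients of
   dx = [f(x) + B u + G(x) u] dt + [Gamma(x) + M(u)] dw. *)
Record sde_coeffs := SdeCoeffs {
  sde_f : 'cV[R]_n -> 'cV[R]_n;
  sde_g : 'I_m -> 'cV[R]_n -> 'cV[R]_n;
  sde_gamma : 'I_q -> 'cV[R]_n -> 'cV[R]_n;
  sde_B : 'M[R]_(n, m);
  sde_M : 'I_q -> 'M[R]_(n, m) }.

Variable S : sde_coeffs.

Definition Gmx (z : 'cV[R]_n) : 'M[R]_(n, m) :=
  \matrix_(i, j) sde_g S j z i 0.

Definition Gammamx (z : 'cV[R]_n) : 'M[R]_(n, q) :=
  \matrix_(i, j) sde_gamma S j z i 0.

Definition Mmx (v : 'cV[R]_m) : 'M[R]_(n, q) :=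
  \matrix_(i, j) (sde_M S j *m v) i 0.

Definition sde_drift (z : 'cV[R]_n) (v : 'cV[R]_m) : 'cV[R]_n :=
  sde_f S z + sde_B S *m v + Gmx z *m v.

Definition sde_diffusion (z : 'cV[R]_n) (v : 'cV[R]_m) : 'M[R]_(n, q) :=
  Gammamx z + Mmx v.

Variable K : 'M[R]_q.

Definition LV (X : 'M[R]_n) (delta : R) (x y : 'cV[R]_n) : R :=
  2 * dotv (x - y) (X *m (sde_f S x - sde_f S y))
  + delta ^+ 2 * sqfrob (sqrtmx X *m (Gmx x - Gmx y))
  + sqfrob (sqrtmx X *m (Gammamx x - Gammamx y) *m sqrtmx K).

Definition Umx (calU : 'M[R]_m) (X : 'M[R]_n) : 'M[R]_m :=
  calU - \sum_i \sum_j K i j *: ((sde_M S i)^T *m X *m sde_M S j).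

Definition Svec (X : 'M[R]_n) (x y : 'cV[R]_n) : 'cV[R]_m :=
  (sde_B S)^T *m X *m (x - y)
  + \sum_i \sum_j
      K i j *: ((sde_M S i)^T *m X *m (sde_gamma S j x - sde_gamma S j y)).

Record simplified_reachability_gramian
    (calU : 'M[R]_m) (delta : R) (P : 'M[R]_n) : Prop := {
  gramian_posdef : posdef P;
  gramian_calU_posdef : posdef calU;
  gramian_delta_gt0 : 0 < delta;
  gramian_U_posdef : posdef (Umx calU (invmx P));
  gramian_ineq : forall x : 'cV[R]_n,
    LV (invmx P) delta x 0
    <= - dotv (Svec (invmx P) x 0)
              (invmx (Umx calU (invmx P)) *m Svec (invmx P) x 0) }.

End System.

Section Stochastic.
Variables (R : realType) (d : measure_display) (Omega : measurableType d).
Variables (Pr : probability Omega R) (F : R -> set (set Omega)).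

Local Notation mu := (@lebesgue_measure R).

(* Only the values [F t] with [0 <= t] are meaningful. *)
Record usual_filtration : Prop := {
  filtration_sigma : forall t, 0 <= t -> sigma_algebra setT (F t);
  filtration_sub : forall t, 0 <= t -> F t `<=` measurable;
  filtration_nd : forall s t, 0 <= s -> s <= t -> F s `<=` F t;
  filtration_right_continuous : forall t, 0 <= t ->
    F t = \bigcap_(s in [set s | t < s]) F s;
  filtration_complete : forall N, Pr.-negligible N -> F 0 N }.

Definition meas_wrt (G : set (set Omega)) (X : Omega -> R) : Prop :=
  forall C : set R, measurable C -> G (X @^-1` C).

(* Jointly measurable and adapted on [0, T]. *)
Definition measurable_adapted (T : R) (X : R -> Omega -> R) : Prop :=
  measurable_fun (`[0, T]%classic `*` [set: Omega])
    (fun z : measurableTypeR R * Omega => X z.1 z.2)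
  /\ forall t, 0 <= t <= T -> meas_wrt (F t) (X t).

Definition measurable_adapted_vec k (T : R) (X : R -> Omega -> 'cV[R]_k) :=
  forall i, measurable_adapted T (fun t omega => X t omega i 0).

Definition L2T_sqnorm k (T : R) (v : R -> Omega -> 'cV[R]_k) : \bar R :=
  (\int[Pr]_omega \int[mu]_(t in `[0%R, T]) (sqnorm (v t omega))%:E)%E.

Definition admissible_control m (T : R) (u : R -> Omega -> 'cV[R]_m) : Prop :=
  measurable_adapted_vec T u /\ (L2T_sqnorm T u < +oo)%E.

(* The joint law of an increment is fixed through its one-dimensional
   projections; its independence of [F t] is independence of the sigma-algebra
   generated by its components. *)
Record wiener_process q (K : 'M[R]_q) (w : R -> Omega -> 'cV[R]_q) : Prop := {
  wiener_adapted : forall t i, 0 <= t ->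
    meas_wrt (F t) (fun omega => w t omega i 0);
  wiener_start : {ae Pr, forall omega, w 0 omega = 0};
  wiener_continuous :
    {ae Pr, forall omega, {within `[0, +oo[, continuous (fun t => w t omega)}};
  wiener_gaussian : forall t h (a : 'cV[R]_q), 0 <= t -> 0 <= h ->
    forall C : set R, measurable C ->
    Pr [set omega | C (dotv a (w (t + h) omega - w t omega))]
    = gaussian_law 0 (h * dotv a (K *m a)) C;
  wiener_independent : forall t h, 0 <= t -> 0 <= h ->
    forall A D : set Omega, F t A ->
    <<s [set E : set Omega | exists (i : 'I_q) (C : set R), measurable C /\
           E = [set omega | C ((w (t + h) omega - w t omega) i 0)]] >> D ->
    Pr (A `&` D) = (Pr A * Pr D)%E;
  wiener_covariance : forall t i j, 0 <= t ->
    ('E_Pr[fun omega => (w t omega i 0 * w t omega j 0)%R] = (t * K i j)%:E)%E }.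

(* The process equal to [sp_coef k] on the interval
   ]sp_time k, sp_time k.+1], for k < sp_size, and to 0 elsewhere. *)
Record simple_process := SimpleProcess {
  sp_size : nat;
  sp_time : nat -> R;
  sp_coef : nat -> Omega -> R;
  sp_time_ge0 : 0 <= sp_time 0%N;
  sp_time_nd : forall k, sp_time k <= sp_time k.+1;
  sp_coef_meas : forall k, meas_wrt (F (sp_time k)) (sp_coef k);
  sp_coef_bounded : forall k, exists c, forall omega, `|sp_coef k omega| <= c }.

Definition sp_val (H : simple_process) (s : R) (omega : Omega) : R :=
  \sum_(k < sp_size H)
    sp_coef H k omega * \1_(`]sp_time H k, sp_time H k.+1]%classic) s.

Definition sp_integral (W : R -> Omega -> R) (H : simple_process) (t : R)
    (omega : Omega) : R :=
  \sum_(k < sp_size H) sp_coef H k omega *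
    (W (Num.min (sp_time H k.+1) t) omega - W (Num.min (sp_time H k) t) omega).

Definition cvg0_in_probability (Z : nat -> Omega -> \bar R) : Prop :=
  forall eps : R, 0 < eps ->
    (fun k => Pr [set omega | (eps%:E <= Z k omega)%E]) @ \oo --> 0%E.

(* [Y] is a version of the Ito integral of [H] with respect to [W] over [0, t]:
   [H] is measurable, adapted and almost surely square integrable in time, and
   [Y] is the limit in probability of the integrals of simple processes which
   converge to [H] in L^2([0, t]) in probability. *)
Definition ito_integral (W : R -> Omega -> R) (t : R) (H : R -> Omega -> R)
    (Y : Omega -> R) : Prop :=
  [/\ measurable_adapted t H,
      {ae Pr, forall omega,
        (\int[mu]_(s in `[0%R, t]) (H s omega ^+ 2)%:E < +oo)%E},
      meas_wrt (F t) Y &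
      exists Hk : nat -> simple_process,
        cvg0_in_probability (fun k omega =>
          \int[mu]_(s in `[0%R, t])
            ((sp_val (Hk k) s omega - H s omega) ^+ 2)%:E)%E /\
        cvg0_in_probability (fun k omega =>
          (`|sp_integral W (Hk k) t omega - Y omega|)%:E)].

Variables (n m q : nat) (S : sde_coeffs R n m q).
Variable w : R -> Omega -> 'cV[R]_q.

Record sde_solution (T : R) (x0 : 'cV[R]_n) (u : R -> Omega -> 'cV[R]_m)
    (x : R -> Omega -> 'cV[R]_n) : Prop := {
  sol_adapted : measurable_adapted_vec T x;
  sol_continuous :
    {ae Pr, forall omega, {within `[0, T], continuous (fun t => x t omega)}};
  sol_drift_integrable : {ae Pr, forall omega, forall i : 'I_n,
    mu.-integrable `[0, T]
      (fun s => (sde_drift S (x s omega) (u s omega) i 0)%:E)};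
  sol_equation : forall t, 0 <= t <= T ->
    exists J : 'I_n -> 'I_q -> Omega -> R,
      (forall i j, ito_integral (fun s omega => w s omega j 0) t
         (fun s omega => sde_diffusion S (x s omega) (u s omega) i j) (J i j))
      /\ {ae Pr, forall omega, forall i : 'I_n,
           x t omega i 0 = x0 i 0
             + \int[mu]_(s in `[0, t]) sde_drift S (x s omega) (u s omega) i 0
             + \sum_j J i j omega} }.

(* Existence and pathwise uniqueness, on every time horizon. *)
Definition sde_well_posed : Prop :=
  forall (T : R) (x0 : 'cV[R]_n) (u : R -> Omega -> 'cV[R]_m),
    0 < T -> admissible_control T u ->
    exists x, sde_solution T x0 u x /\
      forall x', sde_solution T x0 u x' ->
        {ae Pr, forall omega, forall t, 0 <= t <= T -> x' t omega = x t omega}.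

Record sde_standing_assumptions : Prop := {
  sde_f0 : sde_f S 0 = 0;
  sde_g0 : forall i, sde_g S i 0 = 0;
  sde_gamma0 : forall j, sde_gamma S j 0 = 0;
  sde_g_zero_or_nonconstant : forall i,
    (forall z, sde_g S i z = 0) \/ ~ (exists c, forall z, sde_g S i z = c);
  sde_f_borel : borel_map (sde_f S);
  sde_g_borel : forall i, borel_map (sde_g S i);
  sde_gamma_borel : forall j, borel_map (sde_gamma S j);
  sde_unique_global_solution : sde_well_posed }.

Definition multiplicative_controls (u : R -> Omega -> 'cV[R]_m) (t : R)
    (omega : Omega) : 'cV[R]_m :=
  \col_i (if `[< forall z, sde_g S i z = 0 >] then 0 else u t omega i 0).

Definition deterministic_on k (T : R) (v : R -> Omega -> 'cV[R]_k) : Prop :=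
  exists v0 : R -> 'cV[R]_k,
    forall t, 0 <= t <= T -> {ae Pr, forall omega, v t omega = v0 t}.

End Stochastic.

(* Main.v *)
Require Import Defs.
From HB Require Import structures.
From mathcomp Require Import all_boot all_order all_algebra.
From mathcomp Require Import all_classical all_reals all_analysis.
From mathcomp Require Import measurable_realfun.
From mathcomp Require Import ring lra.
From mathcomp Require complex.

(** The quadratic form [V x = x^T P^-1 x] is a storage function of the system. Along
    a solution with drift [b] and diffusion [h], its Ito drift is
    [2 <x, P^-1 b> + tr (K h^T P^-1 h)]. Completing a square in the control and using
    Young's inequality with weight [delta], the Gramian inequality bounds it by
    [u^T calU u + kappa V x] with [kappa = |u~|^2 / delta^2]
    ([gramian_dissipation]). As [u~] is deterministic, [kappa] leaves the
    expectation, so that [y t = E V (x t)] satisfies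
    [y t <= |calU^(1/2) u|^2 + int_0^t kappa y], and Gronwall's inequality bounds
    [y]. Finally [<x, p_k>^2 <= lambda_k V x] by Cauchy-Schwarz
    ([eigenvector_bound]).

    The work is to bound [E V (x t)] by the mean of the time integral of this Ito
    drift, where the stochastic integral is given, for each time separately, as a
    limit in probability of integrals of simple processes. Since [V] is quadratic
    and an upper bound suffices, the means of its terms can be computed along
    approximations.

    The processes are stopped when an accumulated cost, which dominates the drift,
    the squared diffusion and the gain, reaches a level [N] ([below]). The cost is a
    time integral, so that the stopping is adapted by [prog_integral]. The stopped
    diffusion is a limit in [L^2] of simple processes [H] of bounded energy
    ([stopped_approximation]), and their integrals [M] converge to the given
    stochastic integral, in probability and at every earlier time, on the event
    that the stopping has not occurred; this is a Lenglart bound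
    ([stepI_lenglart], [stopped_integral_cvg]).

    Before the stopping, the state is [A + J] with [A] the integral of the stopped
    drift and [J] the stochastic integral. The expectation of the quadratic form of
    [A + M] is computed term by term: [A A^T] by integration by parts on each path,
    [A M^T] by the martingale property of [M], which replaces [M] at the final time
    by [M] at the time of the drift, and [M M^T] by the isometry
    ([cut_energy_cvg]). Here the drift is cut off at a size [r], to keep all
    products integrable. Fatou's lemma along convergence in probability
    ([fatou_prob]), first as [H] converges and then as [r] grows, yields
    [energy_inequality]. After Gronwall's inequality [N] tends to infinity. *)

Set Implicit Arguments.
Unset Strict Implicit.
Unset Printing Implicit Defensive.

Import Order.TTheory GRing.Theory Num.Theory.
Import numFieldNormedType.Exports.

Local Open Scope classical_set_scope.
Local Open Scope ring_scope.

(** * Inner products and the positive semidefinite square root *)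
Section PsdSqrt.
Import complex.
Variable R : realType.

Lemma dotvE n (u v : 'cV[R]_n) : dotv u v = (u^T *m v) 0 0.
Proof. by rewrite mxE; apply: eq_bigr => i _; rewrite !mxE. Qed.

Lemma dotvC n (u v : 'cV[R]_n) : dotv u v = dotv v u.
Proof. by apply: eq_bigr => i _; rewrite mulrC. Qed.

Lemma dotvDl n (u v w : 'cV[R]_n) : dotv (u + v) w = dotv u w + dotv v w.
Proof. by rewrite -big_split; apply: eq_bigr => i _; rewrite mxE mulrDl. Qed.

Lemma dotvDr n (u v w : 'cV[R]_n) : dotv w (u + v) = dotv w u + dotv w v.
Proof. by rewrite !(dotvC w) dotvDl. Qed.

Lemma dotvZl n a (u w : 'cV[R]_n) : dotv (a *: u) w = a * dotv u w.
Proof. by rewrite mulr_sumr; apply: eq_bigr => i _; rewrite mxE mulrA. Qed.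

Lemma dotvZr n a (u w : 'cV[R]_n) : dotv w (a *: u) = a * dotv w u.
Proof. by rewrite dotvC dotvZl dotvC. Qed.

Lemma dotvNl n (u w : 'cV[R]_n) : dotv (- u) w = - dotv u w.
Proof. by rewrite -scaleN1r dotvZl mulN1r. Qed.

Lemma dotvNr n (u w : 'cV[R]_n) : dotv w (- u) = - dotv w u.
Proof. by rewrite dotvC dotvNl dotvC. Qed.

Lemma dotv_trmx n k (A : 'M[R]_(n, k)) (u : 'cV[R]_n) (v : 'cV[R]_k) :
  dotv u (A *m v) = dotv (A^T *m u) v.
Proof. by rewrite !dotvE trmx_mul trmxK mulmxA. Qed.

Lemma sqnorm_ge0 n (v : 'cV[R]_n) : 0 <= sqnorm v.
Proof. by apply: sumr_ge0 => i _; rewrite -expr2 sqr_ge0. Qed.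

Lemma sqnorm_eq0 n (v : 'cV[R]_n) : sqnorm v = 0 -> v = 0.
Proof.
move=> /psumr_eq0P h; apply/matrixP => i j; rewrite ord1 mxE.
by apply/eqP; rewrite -sqrf_eq0 expr2 h// => k _; rewrite -expr2 sqr_ge0.
Qed.

Lemma posdef_psd n (A : 'M[R]_n) : posdef A -> psd A.
Proof.
move=> [sA pA]; split=> // v; have [->|/pA/ltW//] := eqVneq v 0.
by rewrite mulmx0 /dotv big1// => i _; rewrite mxE mul0r.
Qed.

Lemma psd_eigenvalue_ge0 n (A : 'M[R]_n) a : psd A -> eigenvalue A a -> 0 <= a.
Proof.
move=> [_ pA] /eigenvalueP[v vA v0].
have := pA v^T; rewrite dotvE trmxK mulmxA vA -scalemxAl mxE.
have -> : (v *m v^T) 0 0 = sqnorm v^T.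
  by rewrite /sqnorm dotvE trmxK.
rewrite pmulr_lge0// lt_neqAle sqnorm_ge0 andbT eq_sym.
apply: contraNneq v0 => /sqnorm_eq0 v0.
by rewrite -(trmxK v) v0 trmx0.
Qed.

Lemma interpolation (f : R -> R) (s : seq R) : uniq s ->
  exists p : {poly R}, forall a, a \in s -> p.[a] = f a.
Proof.
elim: s => [_|a s IH /= /andP[aNs us]]; first by exists 0.
have [p Hp] := IH us; pose q : {poly R} := \prod_(b <- s) ('X - b%:P).
have qa0 : q.[a] != 0 by rewrite -/(root q a) root_prod_XsubC.
exists (p + ((f a - p.[a]) / q.[a]) *: q) => b.
rewrite inE hornerD hornerZ => /orP[/eqP ->|bs].
  by rewrite divfK// addrC subrK.
have /eqP-> : root q b by rewrite root_prod_XsubC.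
by rewrite mulr0 addr0 Hp.
Qed.

Lemma symmetric_horner n (A : 'M[R]_n.+1) (p : {poly R}) :
  A^T = A -> (horner_mx A p)^T = horner_mx A p.
Proof.
move=> sA; elim/poly_ind: p => [|p c IH]; first by rewrite rmorph0 trmx0.
rewrite rmorphD rmorphM /= horner_mx_X horner_mx_C linearD /= tr_scalar_mx.
congr (_ + _); rewrite -[_ * A]/(_ *m A) trmx_mul IH sA.
rewrite -[LHS]/(A * _) -{1}(horner_mx_X A) -rmorphM mulrC rmorphM /=.
by rewrite horner_mx_X.
Qed.

(** Over [R[i]] a real symmetric matrix is unitarily diagonalizable, so it is
    annihilated by any real polynomial that vanishes at its real eigenvalues. *)
Lemma symmetric_annihilated n (A : 'M[R]_n.+1) : A^T = A ->
  exists s : seq R, [/\ uniq s, forall a, a \in s -> eigenvalue A a &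
    forall p : {poly R}, (forall a, a \in s -> p.[a] = 0) -> horner_mx A p = 0].
Proof.
move=> sA; pose f := (real_complex R); set B := map_mx f A.
have hB : B \is hermsymmx.
  apply: realsym_hermsym.
    by apply/is_hermitianmxP; rewrite expr0 scale1r map_mx_id// /B map_trmx sA.
  by apply/mxOverP => i j; rewrite mxE complex_real.
have /hermitian_normalmx/orthomx_spectralP := hB.
set P := spectralmx B; set d := spectral_diag B => BE.
have Pu : P \in unitmx by exact: spectral_unit.
have dr i : d 0 i = f (complex.Re (d 0 i)).
  apply/esym/RRe_real.
  by have /mxOverP/(_ 0 i) := hermitian_spectral_diag_real hB.
exists (undup [seq complex.Re (d 0 i) | i <- enum 'I_n.+1]); split.
- exact: undup_uniq.
- move=> a; rewrite mem_undup => /mapP[i _ ->].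
  suff: eigenvalue B (d 0 i) by rewrite dr eigenvalue_map.
  apply/eigenvalueP; exists (row i P).
    by rewrite -/B [in LHS]BE -row_mul !mulmxA mulmxV// mul1mx row_mul row_diag_mx
      -scalemxAl -rowE.
  apply/eqP => Pi0; have := mulmxV Pu => /(congr1 (row i)).
  rewrite row_mul Pi0 mul0mx => /matrixP/(_ 0 i); rewrite !mxE eqxx => /eqP.
  by rewrite eq_sym oner_eq0.
(* Conjugation by the spectral matrix turns p(A) into the diagonal matrix of the
   values of p at the eigenvalues. *)
- move=> p pA; apply: (@map_mx_inj _ _ f); rewrite map_mx0 map_horner_mx -/B.
  rewrite BE horner_mx_uconjC//.
  rewrite horner_mx_diag.
  rewrite (_ : diag_mx _ = 0) ?mulmx0 ?mul0mx//.
  apply/matrixP => i j; rewrite !mxE dr horner_map/= pA ?rmorph0 ?mul0rn//.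
  by rewrite mem_undup; apply/mapP; exists i => //; rewrite mem_enum.
Qed.

(** The square root is [Q^2], where [Q] is a polynomial in [A] that interpolates
    the fourth root on the spectrum: squares of symmetric matrices are
    automatically positive semidefinite. *)
Lemma psd_sqrt_exists n (A : 'M[R]_n) : psd A ->
  exists S : 'M[R]_n, psd S /\ S *m S = A.
Proof.
case: n A => [|n] A psdA.
  exists 0; split; last by apply/matrixP => -[].
  by split; [rewrite trmx0|move=> v; rewrite /dotv big_ord0].
have [sA _] := psdA; have [s [us sev sann]] := symmetric_annihilated sA.
have [p pE] := interpolation (fun x => Num.sqrt (Num.sqrt x)) us.
pose Q := horner_mx A p; have sQ : Q^T = Q by exact: symmetric_horner.
exists (Q *m Q); split.
  split; first by rewrite trmx_mul sQ.
  by move=> v; rewrite -mulmxA dotv_trmx sQ sqnorm_ge0.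
have : horner_mx A (p * p * (p * p) - 'X) = 0.
  apply: sann => a sa; have a0 := psd_eigenvalue_ge0 psdA (sev _ sa).
  have r2 := sqr_sqrtr (sqrtr_ge0 a); have r4 := sqr_sqrtr a0.
  rewrite hornerD hornerN hornerX !hornerM pE//.
  set y := Num.sqrt (Num.sqrt a) in r2 *.
  have ay : a = y ^+ 2 * y ^+ 2 by rewrite r2 -expr2 r4.
  by rewrite [X in _ - X]ay; ring.
rewrite rmorphB !rmorphM/= horner_mx_X => /eqP; rewrite subr_eq0 => /eqP.
by [].
Qed.

Lemma sqrtmxP n (A : 'M[R]_n) : psd A ->
  psd (sqrtmx A) /\ sqrtmx A *m sqrtmx A = A.
Proof.
move=> /psd_sqrt_exists[S SA].
by have := @xgetPex _ (0 : 'M[R]_n) [set S | psd S /\ S *m S = A] (ex_intro _ S SA).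
Qed.

Lemma dotv_sqrtmx n (A : 'M[R]_n) (v : 'cV[R]_n) : psd A ->
  sqnorm (sqrtmx A *m v) = dotv v (A *m v).
Proof.
move=> /sqrtmxP[[sS _] SS].
by rewrite /sqnorm dotv_trmx sS mulmxA SS dotvC.
Qed.

Lemma sqfrob_trace n k (A : 'M[R]_(n, k)) : sqfrob A = \tr (A^T *m A).
Proof.
rewrite /sqfrob /mxtrace exchange_big; apply: eq_bigr => j _.
by rewrite mxE; apply: eq_bigr => i _; rewrite !mxE expr2.
Qed.

Lemma sqfrob_sqrtmx n k (A : 'M[R]_n) (Y : 'M[R]_(n, k)) : psd A ->
  sqfrob (sqrtmx A *m Y) = \tr (Y^T *m A *m Y).
Proof.
move=> /sqrtmxP[[sS _] SS].
rewrite sqfrob_trace trmx_mul sS !mulmxA; congr (\tr (_ *m _)).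
by rewrite -mulmxA SS.
Qed.

Lemma sqfrob_sqrtmx2 n k (A : 'M[R]_n) (K : 'M[R]_k) (Y : 'M[R]_(n, k)) :
  psd A -> psd K ->
  sqfrob (sqrtmx A *m Y *m sqrtmx K) = \tr (K *m (Y^T *m A *m Y)).
Proof.
move=> psdA /sqrtmxP[[sS _] SS].
rewrite -mulmxA sqfrob_sqrtmx// trmx_mul sS.
set W := Y^T *m A *m Y; set L := sqrtmx K.
have -> : L *m Y^T *m A *m (Y *m L) = L *m (W *m L) by rewrite /W !mulmxA.
by rewrite mxtrace_mulC -mulmxA SS mxtrace_mulC.
Qed.

Lemma tr_quadratic n k (A : 'M[R]_n) (K : 'M[R]_k) (Y : 'M[R]_(n, k)) :
  K^T = K ->
  \tr (K *m (Y^T *m A *m Y)) =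
  \sum_i \sum_i' A i i' * \sum_j \sum_j' K j j' * (Y i j * Y i' j').
Proof.
move=> sK; rewrite /mxtrace.
pose G i i' j j' := A i i' * (K j j' * (Y i j * Y i' j')).
transitivity (\sum_j' \sum_j \sum_i' \sum_i G i i' j j').
  apply: eq_bigr => j _; rewrite mxE; apply: eq_bigr => j' _.
  rewrite mxE mulr_sumr; apply: eq_bigr => i' _.
  rewrite mxE mulr_suml mulr_sumr; apply: eq_bigr => i _.
  rewrite mxE /G -[in LHS]sK mxE; ring.
transitivity (\sum_i \sum_i' \sum_j \sum_j' G i i' j j'); last first.
  apply: eq_bigr => i _; apply: eq_bigr => i' _.
  by rewrite mulr_sumr; apply: eq_bigr => j _; rewrite mulr_sumr.
rewrite exchange_big/= pair_big/= [RHS]pair_big/=.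
under eq_bigr do rewrite exchange_big/= pair_big/=.
by rewrite exchange_big/=; apply: eq_bigr => -[i i'] _; rewrite pair_big.
Qed.

End PsdSqrt.

(** * The dissipation inequality of a simplified reachability Gramian *)
Section Dissipation.
Variables (R : realType).

Definition quadf n (X : 'M[R]_n) (x : 'cV[R]_n) : R := dotv x (X *m x).

(** The Ito correction [tr (K h^T X h)] of [x^T X x] for a diffusion matrix [h]. *)
Definition itoq n q (X : 'M[R]_n) (K : 'M[R]_q) (h : 'M[R]_(n, q)) : R :=
  \sum_i \sum_i' X i i' * \sum_j \sum_j' K j j' * (h i j * h i' j').

Lemma posdef_unitmx n (A : 'M[R]_n) : posdef A -> A \in unitmx.
Proof.
move=> [_ pA]; rewrite -row_free_unit -kermx_eq0; apply/eqP/row_matrixP => i.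
rewrite row0; have /sub_kermxP := row_sub i (kermx A).
set v := row i _ => vA; apply/eqP/negPn/negP => v0.
have := pA v^T; rewrite -(inj_eq trmx_inj) trmxK trmx0 v0 => /(_ isT).
by rewrite dotvE trmxK mulmxA vA mul0mx mxE ltxx.
Qed.

Lemma invmx_sym n (A : 'M[R]_n) : A^T = A -> (invmx A)^T = invmx A.
Proof. by move=> sA; rewrite trmx_inv sA. Qed.

Lemma psd_invmx n (A : 'M[R]_n) : posdef A -> psd (invmx A).
Proof.
move=> pA; have uA := posdef_unitmx pA; have [sA qA] := posdef_psd pA.
split=> [|v]; first exact: invmx_sym.
have := qA (invmx A *m v); rewrite mulmxA mulmxV// mul1mx.
by rewrite dotvC.
Qed.

Lemma dotv_psd_sym n (A : 'M[R]_n) (u v : 'cV[R]_n) : A^T = A ->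
  dotv u (A *m v) = dotv v (A *m u).
Proof. by move=> sA; rewrite dotv_trmx sA dotvC. Qed.

(** The difference of the two sides is the form of [U] at [v - U^-1 S]. *)
Lemma complete_square m (U : 'M[R]_m) (S v : 'cV[R]_m) : posdef U ->
  2 * dotv v S - dotv v (U *m v) <= dotv S (invmx U *m S).
Proof.
move=> pU; have uU := posdef_unitmx pU; have [sU qU] := posdef_psd pU.
set z := invmx U *m S.
have Uz : U *m z = S by rewrite /z mulmxA mulmxV// mul1mx.
have := qU (v - z); rewrite mulmxBr !dotvDl !dotvDr !dotvNl !dotvNr Uz.
rewrite (dotv_psd_sym z v sU) Uz (dotvC z S); lra.
Qed.

Lemma young_sqfrob n m (a : 'cV[R]_n) (Y : 'M[R]_(n, m)) (v : 'cV[R]_m) (e : R) :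
  0 < e ->
  2 * dotv a (Y *m v) <= e ^+ 2 * sqfrob Y + sqnorm v * e ^- 2 * sqnorm a.
Proof.
move=> e0.
have -> : 2 * dotv a (Y *m v) = \sum_i \sum_j 2 * (a i 0 * (Y i j * v j 0)).
  rewrite mulr_sumr; apply: eq_bigr => i _.
  by rewrite mxE !mulr_sumr.
have -> : e ^+ 2 * sqfrob Y = \sum_i \sum_j e ^+ 2 * Y i j ^+ 2.
  by rewrite mulr_sumr; apply: eq_bigr => i _; rewrite mulr_sumr.
have -> : sqnorm v * e ^- 2 * sqnorm a =
    \sum_i \sum_j (v j 0 / e * a i 0) ^+ 2.
  rewrite mulr_sumr; apply: eq_bigr => i _; rewrite -mulrA mulr_suml.
  by apply: eq_bigr => j _; rewrite !exprMn exprVn; ring.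
rewrite -big_split; apply: ler_sum => i _; rewrite -big_split.
apply: ler_sum => j _ /=.
have -> : 2 * (a i 0 * (Y i j * v j 0)) = 2 * ((e * Y i j) * (v j 0 / e * a i 0)).
  by field; rewrite gt_eqF.
have := sqr_ge0 (e * Y i j - v j 0 / e * a i 0).
rewrite sqrrB exprMn; lra.
Qed.

Variables (n m q : nat) (S : sde_coeffs R n m q) (K : 'M[R]_q).

Lemma trace_double_sum (Z : 'M[R]_q) : K^T = K ->
  \tr (K *m Z) = \sum_i \sum_j K i j * Z i j.
Proof.
move=> sK; rewrite /mxtrace exchange_big/=; apply: eq_bigr => j _.
by rewrite mxE; apply: eq_bigr => i _; rewrite -{1}sK mxE.
Qed.

Lemma itoqE (X : 'M[R]_n) (h : 'M[R]_(n, q)) : K^T = K ->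
  itoq X K h = \sum_i \sum_j K i j * dotv (col i h) (X *m col j h).
Proof.
move=> sK; rewrite /itoq -tr_quadratic// trace_double_sum//.
apply: eq_bigr => i _; apply: eq_bigr => j _; congr (_ * _).
rewrite -mulmxA mxE; apply: eq_bigr => l _; rewrite !mxE; congr (_ * _).
by apply: eq_bigr => k _; rewrite mxE.
Qed.

Lemma Gmx_multiplicative x (v : 'cV[R]_m) :
  Gmx S x *m v =
  Gmx S x *m \col_i (if `[< forall z, sde_g S i z = 0 >] then 0 else v i 0).
Proof.
apply/matrixP => i j; rewrite ord1 !mxE; apply: eq_bigr => k _; rewrite !mxE.
by case: asboolP => // g0; rewrite g0 mxE !mul0r.
Qed.

Lemma dotv_suml k I (r : seq I) (F : I -> 'cV[R]_k) v :
  dotv (\sum_(i <- r) F i) v = \sum_(i <- r) dotv (F i) v.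
Proof.
elim/big_rec2 : _ => [|i y z _ <-]; last by rewrite dotvDl.
by rewrite /dotv big1// => i _; rewrite mxE mul0r.
Qed.

Lemma dotv_sumr k I (r : seq I) (F : I -> 'cV[R]_k) v :
  dotv v (\sum_(i <- r) F i) = \sum_(i <- r) dotv v (F i).
Proof. by rewrite dotvC dotv_suml; apply: eq_bigr => i _; rewrite dotvC. Qed.

Lemma dotv_mulmxl k l (A : 'M[R]_(k, l)) (u : 'cV[R]_l) (v : 'cV[R]_k) :
  dotv (A *m u) v = dotv u (A^T *m v).
Proof. by rewrite dotv_trmx trmxK. Qed.

(** The Gramian inequality bounds the generator of [x^T P^-1 x]: completing the
    square in [v] absorbs the cross terms [S] between the additive part of the
    control and the state, and Young's inequality with weight [delta] those of
    the multiplicative part. *)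
Lemma gramian_dissipation (calU : 'M[R]_m) (delta : R) (P : 'M[R]_n)
    (x : 'cV[R]_n) (v vt : 'cV[R]_m) :
  psd K -> (forall i, sde_g S i 0 = 0) -> (forall j, sde_gamma S j 0 = 0) ->
  sde_f S 0 = 0 ->
  simplified_reachability_gramian S K calU delta P ->
  vt = \col_i (if `[< forall z, sde_g S i z = 0 >] then 0 else v i 0) ->
  2 * dotv x (invmx P *m sde_drift S x v) + itoq (invmx P) K (sde_diffusion S x v)
  <= dotv v (calU *m v) + sqnorm vt * delta ^- 2 * quadf (invmx P) x.
Proof.
move=> psdK g0 gamma0 f0 [pP pcU d0 pU /(_ x) ineq] ->.
set vt' := \col_i _; set X := invmx P in pU ineq *.
have psdX : psd X by exact: psd_invmx.
have [sX qX] := psdX; have [sK _] := psdK.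
have G0 : Gmx S 0 = 0 by apply/matrixP => i j; rewrite !mxE g0 mxE.
have Ga0 : Gammamx S 0 = 0 by apply/matrixP => i j; rewrite !mxE gamma0 mxE.
move: ineq; rewrite /LV G0 Ga0 f0 !subr0 sqfrob_sqrtmx2// tr_quadratic//.
rewrite -/(itoq X K _).
have := young_sqfrob (sqrtmx X *m x) (sqrtmx X *m Gmx S x) vt' d0.
have -> : dotv (sqrtmx X *m x) (sqrtmx X *m Gmx S x *m vt') =
          dotv x (X *m (Gmx S x *m v)).
  have [[sS _] SS] := sqrtmxP psdX.
  by rewrite (Gmx_multiplicative x v) dotvC dotv_trmx sS !mulmxA SS dotvC.
rewrite (dotv_sqrtmx _ psdX) -/(quadf X x).
have := complete_square (Svec S K X x 0) v pU.
set SS := Svec _ _ _ _ _; set UU := Umx _ _ _ _.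
have itoD : itoq X K (sde_diffusion S x v) = itoq X K (Gammamx S x) +
    2 * (dotv v SS - dotv x (X *m (sde_B S *m v))) +
    (dotv v (calU *m v) - dotv v (UU *m v)).
  have colE j : col j (sde_diffusion S x v) = sde_gamma S j x + sde_M S j *m v.
    by apply/matrixP => i k; rewrite ord1 !mxE.
  have colG j : col j (Gammamx S x) = sde_gamma S j x.
    by apply/matrixP => i k; rewrite ord1 !mxE.
  pose cr i j := dotv (sde_M S i *m v) (X *m sde_gamma S j x).
  have -> : dotv v SS = dotv x (X *m (sde_B S *m v)) +
      \sum_i \sum_j K i j * cr i j.
    rewrite /SS /Svec subr0 dotvDr dotv_sumr; congr (_ + _).
      by rewrite -mulmxA -dotv_mulmxl dotv_psd_sym.
    apply: eq_bigr => i _; rewrite dotv_sumr; apply: eq_bigr => j _.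
    by rewrite dotvZr gamma0 subr0 -mulmxA -dotv_mulmxl.
  have -> : dotv v (UU *m v) = dotv v (calU *m v) -
      \sum_i \sum_j K i j * dotv (sde_M S i *m v) (X *m (sde_M S j *m v)).
    rewrite /UU /Umx mulmxBl dotvDr dotvNr; congr (_ - _).
    rewrite mulmx_suml dotv_sumr; apply: eq_bigr => i _.
    rewrite mulmx_suml dotv_sumr; apply: eq_bigr => j _.
    by rewrite -scalemxAl dotvZr -!mulmxA -dotv_mulmxl.
  have crT : \sum_i \sum_j K i j * dotv (sde_gamma S i x) (X *m (sde_M S j *m v)) =
      \sum_i \sum_j K i j * cr i j.
    rewrite exchange_big; apply: eq_bigr => j _; apply: eq_bigr => i _ /=.
    by rewrite dotv_psd_sym// -{1}sK mxE.
  have -> : itoq X K (sde_diffusion S x v) = itoq X K (Gammamx S x) +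
      (\sum_i \sum_j K i j * cr i j + \sum_i \sum_j K i j * cr i j) +
      \sum_i \sum_j K i j * dotv (sde_M S i *m v) (X *m (sde_M S j *m v)).
    rewrite !itoqE// -{1}crT -!big_split/=; apply: eq_bigr => i _.
    rewrite -!big_split/=; apply: eq_bigr => j _.
    by rewrite !colE !colG mulmxDr dotvDl !dotvDr /cr; ring.
  lra.
rewrite itoD /sde_drift !mulmxDr !dotvDr => c1 c2 c3.
have := c3; have := c2; lra.
Qed.
End Dissipation.

(** * Integrable real functions and the theorem of Fubini *)
Section RealIntegrals.
Context d (T : measurableType d) (R : realType).
Variable mu : {measure set T -> \bar R}.
Implicit Types f g : T -> R.

Definition L1 f := mu.-integrable setT (EFin \o f).

Lemma L1_measurable f : L1 f -> measurable_fun setT f.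
Proof. by move=> /measurable_int/measurable_EFinP. Qed.

Lemma L1E f : L1 f -> ((\int[mu]_x f x)%R%:E = \int[mu]_x (f x)%:E)%E.
Proof. by move=> Lf; rewrite fineK//; exact: integrable_fin_num. Qed.

Lemma L1D f g : L1 f -> L1 g -> L1 (fun x => f x + g x).
Proof. exact: integrableD. Qed.

Lemma L1Zl a f : L1 f -> L1 (fun x => a * f x).
Proof. exact: integrableZl. Qed.

Lemma L1N f : L1 f -> L1 (fun x => - f x).
Proof. exact: integrableN. Qed.

Lemma L1B f g : L1 f -> L1 g -> L1 (fun x => f x - g x).
Proof. by move=> Lf Lg; apply: L1D => //; exact: L1N. Qed.

Lemma L1_abs f : L1 f -> L1 (fun x => `|f x|).
Proof. exact: integrable_norm. Qed.

Lemma L1_sum I (r : seq I) (F : I -> T -> R) : (forall i, L1 (F i)) ->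
  L1 (fun x => \sum_(i <- r) F i x).
Proof.
move=> LF; apply: (@eq_integrable _ _ _ _ _ measurableT
  (fun x => \sum_(i <- r) (F i x)%:E)%E).
  by move=> x _ /=; rewrite sumEFin.
by apply: integrable_sum => // i _; exact: LF.
Qed.

Lemma L1_le f g : measurable_fun setT f -> (forall x, `|f x| <= g x) ->
  L1 g -> L1 f.
Proof.
move=> mf fg; apply: le_integrable => //; first exact/measurable_EFinP.
by move=> x _ /=; rewrite lee_fin (le_trans (fg x))// ler_norm.
Qed.

Lemma L1_ge0 f : measurable_fun setT f -> (forall x, 0 <= f x) ->
  (\int[mu]_x (f x)%:E < +oo)%E -> L1 f.
Proof.
move=> mf f0 foo; apply/integrableP; split; first exact/measurable_EFinP.
by under eq_integral do rewrite /= ger0_norm//.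
Qed.

Lemma L1_ge0P f : (forall x, 0 <= f x) -> L1 f -> (\int[mu]_x (f x)%:E < +oo)%E.
Proof. by move=> _ /integrable_lty; exact. Qed.

Lemma RintD f g : L1 f -> L1 g ->
  \int[mu]_x (f x + g x) = \int[mu]_x f x + \int[mu]_x g x.
Proof. by move=> Lf Lg; rewrite RintegralD. Qed.

Lemma RintB f g : L1 f -> L1 g ->
  \int[mu]_x (f x - g x) = \int[mu]_x f x - \int[mu]_x g x.
Proof. by move=> Lf Lg; rewrite RintegralB. Qed.

Lemma RintZ a f : L1 f -> \int[mu]_x (a * f x) = a * \int[mu]_x f x.
Proof. by move=> Lf; rewrite RintegralZl. Qed.

Lemma RintN f : L1 f -> \int[mu]_x (- f x) = - \int[mu]_x f x.
Proof.
move=> Lf; under eq_Rintegral do rewrite -mulN1r.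
by rewrite RintZ// mulN1r.
Qed.

Lemma Rint_sum I (r : seq I) (F : I -> T -> R) : (forall i, L1 (F i)) ->
  \int[mu]_x (\sum_(i <- r) F i x) = \sum_(i <- r) \int[mu]_x F i x.
Proof.
move=> LF; elim: r => [|i r IH].
  by under eq_Rintegral do rewrite big_nil; rewrite Rintegral_cst// mul0r big_nil.
under eq_Rintegral do rewrite big_cons.
by rewrite RintD ?IH ?big_cons//; exact: L1_sum.
Qed.

Lemma Rint_le f g : L1 f -> L1 g -> (forall x, f x <= g x) ->
  \int[mu]_x f x <= \int[mu]_x g x.
Proof. by move=> Lf Lg fg; rewrite le_Rintegral. Qed.

Lemma Rint_abs f : L1 f -> `|\int[mu]_x f x| <= \int[mu]_x `|f x|.
Proof. by move=> Lf; rewrite le_normr_Rintegral. Qed.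

Lemma Rint_ae f g : measurable_fun setT f -> measurable_fun setT g ->
  {ae mu, forall x, f x = g x} -> \int[mu]_x f x = \int[mu]_x g x.
Proof.
move=> mf mg fg; congr fine; apply: ae_eq_integral => //.
- exact/measurable_EFinP.
- exact/measurable_EFinP.
- by apply: filterS fg => x -> _.
Qed.

Lemma L1_sqr_prod f g : measurable_fun setT f -> measurable_fun setT g ->
  L1 (fun x => f x ^+ 2) -> L1 (fun x => g x ^+ 2) -> L1 (fun x => f x * g x).
Proof.
move=> mf mg Lf Lg; apply: (@L1_le _ (fun x => f x ^+ 2 + g x ^+ 2)).
- exact: measurable_funM.
- move=> x; rewrite ler_norml.
  have := sqr_ge0 (f x + g x); have := sqr_ge0 (f x - g x).
  have := sqr_ge0 (f x); have := sqr_ge0 (g x).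
  by rewrite sqrrB sqrrD => *; apply/andP; split; lra.
- exact: L1D.
Qed.

Lemma L1_sqrD f g : measurable_fun setT f -> measurable_fun setT g ->
  L1 (fun x => f x ^+ 2) -> L1 (fun x => g x ^+ 2) ->
  L1 (fun x => (f x + g x) ^+ 2).
Proof.
move=> mf mg Lf Lg; apply: (@L1_le _ (fun x => 2 * f x ^+ 2 + 2 * g x ^+ 2)).
- exact/measurable_funX/measurable_funD.
- move=> x; rewrite ger0_norm ?sqr_ge0//.
  have := sqr_ge0 (f x - g x); rewrite sqrrB sqrrD; lra.
- by apply: L1D; exact: L1Zl.
Qed.

Lemma L1_sqr_sum I (r : seq I) (F : I -> T -> R) :
  (forall i, measurable_fun setT (F i)) ->
  (forall i, L1 (fun x => F i x ^+ 2)) ->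
  L1 (fun x => (\sum_(i <- r) F i x) ^+ 2).
Proof.
move=> mF LF; elim: r => [|i r IH].
  under eq_fun do rewrite big_nil expr0n/=.
  exact: integrable0.
under eq_fun do rewrite big_cons.
by apply: L1_sqrD => //; exact: measurable_sum.
Qed.

End RealIntegrals.

Section FiniteMeasure.
Context d (T : measurableType d) (R : realType).
Variable mu : {finite_measure set T -> \bar R}.
Implicit Types f g : T -> R.

Lemma L1_bounded f (c : R) : measurable_fun setT f ->
  (forall x, `|f x| <= c) -> L1 mu f.
Proof.
move=> mf fc; apply: (@L1_le _ _ _ _ _ (fun=> c)) => //.
exact: finite_measure_integrable_cst.
Qed.

Lemma L1_cst c : L1 mu (fun=> c).
Proof. exact: finite_measure_integrable_cst. Qed.

Lemma L1_of_sqr f : measurable_fun setT f -> L1 mu (fun x => f x ^+ 2) -> L1 mu f.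
Proof.
move=> mf L2; apply: (@L1_le _ _ _ _ _ (fun x => f x ^+ 2 + 1)) => //.
- move=> x; rewrite ler_norml.
  have := sqr_ge0 (f x + 1); have := sqr_ge0 (f x - 1).
  by rewrite sqrrB sqrrD !expr1n !mulr1 => *; apply/andP; split; lra.
- by apply: L1D => //; exact: L1_cst.
Qed.

Lemma L1M_bounded f g (c : R) : measurable_fun setT f -> L1 mu g ->
  (forall x, `|f x| <= c) -> L1 mu (fun x => f x * g x).
Proof.
move=> mf Lg fc; apply: (@L1_le _ _ _ _ _ (fun x => c * `|g x|)).
- by apply: measurable_funM => //; exact: L1_measurable Lg.
- by move=> x; rewrite normrM ler_wpM2r.
- by apply: L1Zl; exact: L1_abs.
Qed.

End FiniteMeasure.

Section ProductMeasure.
Context d1 d2 (T1 : measurableType d1) (T2 : measurableType d2) (R : realType).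
Variable m1 : {finite_measure set T1 -> \bar R}.
Variable m2 : {finite_measure set T2 -> \bar R}.
Implicit Type f : T1 -> T2 -> R.

Definition jmeas f := measurable_fun setT (fun z : T1 * T2 => f z.1 z.2).

(** Integrability on the product, for functions given in curried form: these are
    the processes, with a time and a sample as arguments. *)
Definition L1prod f := (m1 \x m2)%E.-integrable setT (fun z => (f z.1 z.2)%:E).

Lemma jmeas1 f x : jmeas f -> measurable_fun setT (f x).
Proof.
by move=> jf; apply: (@measurable_fun_pair2 _ _ _ _ _ _ (fun z : T1 * T2 => f z.1 z.2)).
Qed.

Lemma jmeas2 f y : jmeas f -> measurable_fun setT (f ^~ y).
Proof.
by move=> jf; apply: (@measurable_fun_pair1 _ _ _ _ _ _ (fun z : T1 * T2 => f z.1 z.2)).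
Qed.

Lemma L1prod_bounded f (c : R) : jmeas f -> (forall x y, `|f x y| <= c) ->
  L1prod f.
Proof.
move=> mf fc; apply/integrableP; split; first exact/measurable_EFinP.
apply: (@le_lt_trans _ _ (\int[m1 \x m2]_x (cst c%:E x))%E).
  apply: ge0_le_integral => //.
  - by apply: measurableT_comp => //; exact/measurable_EFinP.
  - by move=> z _; rewrite /= lee_fin.
rewrite integral_cst//= -setXTT product_measure1E// lte_mul_pinfty//.
- by rewrite lee_fin (le_trans _ (fc point point)).
- by rewrite -ge0_fin_numE ?mule_ge0// fin_numM// fin_num_measure.
Qed.

Lemma L1prod_measurable f : L1prod f -> jmeas f.
Proof. by move=> /measurable_int/measurable_EFinP. Qed.

Lemma L1prod_le f g : jmeas f -> (forall x y, `|f x y| <= g x y) ->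
  L1prod g -> L1prod f.
Proof.
move=> mf fg; apply: le_integrable => //; first exact/measurable_EFinP.
by move=> z _ /=; rewrite lee_fin (le_trans (fg _ _))// ler_norm.
Qed.

Lemma L1prod_ge0 f : jmeas f -> (forall x y, 0 <= f x y) ->
  (\int[m2]_y \int[m1]_x (f x y)%:E < +oo)%E -> L1prod f.
Proof.
move=> mf f0 foo; apply/integrable21ltyP; first exact/measurable_EFinP.
by under eq_integral do under eq_integral do rewrite /= ger0_norm//.
Qed.

Lemma L1prod_inner1 f : L1prod f -> L1 m1 (fun x => \int[m2]_y f x y).
Proof.
move=> Lf; have int1 := ae_integrable1 Lf.
have iF := integrable_fubini_F Lf.
apply/integrableP; split.
  apply/measurable_EFinP; apply: measurableT_comp => //.
  exact: measurable_int iF.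
have /integrableP[_] := iF; rewrite [X in (X < _)%E -> _](_ : _ =
  (\int[m1]_x `|(\int[m2]_y f x y)%:E|)%E)//.
apply: ge0_ae_eq_integral => //.
- by apply: measurableT_comp => //; exact: measurable_int iF.
- apply: measurableT_comp => //; apply/measurable_EFinP; apply: measurableT_comp => //.
  exact: measurable_int iF.
- by apply: filterS int1 => x ix _; exact: (congr1 abse (esym (L1E ix))).
Qed.

Lemma RFubini1 f : L1prod f ->
  ((\int[m1]_x \int[m2]_y f x y)%R%:E = \int[m1 \x m2]_z (f z.1 z.2)%:E)%E.
Proof.
move=> Lf; have int1 := ae_integrable1 Lf.
have iF := integrable_fubini_F Lf.
rewrite L1E; last exact: L1prod_inner1.
rewrite -integral12_prod_meas1//.
apply: ae_eq_integral => //.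
- apply/measurable_EFinP; apply: measurableT_comp => //.
  exact: measurable_int iF.
- exact: measurable_int iF.
- by apply: filterS int1 => x ix _; exact: (L1E ix).
Qed.

End ProductMeasure.

Section RealFubini.
Context d1 d2 (T1 : measurableType d1) (T2 : measurableType d2) (R : realType).
Variable m1 : {finite_measure set T1 -> \bar R}.
Variable m2 : {finite_measure set T2 -> \bar R}.
Implicit Type f : T1 -> T2 -> R.

Lemma L1prod_swap f : L1prod m1 m2 f -> L1prod m2 m1 (fun y x => f x y).
Proof.
move=> Lf; have mf := L1prod_measurable Lf.
apply/integrable12ltyP.
  apply/measurable_EFinP.
  apply: (@measurableT_comp _ _ _ _ _ _ (fun z : T1 * T2 => f z.1 z.2) _
    (fun z : T2 * T1 => (z.2, z.1))) => //.
  by apply: measurable_fun_pair.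
by have /integrable21ltyP := Lf; apply; exact/measurable_EFinP.
Qed.

Lemma L1prod_inner2 f : L1prod m1 m2 f -> L1 m2 (fun y => \int[m1]_x f x y).
Proof. by move=> /L1prod_swap/L1prod_inner1. Qed.

Lemma RFubini2 f : L1prod m1 m2 f ->
  ((\int[m2]_y \int[m1]_x f x y)%R%:E = \int[m1 \x m2]_z (f z.1 z.2)%:E)%E.
Proof.
move=> Lf; rewrite (RFubini1 (L1prod_swap Lf)).
by rewrite -(integral12_prod_meas1 (L1prod_swap Lf)) -integral21_prod_meas1.
Qed.

Lemma RFubini f : L1prod m1 m2 f ->
  \int[m1]_x \int[m2]_y f x y = \int[m2]_y \int[m1]_x f x y.
Proof. by move=> Lf; apply: EFin_inj; rewrite RFubini1// RFubini2. Qed.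

End RealFubini.

Section Truncation.
Context (R : realType).

(** The integrals of the truncations increase to the integral of [f]. *)
Lemma integral_trunc_le d (T : measurableType d) (mu : {measure set T -> \bar R})
    (f : T -> R) (c : \bar R) : measurable_fun setT f -> (forall x, 0 <= f x) ->
  (forall m : nat, (\int[mu]_x (Num.min (f x) m%:R)%:E <= c)%E) ->
  (\int[mu]_x (f x)%:E <= c)%E.
Proof.
move=> mf f0 fc.
have mk (k : nat) : measurable_fun setT (fun x => Num.min (f x) k%:R).
  exact: measurable_minr.
have := @cvg_monotone_convergence _ _ _ mu setT measurableT
  (fun k x => (Num.min (f x) k%:R)%:E).
have lim x : limn (fun k => (Num.min (f x) k%:R)%:E) = (f x)%:E.
  apply/cvg_lim => //; apply: cvg_near_cst; near=> k.
  rewrite min_l//; apply: ltW; apply: lt_le_trans (truncnS_gt _) _.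
  by rewrite ler_nat; near: k; exists (Num.truncn (f x)).+1.
move=> H'.
have H : (fun k => \int[mu]_x (Num.min (f x) k%:R)%:E)%E @ \oo --> (\int[mu]_x (f x)%:E)%E.
  under eq_integral do rewrite -lim.
  apply: H' => //.
  - by move=> k; exact/measurable_EFinP.
  - by move=> k x _; rewrite lee_fin le_min f0/=.
  - by move=> x _ a b ab; rewrite lee_fin le_min !ge_min lexx/= ler_nat ab orbT.
by apply: (cvge_to_le H); apply: nearW => k; exact: fc.
Unshelve. all: by end_near. Qed.

End Truncation.

(** * Convergence in probability *)
Section ErealSqueeze.
Variable R : realType.
Local Open Scope ereal_scope.

Lemma ge0_cvg0P (u : nat -> \bar R) : (forall k, 0 <= u k) ->
  u @ \oo --> 0 <->
  forall e : R, (0 < e)%R -> \forall k \near \oo, u k <= e%:E.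
Proof.
move=> u0; split=> [/fine_cvgP[fu cu] e e0|small].
  near=> k; have fk : u k \is a fin_num by near: k.
  rewrite -(fineK fk) lee_fin.
  have : (`|0 - (fine \o u) k| < e)%R.
    by near: k; apply: cvgr_dist_lt e0.
  by rewrite sub0r normrN => /ltW; apply: le_trans; exact: ler_norm.
have fu : \forall k \near \oo, u k \is a fin_num.
  have := small 1%R ltr01; apply: filterS => k uk.
  by rewrite ge0_fin_numE// (le_lt_trans uk)// ltry.
apply/fine_cvgP; split => //; apply/cvgrPdist_le => e e0.
near=> k; have fk : u k \is a fin_num by near: k.
rewrite sub0r normrN /= ger0_norm ?fine_ge0// -lee_fin fineK//.
by near: k; exact: small.
Unshelve. all: by end_near. Qed.

(** The form in which convergence in probability is used: the error is at most
    any [e], up to a multiple, depending on [e], of a quantity that vanishes. *)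
Lemma squeeze_eps (u v : nat -> \bar R) :
  (forall k, 0 <= u k) -> (forall k, 0 <= v k) -> v @ \oo --> 0 ->
  (forall e : R, (0 < e)%R -> exists2 C : R, (0 <= C)%R &
     forall k, u k <= e%:E + C%:E * v k) ->
  u @ \oo --> 0.
Proof.
move=> u0 v0 /(ge0_cvg0P v0) vs uv; apply/(ge0_cvg0P u0) => e e0.
have e20 : (0 < e / 2)%R by rewrite divr_gt0.
have [C C0 uC] := uv _ e20.
have D0 : (0 < e / 2 / (C + 1))%R by rewrite divr_gt0// ltr_wpDl.
apply: filterS (vs _ D0) => k vk.
apply: le_trans (uC k) _.
have -> : e%:E = (e / 2)%:E + (e / 2)%:E by rewrite -EFinD -splitr.
rewrite leeD2l//; apply: (@le_trans _ _ (C%:E * (e / 2 / (C + 1))%:E)).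
  by rewrite lee_wpmul2l// lee_fin.
by rewrite -EFinM lee_fin mulrCA ger_pMr// ler_pdivrMr ?ltr_wpDl// mul1r lerDl.
Qed.

Lemma cvg0_le (u v : nat -> \bar R) : (forall k, 0 <= u k) ->
  (forall k, u k <= v k) -> v @ \oo --> 0 -> u @ \oo --> 0.
Proof.
move=> u0 uv v0; apply: squeeze_cvge (cvg_cst 0) v0.
by apply: nearW => k; rewrite u0 uv.
Qed.

Lemma cvg0_add (u v : nat -> \bar R) : u @ \oo --> 0 -> v @ \oo --> 0 ->
  (fun k => u k + v k) @ \oo --> 0.
Proof. by move=> u0 v0; rewrite -[0]adde0; exact: cvgeD. Qed.

Lemma cvg0_scale (u : nat -> \bar R) (C : R) : u @ \oo --> 0 ->
  (fun k => C%:E * u k) @ \oo --> 0.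
Proof. by move=> u0; rewrite -[0](mule0 C%:E); exact: cvgeZl. Qed.

End ErealSqueeze.

Section ConvergenceInProbability.
Context d (Omega : measurableType d) (R : realType) (Pr : probability Omega R).
Local Open Scope ereal_scope.
Implicit Types Z : Omega -> \bar R.

(** The distance to 0 for convergence in probability. In contrast with the
    probabilities of the tails, it is subadditive and monotone in [Z]. *)
Definition pmet Z := \int[Pr]_w mine (Z w) 1.

Definition cvp0 (Z : nat -> Omega -> \bar R) := (fun k => pmet (Z k)) @ \oo --> 0.

Lemma integral_prob_cst (r : \bar R) : \int[Pr]_w r = r.
Proof.
transitivity (r * Pr setT); first by rewrite -integral_cst.
by rewrite -[RHS]mule1; congr (_ * _); exact: probability_setT.
Qed.

Lemma Rintegral_prob_cst (r : R) : (\int[Pr]_w r)%R = r.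
Proof. by rewrite /Rintegral integral_prob_cst. Qed.

Definition nnmeas Z := measurable_fun setT Z /\ forall w, 0 <= Z w.

Lemma nnmeas_mine Z : nnmeas Z -> nnmeas (fun w => mine (Z w) 1).
Proof.
move=> [mZ Z0]; split; first exact: measurable_mine.
by move=> w; rewrite le_min Z0/=.
Qed.

Lemma pmet_ge0 Z : (forall w, 0 <= Z w) -> 0 <= pmet Z.
Proof. by move=> Z0; apply: integral_ge0 => w _; rewrite le_min Z0/=. Qed.

Lemma pmet_le Z Z' : nnmeas Z -> nnmeas Z' ->
  {ae Pr, forall w, Z w <= Z' w} -> pmet Z <= pmet Z'.
Proof.
move=> nZ nZ' ZZ'; have [mZ Z0] := nnmeas_mine nZ.
have [mZ' Z0'] := nnmeas_mine nZ'.
apply: ae_ge0_le_integral => //.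
by apply: filterS ZZ' => w h _; rewrite le_min !ge_min h lexx orbT.
Qed.

Lemma mine_add (a b : \bar R) : 0 <= a -> 0 <= b ->
  mine (a + b) 1 <= mine a 1 + mine b 1.
Proof.
move=> a0 b0; have [a1|/ltW a1] := leP a 1; last first.
  by rewrite ge_min leeDl ?orbT// le_min b0/=.
have [b1|/ltW b1] := leP b 1.
  by rewrite ge_min lexx.
by rewrite ge_min leeDr ?orbT.
Qed.

Lemma pmet_add Z Z' : nnmeas Z -> nnmeas Z' ->
  pmet (fun w => Z w + Z' w) <= pmet Z + pmet Z'.
Proof.
move=> nZ nZ'; have [mZ Z0] := nnmeas_mine nZ.
have [mZ' Z0'] := nnmeas_mine nZ'; rewrite -ge0_integralD//.
apply: ge0_le_integral => //.
- by move=> w _; rewrite le_min adde_ge0 ?(nZ.2, nZ'.2)/=.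
- by apply: measurable_mine => //; apply: emeasurable_funD; [exact: nZ.1|exact: nZ'.1].
- exact: emeasurable_funD.
- by move=> w _; apply: mine_add; [exact: nZ.2|exact: nZ'.2].
Qed.

Lemma pmet_scale (c : R) Z : (1 <= c)%R -> nnmeas Z ->
  pmet (fun w => c%:E * Z w) <= c%:E * pmet Z.
Proof.
move=> c1 nZ; have [mZ Z0] := nnmeas_mine nZ.
have c0 : (0 <= c)%R by rewrite (le_trans ler01).
rewrite -ge0_integralZl//.
apply: ge0_le_integral => //.
- by move=> w _; rewrite le_min mule_ge0 ?(nZ.2)/=.
- by apply: measurable_mine => //; apply: measurable_funeM; exact: nZ.1.
- exact: measurable_funeM.
- move=> w _; have [z1|/ltW z1] := leP (Z w) 1.
    by rewrite ge_min lexx.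
  by rewrite mule1 ge_min lee_fin c1 orbT.
Qed.

Lemma pmet_markov (e : R) Z : (0 < e)%R -> (e <= 1)%R -> nnmeas Z ->
  e%:E * Pr [set w | e%:E <= Z w] <= pmet Z.
Proof.
move=> e0 e1 nZ; have [mZ Z0] := nnmeas_mine nZ.
have mE : measurable [set w | e%:E <= Z w].
  by rewrite -[X in measurable X]setTI; apply: emeasurable_fun_c_infty => //; exact: nZ.1.
have := le_integral_abse Pr measurableT mZ e0; rewrite setTI => le1.
apply: (le_trans _ (le_trans le1 _)); last first.
  by under eq_integral do rewrite gee0_abs//.
rewrite lee_pmul2l// le_measure ?inE//.
- rewrite -[X in measurable X]setTI; apply: emeasurable_fun_c_infty => //.
  exact: measurableT_comp.
- by move=> w /= eZ; rewrite gee0_abs// le_min eZ lee_fin.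
Qed.

Lemma pmet_le_prob (e : R) Z : (0 <= e)%R -> nnmeas Z ->
  pmet Z <= e%:E + Pr [set w | e%:E <= Z w].
Proof.
move=> e0 nZ; have [mZ Z0] := nnmeas_mine nZ.
have mE : measurable [set w | e%:E <= Z w].
  by rewrite -[X in measurable X]setTI; apply: emeasurable_fun_c_infty => //; exact: nZ.1.
have mI : measurable_fun setT (fun w => (\1_[set w | (e%:E <= Z w)%E] w)%:E : \bar R).
  by apply/measurable_EFinP; exact: measurable_indic.
have -> : e%:E + Pr [set w | e%:E <= Z w] =
    \int[Pr]_w (e%:E + (\1_[set w | (e%:E <= Z w)%E] w)%:E).
  rewrite ge0_integralD//.
  by rewrite integral_prob_cst integral_indic// setIT.
apply: ge0_le_integral => //.
- exact: emeasurable_funD.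
- move=> w _; rewrite indicE; have [eZ|Ze] := leP e%:E (Z w).
    by rewrite mem_set// ge_min leeDr ?orbT.
  rewrite memNset/=; last by apply/negP; rewrite -ltNge.
  by rewrite adde0 ge_min ltW.
Qed.

Lemma cvp0P (Z : nat -> Omega -> \bar R) : (forall k, nnmeas (Z k)) ->
  cvg0_in_probability Pr Z <-> cvp0 Z.
Proof.
move=> nZ; have Z0 k : 0 <= pmet (Z k) by apply: pmet_ge0 => w; exact: (nZ k).2.
split=> h.
  apply/(ge0_cvg0P Z0) => e e0.
  have e20 : (0 < e / 2)%R by rewrite divr_gt0.
  have P0 k : 0 <= Pr [set w | (e / 2)%:E <= Z k w] by [].
  have /(ge0_cvg0P P0)/(_ _ e20) := h _ e20; apply: filterS => k hk.
  apply: le_trans (pmet_le_prob (ltW e20) (nZ k)) _.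
  by rewrite [in leRHS](splitr e) EFinD leeD2l.
have small (e : R) : (0 < e)%R -> (e <= 1)%R ->
    (fun k => Pr [set w | e%:E <= Z k w]) @ \oo --> 0.
  move=> e0 e1; apply: (@cvg0_le _ _ (fun k => (e^-1)%:E * pmet (Z k))) => //.
    move=> k; rewrite -(@lee_pmul2l _ e%:E) ?lte_fin// muleA -EFinM divff ?gt_eqF// mul1e.
    exact: pmet_markov.
  exact: cvg0_scale.
move=> e e0; have [e1|/ltW e1] := leP e 1%R; first exact: small.
apply: (@cvg0_le _ _ (fun k => Pr [set w | 1%:E <= Z k w])) => //; last exact: small.
move=> k; have mE (c : \bar R) : measurable [set w | c <= Z k w].
  by rewrite -[X in measurable X]setTI; apply: emeasurable_fun_c_infty => //; exact: (nZ k).1.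
apply: le_measure; rewrite ?inE; [exact: mE|exact: mE|].
by move=> w /=; apply: le_trans; rewrite lee_fin.
Qed.

Lemma cvp0_le (Z Z' : nat -> Omega -> \bar R) :
  (forall k, nnmeas (Z k)) -> (forall k, nnmeas (Z' k)) ->
  (forall k, {ae Pr, forall w, Z k w <= Z' k w}) -> cvp0 Z' -> cvp0 Z.
Proof.
move=> nZ nZ' ZZ'; apply: cvg0_le => k; first by apply: pmet_ge0 => w; exact: (nZ k).2.
exact: pmet_le.
Qed.

Lemma cvp0_add (Z Z' : nat -> Omega -> \bar R) :
  (forall k, nnmeas (Z k)) -> (forall k, nnmeas (Z' k)) ->
  cvp0 Z -> cvp0 Z' -> cvp0 (fun k w => Z k w + Z' k w).
Proof.
move=> nZ nZ' cZ cZ'.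
apply: cvg0_le (cvg0_add cZ cZ') => k.
  by apply: pmet_ge0 => w; rewrite adde_ge0 ?(nZ k).2 ?(nZ' k).2.
exact: pmet_add.
Qed.

Lemma cvp0_scale (c : R) (Z : nat -> Omega -> \bar R) : (1 <= c)%R ->
  (forall k, nnmeas (Z k)) -> cvp0 Z -> cvp0 (fun k w => c%:E * Z k w).
Proof.
move=> c1 nZ cZ; apply: cvg0_le (cvg0_scale c cZ) => k.
  apply: pmet_ge0 => w; rewrite mule_ge0 ?(nZ k).2// lee_fin.
  exact: le_trans ler01 c1.
exact: pmet_scale.
Qed.

Lemma cvp0_sum I (r : seq I) (Z : I -> nat -> Omega -> \bar R) :
  (forall i k, nnmeas (Z i k)) -> (forall i, cvp0 (Z i)) ->
  cvp0 (fun k w => \sum_(i <- r) Z i k w).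
Proof.
move=> nZ cZ; elim: r => [|i r IH].
  rewrite /cvp0 (_ : (fun _ => _) = cst 0); first exact: cvg_cst.
  apply/funext => k; apply: integral0_eq => w _; rewrite big_nil.
  by rewrite min_l.
have -> : (fun k w => \sum_(j <- i :: r) Z j k w) =
    (fun k w => Z i k w + \sum_(j <- r) Z j k w).
  by apply/funext => k; apply/funext => w; rewrite big_cons.
apply: cvp0_add => // k; split.
  by apply: emeasurable_sum => j; exact: (nZ j k).1.
by move=> w; apply: sume_ge0 => j _; exact: (nZ j k).2.
Qed.

(** Dominated convergence, the truncated variables being at most 1. *)
Lemma cvp0_ae (Z : nat -> Omega -> \bar R) : (forall k, nnmeas (Z k)) ->
  {ae Pr, forall w, (fun k => Z k w) @ \oo --> 0} -> cvp0 Z.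
Proof.
move=> nZ cZ; rewrite /cvp0 /pmet.
have [] := @dominated_convergence _ _ _ Pr setT measurableT
  (fun k w => mine (Z k w) 1) (cst 0) (cst 1).
- by move=> k; exact: (nnmeas_mine (nZ k)).1.
- exact: measurable_cst.
- apply: filterS cZ => w cw _ /=.
  apply: cvg0_le cw => k; first exact: (nnmeas_mine (nZ k)).2.
  by rewrite ge_min lexx.
- by apply: finite_measure_integrable_cst.
- apply: aeW => w k _; rewrite gee0_abs; last exact: (nnmeas_mine (nZ k)).2.
  by rewrite ge_min lexx orbT.
by move=> _ _; rewrite integral0.
Qed.

(** A variable [Z] bounded by [B >= 1] is at most [B min (Z, 1)]. *)
Lemma pmet_bounded (B : R) (Z : Omega -> \bar R) : (1 <= B)%R -> nnmeas Z ->
  {ae Pr, forall w, Z w <= B%:E} -> \int[Pr]_w Z w <= B%:E * pmet Z.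
Proof.
move=> B1 nZ ZB; have [mZ Z0] := nnmeas_mine nZ.
rewrite -ge0_integralZl//; last by rewrite lee_fin (le_trans ler01).
apply: ae_ge0_le_integral => //.
- by move=> w _; exact: nZ.2.
- exact: nZ.1.
- by move=> w _; rewrite mule_ge0// lee_fin (le_trans ler01).
- exact: measurable_funeM.
apply: filterS ZB => w zB _; have [z1|/ltW z1] := leP (Z w) 1.
  by rewrite -[leLHS]mul1e lee_wpmul2r ?lee_fin// nZ.2.
by rewrite mule1.
Qed.

End ConvergenceInProbability.

(** * Measurability and independence relative to a sub-sigma-algebra *)
Section SubSigma.
Context d (Omega : measurableType d) (R : realType).
Variable G : set (set Omega).
Hypothesis sG : sigma_algebra setT G.
Implicit Types X Y : Omega -> R.

Lemma meas_wrtP X : meas_wrt G X <->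
  measurable_fun (setT : set (g_sigma_algebraType G)) X.
Proof.
have GE := measurable_g_measurableTypeE sG; split=> mX.
  by move=> _ B mB; rewrite setTI GE; exact: mX.
by move=> B mB; have := mX measurableT B mB; rewrite setTI GE.
Qed.

Lemma meas_wrt_sub (G' : set (set Omega)) X :
  G `<=` G' -> meas_wrt G X -> meas_wrt G' X.
Proof. by move=> GG' mX B mB; exact/GG'/mX. Qed.

Lemma meas_wrt_measurable X : G `<=` measurable -> meas_wrt G X ->
  measurable_fun setT X.
Proof. by move=> GG' mX _ B mB; rewrite setTI; exact/GG'/mX. Qed.

Lemma meas_wrtD X Y : meas_wrt G X -> meas_wrt G Y -> meas_wrt G (fun w => X w + Y w).
Proof. by move=> /meas_wrtP mX /meas_wrtP mY; apply/meas_wrtP; exact: measurable_funD. Qed.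

Lemma meas_wrtM X Y : meas_wrt G X -> meas_wrt G Y -> meas_wrt G (fun w => X w * Y w).
Proof. by move=> /meas_wrtP mX /meas_wrtP mY; apply/meas_wrtP; exact: measurable_funM. Qed.

Lemma meas_wrt_cst (c : R) : meas_wrt G (fun=> c).
Proof. by apply/meas_wrtP; exact: measurable_cst. Qed.

Lemma meas_wrtB X Y : meas_wrt G X -> meas_wrt G Y -> meas_wrt G (fun w => X w - Y w).
Proof. by move=> /meas_wrtP mX /meas_wrtP mY; apply/meas_wrtP; exact: measurable_funB. Qed.

Lemma meas_wrt_sum I (r : seq I) (F : I -> Omega -> R) :
  (forall i, meas_wrt G (F i)) -> meas_wrt G (fun w => \sum_(i <- r) F i w).
Proof.
move=> mF; apply/meas_wrtP; apply: measurable_sum => i.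
by move/meas_wrtP: (mF i).
Qed.

Lemma meas_wrt_comp X (h : R -> R) : measurable_fun setT h -> meas_wrt G X ->
  meas_wrt G (fun w => h (X w)).
Proof. by move=> mh /meas_wrtP mX; apply/meas_wrtP; exact: measurableT_comp. Qed.

Lemma meas_wrt_indic A : G A -> meas_wrt G (\1_A : Omega -> R).
Proof.
move=> GA; apply/meas_wrtP; apply: measurable_indic.
by rewrite measurable_g_measurableTypeE.
Qed.

Lemma meas_wrt_le X (c : R) : meas_wrt G X -> G [set w | X w <= c].
Proof.
move=> mX; have := mX [set y | y <= c]; apply.
rewrite (_ : [set y | y <= c] = `]-oo, c]%classic); first exact: measurable_itv.
by apply/seteqP; split => y /=; rewrite in_itv.
Qed.

End SubSigma.

Section Independence.
Context d (Omega : measurableType d) (R : realType) (Pr : probability Omega R).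
Variable G : set (set Omega).
Hypothesis GM : G `<=` measurable.
Implicit Types Z Y : Omega -> R.

Definition indep_of Y := forall A C, G A -> measurable C ->
  Pr (A `&` Y @^-1` C) = (Pr A * Pr (Y @^-1` C))%E.

(** Independence makes the joint law of [Z] and [Y] the product of their laws,
    on which Fubini's theorem applies to the product function. *)
Lemma indep_prod Z Y : meas_wrt G Z -> measurable_fun setT Y -> indep_of Y ->
  L1 Pr Z -> L1 Pr Y ->
  L1 Pr (fun w => Z w * Y w) /\
  \int[Pr]_w (Z w * Y w) = (\int[Pr]_w Z w) * (\int[Pr]_w Y w).
Proof.
move=> GZ mY indY LZ LY; have mZ := meas_wrt_measurable GM GZ.
pose mZ_mix := isMeasurableFun.Build _ _ _ _ _ mZ.
pose mY_mix := isMeasurableFun.Build _ _ _ _ _ mY.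
pose Zp : {mfun Omega >-> R} := HB.pack Z mZ_mix.
pose Yp : {mfun Omega >-> R} := HB.pack Y mY_mix.
have mZY : measurable_fun setT (fun w => (Z w, Y w) : (R * R)%type).
  exact: measurable_fun_pair.
pose mZY_mix := isMeasurableFun.Build _ _ _ _ _ mZY.
pose ZYp : {mfun Omega >-> (R * R)%type} :=
  HB.pack (fun w => (Z w, Y w) : (R * R)%type) mZY_mix.
pose PZ := distribution Pr Zp; pose PY := distribution Pr Yp.
pose PZY := distribution Pr ZYp.
have prodE X : measurable X -> (PZ \x PY)%E X = PZY X.
  apply: product_measure_unique => A B mA mB.
  by rewrite -[LHS]/(Pr (Z @^-1` A `&` Y @^-1` B)) indY//; exact: GZ.
have law (h : R -> R) X (Xp : {mfun Omega >-> R}) : Xp = X :> (Omega -> R) ->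
    measurable_fun setT h -> L1 Pr (fun w => h (X w)) ->
    L1 (distribution Pr Xp) h /\
    \int[distribution Pr Xp]_y h y = \int[Pr]_w h (X w).
  move=> XE mh Lh; split; last first.
    rewrite /Rintegral integral_distribution ?XE//; exact/measurable_EFinP.
  apply/integrableP; split; first exact/measurable_EFinP.
  rewrite (@ge0_integral_distribution _ _ _ _ _ _ _ (fun y => `|(h y)%:E|%E))//.
    by have /integrableP[_] := Lh; rewrite XE.
  by apply: measurableT_comp => //; exact/measurable_EFinP.
have [LPZ EPZ] := law id Z Zp erefl (@measurable_id _ _ _) LZ.
have [LPY EPY] := law id Y Yp erefl (@measurable_id _ _ _) LY.
have mmul : measurable_fun setT (fun z : R * R => z.1 * z.2).
  by apply: measurable_funM; [exact: measurable_fst|exact: measurable_snd].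
have mabs : measurable_fun setT (fun y : R => (`|y|)%:E).
  by apply/measurable_EFinP; exact: normr_measurable.
have Lprod : L1prod PZ PY (fun x y => x * y).
  apply/integrable12ltyP; first exact/measurable_EFinP.
  have -> : (\int[PZ]_x \int[PY]_y `|(x * y)%:E| =
      \int[PZ]_x ((\int[PY]_y `|y|)%R%:E * `|x|%:E))%E.
    apply: eq_integral => x _.
    rewrite L1E; last exact: L1_abs LPY.
    rewrite muleC -ge0_integralZl//.
    by apply: eq_integral => y _; rewrite -EFinM -normrM.
  rewrite ge0_integralZl//; last 1 first.
  - by rewrite lee_fin Rintegral_ge0.
  - apply: lte_mul_pinfty => //; first by rewrite lee_fin Rintegral_ge0.
    by have /integrableP[_] := LPZ.
have intE (h : (R * R)%type -> \bar R) :
    (\int[PZ \x PY]_z h z = \int[PZY]_z h z)%E.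
  by apply: eq_measure_integral => A mA _; exact: prodE.
have LZY : L1 Pr (fun w => Z w * Y w).
  apply/integrableP; split; first exact/measurable_EFinP/measurable_funM.
  have /integrableP[_] := Lprod; rewrite intE ge0_integral_distribution//.
  by apply: measurableT_comp => //; exact/measurable_EFinP.
split => //; apply: EFin_inj; rewrite L1E//.
transitivity (\int[PZY]_z (z.1 * z.2)%:E)%E.
  rewrite integral_distribution//; exact/measurable_EFinP.
rewrite -intE -(RFubini1 Lprod); congr (_%:E).
under eq_Rintegral do rewrite RintZ//.
by rewrite RintegralZr// EPZ EPY.
Qed.

End Independence.

(** * Increments of the Wiener process *)
Section WienerIncrements.
Context (R : realType) (d : measure_display) (Omega : measurableType d).
Variables (Pr : probability Omega R) (F : R -> set (set Omega)).
Variables (q : nat) (K : 'M[R]_q) (w : R -> Omega -> 'cV[R]_q).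
Hypothesis uF : usual_filtration Pr F.
Hypothesis W : wiener_process Pr F K w.

Definition incr (j : 'I_q) (a b : R) (omega : Omega) : R :=
  w b omega j 0 - w a omega j 0.

Let sF t : 0 <= t -> sigma_algebra setT (F t). Proof. by move=> t0; exact: (filtration_sigma uF). Qed.

Lemma wiener_measurable t j : 0 <= t -> measurable_fun setT (fun o => w t o j 0).
Proof.
move=> t0; apply: (meas_wrt_measurable (filtration_sub uF t0)).
exact: (wiener_adapted W).
Qed.

Lemma incr_adapted j a b t : 0 <= a -> 0 <= b -> a <= t -> b <= t ->
  meas_wrt (F t) (incr j a b).
Proof.
move=> a0 b0 at_ bt; have t0 := le_trans a0 at_.
apply: meas_wrtB; first exact: sF.
  by apply: meas_wrt_sub (wiener_adapted W _ b0); exact: (filtration_nd uF).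
by apply: meas_wrt_sub (wiener_adapted W _ a0); exact: (filtration_nd uF).
Qed.

Lemma incr_measurable j a b : 0 <= a -> 0 <= b -> measurable_fun setT (incr j a b).
Proof. by move=> a0 b0; apply: measurable_funB; exact: wiener_measurable. Qed.

Lemma wiener_L2 t j : 0 <= t -> L1 Pr (fun o => w t o j 0 ^+ 2).
Proof.
move=> t0; apply: L1_ge0.
- exact/measurable_funX/wiener_measurable.
- by move=> o; rewrite sqr_ge0.
- have := wiener_covariance W j j t0; rewrite unlock => E.
  by under eq_integral do rewrite expr2; rewrite E ltry.
Qed.

Lemma wiener_L1 t j : 0 <= t -> L1 Pr (fun o => w t o j 0).
Proof.
by move=> t0; apply: L1_of_sqr; [exact: wiener_measurable|exact: wiener_L2].
Qed.

Lemma incr_L2 j a b : 0 <= a -> 0 <= b -> L1 Pr (fun o => incr j a b o ^+ 2).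
Proof.
move=> a0 b0; apply: L1_sqrD.
- exact: wiener_measurable.
- by apply: measurableT_comp => //; exact: wiener_measurable.
- exact: wiener_L2.
- by under eq_fun do rewrite sqrrN; exact: wiener_L2.
Qed.

Lemma incr_L1 j a b : 0 <= a -> 0 <= b -> L1 Pr (incr j a b).
Proof. by move=> a0 b0; apply: L1B; exact: wiener_L1. Qed.

(** The increment and its opposite have the same centred normal law. *)
Lemma incr_mean0 j a b : 0 <= a -> a <= b -> \int[Pr]_o incr j a b o = 0.
Proof.
move=> a0 ab; have b0 := le_trans a0 ab.
have mI := incr_measurable j a0 b0.
have mN : measurable_fun setT (fun o => - incr j a b o) by exact: measurable_funN.
pose mI_mix := isMeasurableFun.Build _ _ _ _ _ mI.
pose mN_mix := isMeasurableFun.Build _ _ _ _ _ mN.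
pose Ip : {mfun Omega >-> R} := HB.pack (incr j a b) mI_mix.
pose Np : {mfun Omega >-> R} := HB.pack (fun o => - incr j a b o) mN_mix.
have h0 : 0 <= b - a by rewrite subr_ge0.
have eab : a + (b - a) = b by rewrite addrC subrK.
have dotE (c : R) o : dotv (c *: delta_mx j 0) (w (a + (b - a)) o - w a o) =
    c * incr j a b o.
  rewrite /dotv (bigD1 j)//= big1 ?addr0; last first.
    by move=> i ij; rewrite !mxE (negPf ij) mulr0 mul0r.
  by rewrite eab !mxE !eqxx mulr1.
have lawE C : measurable C -> distribution Pr Ip C = distribution Pr Np C.
  move=> mC.
  have e1 := wiener_gaussian W (1 *: delta_mx j 0) a0 h0 mC.
  have e2 := wiener_gaussian W (-1 *: delta_mx j 0) a0 h0 mC.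
  have qE : dotv (1 *: delta_mx j 0) (K *m (1 *: delta_mx j 0)) =
      dotv (-1 *: delta_mx j 0) (K *m (-1 *: delta_mx j 0)).
    rewrite /dotv; apply: eq_bigr => i _.
    by rewrite scaleN1r scale1r mulmxN !mxE mulrNN.
  rewrite -qE -e1 in e2.
  transitivity (Pr [set o | C (1 * incr j a b o)]).
    by rewrite /distribution/= /pushforward; congr (Pr _); apply/seteqP; split => o /=;
      rewrite mul1r.
  transitivity (Pr [set o | C (-1 * incr j a b o)]); last first.
    by rewrite /distribution/= /pushforward; congr (Pr _); apply/seteqP; split => o /=;
      rewrite mulN1r.
  move: e2; under eq_set do rewrite dotE.
  by under [in RHS]eq_set do rewrite dotE.
have LI := incr_L1 j a0 b0.
have eqN : \int[Pr]_o incr j a b o = \int[Pr]_o (- incr j a b o).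
  apply: EFin_inj; rewrite L1E// L1E; last exact: L1N.
  have -> : (\int[Pr]_o (incr j a b o)%:E = \int[distribution Pr Ip]_y y%:E)%E.
    by rewrite integral_distribution//; exact/measurable_EFinP.
  have -> : (\int[Pr]_o (- incr j a b o)%:E = \int[distribution Pr Np]_y y%:E)%E.
    by rewrite integral_distribution//; exact: L1N.
  by apply: eq_measure_integral => A mA _; exact: lawE.
move: eqN; rewrite RintN//; lra.
Qed.

Definition incr_sigma (a b : R) : set (set Omega) :=
  <<s [set E : set Omega | exists (i : 'I_q) (C : set R), measurable C /\
           E = [set omega | C (incr i a b omega)]] >>.

Lemma incr_indep a b Y : 0 <= a -> a <= b -> meas_wrt (incr_sigma a b) Y ->
  indep_of Pr (F a) Y.
Proof.
move=> a0 ab mY A C FA mC; have h0 : 0 <= b - a by rewrite subr_ge0.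
apply: (wiener_independent W a0 h0) => //.
have := mY C mC; rewrite /incr_sigma /incr.
rewrite [in X in _ -> X](_ : a + (b - a) = b); last by rewrite addrC subrK.
congr (<<s _ >> _); apply/seteqP; split => E [i [B [mB ->]]]; exists i, B; split => //.
  by apply/seteqP; split => o /=; rewrite !mxE.
by apply/seteqP; split => o /=; rewrite !mxE.
Qed.

Lemma sigma_incr_sigma a b : sigma_algebra setT (incr_sigma a b).
Proof. exact: smallest_sigma_algebra. Qed.

Lemma incr_meas_sigma j a b : meas_wrt (incr_sigma a b) (incr j a b).
Proof. by move=> C mC; apply: sub_sigma_algebra; exists j, C. Qed.

Lemma incr_mean Z j a b : 0 <= a -> a <= b -> meas_wrt (F a) Z -> L1 Pr Z ->
  L1 Pr (fun o => Z o * incr j a b o) /\ \int[Pr]_o (Z o * incr j a b o) = 0.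
Proof.
move=> a0 ab FZ LZ; have b0 := le_trans a0 ab.
have [LZI ->] := indep_prod (filtration_sub uF a0) FZ (incr_measurable j a0 b0)
  (incr_indep a0 ab (@incr_meas_sigma j a b)) LZ (incr_L1 j a0 b0).
by rewrite incr_mean0// mulr0.
Qed.

Lemma incr_prod_L1 i j a b : 0 <= a -> 0 <= b ->
  L1 Pr (fun o => incr i a b o * incr j a b o).
Proof.
by move=> a0 b0; apply: L1_sqr_prod; [exact: incr_measurable|exact: incr_measurable|
  exact: incr_L2|exact: incr_L2].
Qed.

Lemma incr_prod_mean i j a b : 0 <= a -> a <= b ->
  \int[Pr]_o (incr i a b o * incr j a b o) = K i j * (b - a).
Proof.
move=> a0 ab; have b0 := le_trans a0 ab.
have cov t : 0 <= t -> \int[Pr]_o (w t o i 0 * w t o j 0) = t * K i j.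
  by move=> t0; have := wiener_covariance W i j t0; rewrite unlock /Rintegral => ->.
have Fa k : meas_wrt (F a) (fun o => w a o k 0) by exact: (wiener_adapted W).
have La k := wiener_L1 k a0.
have [L1ij E1] := incr_mean j a0 ab (Fa i) (La i).
have [L1ji E2] := incr_mean i a0 ab (Fa j) (La j).
have := cov _ b0.
have -> : \int[Pr]_o (w b o i 0 * w b o j 0) =
  \int[Pr]_o ((w a o i 0 * w a o j 0 + w a o i 0 * incr j a b o) +
     (w a o j 0 * incr i a b o + incr i a b o * incr j a b o)).
  by apply: eq_Rintegral => o _; rewrite /incr; ring.
have Laa : L1 Pr (fun o => w a o i 0 * w a o j 0).
  by apply: L1_sqr_prod; [exact: wiener_measurable|exact: wiener_measurable|
    exact: wiener_L2|exact: wiener_L2].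
have LII := incr_prod_L1 i j a0 b0.
rewrite RintD; [|exact: L1D|exact: L1D].
rewrite RintD// RintD// E1 E2 cov//; lra.
Qed.

(** The product of two increments is independent of the past [F a], by which it
    is multiplied. *)
Lemma incr_cov Z i j a b : 0 <= a -> a <= b -> meas_wrt (F a) Z -> L1 Pr Z ->
  L1 Pr (fun o => Z o * (incr i a b o * incr j a b o)) /\
  \int[Pr]_o (Z o * (incr i a b o * incr j a b o)) =
    (\int[Pr]_o Z o) * (K i j * (b - a)).
Proof.
move=> a0 ab FZ LZ; have b0 := le_trans a0 ab.
have mY : meas_wrt (incr_sigma a b) (fun o => incr i a b o * incr j a b o).
  by apply: (meas_wrtM (sigma_incr_sigma a b)); exact: incr_meas_sigma.
have [LZI ->] := indep_prod (filtration_sub uF a0) FZ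
  (measurable_funM (incr_measurable i a0 b0) (incr_measurable j a0 b0))
  (incr_indep a0 ab mY) LZ (incr_prod_L1 i j a0 b0).
by rewrite incr_prod_mean.
Qed.

End WienerIncrements.

(** * Stochastic integrals of step processes on a grid *)
Section StepIntegral.
Context (R : realType) (d : measure_display) (Omega : measurableType d).
Variables (Pr : probability Omega R) (F : R -> set (set Omega)).
Variables (q : nat) (K : 'M[R]_q) (w : R -> Omega -> 'cV[R]_q).
Hypothesis uF : usual_filtration Pr F.
Hypothesis W : wiener_process Pr F K w.

Definition grid (r : nat -> R) := 0 <= r 0%N /\ forall l, r l <= r l.+1.

Definition adapted_coef (r : nat -> R) (c : nat -> Omega -> R) := forall l,
  meas_wrt (F (r l)) (c l) /\ exists C, forall o, `|c l o| <= C.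

Definition stepI (r : nat -> R) (L : nat) (c : nat -> Omega -> R) (j : 'I_q)
    (o : Omega) : R :=
  \sum_(l < L) c l o * incr w j (r l) (r l.+1) o.

Lemma grid_mono r : grid r -> {homo r : m n / (m <= n)%N >-> m <= n}.
Proof.
move=> [_ rS] m n; elim: n => [|n IH]; first by rewrite leqn0 => /eqP ->.
by rewrite leq_eqVlt ltnS => /predU1P[->//|/IH h]; exact: le_trans h (rS n).
Qed.

Lemma grid_ge0 r l : grid r -> 0 <= r l.
Proof. by move=> gr; apply: le_trans (gr.1) _; exact: grid_mono. Qed.

Lemma adapted_coef_measurable r c l : grid r -> adapted_coef r c ->
  measurable_fun setT (c l).
Proof.
move=> gr ac; apply: (meas_wrt_measurable (filtration_sub uF (grid_ge0 l gr))).
exact: (ac l).1.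
Qed.

Lemma adapted_coefM r c c' : grid r -> adapted_coef r c -> adapted_coef r c' ->
  adapted_coef r (fun l o => c l o * c' l o).
Proof.
move=> gr ac ac' l; have [m1 [C1 b1]] := ac l; have [m2 [C2 b2]] := ac' l.
split; first by apply: meas_wrtM => //; exact: (filtration_sigma uF (grid_ge0 l gr)).
by exists (C1 * C2) => o; rewrite normrM ler_pM.
Qed.

Lemma adapted_coef_L1 r c l : grid r -> adapted_coef r c -> L1 Pr (c l).
Proof.
move=> gr ac; have [_ [C bC]] := ac l.
by apply: (@L1_bounded _ _ _ _ _ C) => //; exact: adapted_coef_measurable ac.
Qed.

Let step_term_L2 r c j l : grid r -> adapted_coef r c ->
  L1 Pr (fun o => (c l o * incr w j (r l) (r l.+1) o) ^+ 2).
Proof.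
move=> gr ac; have [_ [C bC]] := ac l.
under eq_fun do rewrite exprMn.
have r0 := grid_ge0 l gr; have r1 := grid_ge0 l.+1 gr.
apply: (@L1M_bounded _ _ _ _ _ _ (C ^+ 2)).
- exact/measurable_funX/(adapted_coef_measurable _ gr ac).
- exact: (incr_L2 uF W).
- move=> o; rewrite normrX lerXn2r ?nnegrE//.
  exact: le_trans (bC o).
Qed.

Let step_term_measurable r c j l : grid r -> adapted_coef r c ->
  measurable_fun setT (fun o => c l o * incr w j (r l) (r l.+1) o).
Proof.
move=> gr ac; apply: measurable_funM; first exact: adapted_coef_measurable ac.
by apply: (incr_measurable uF W); exact: grid_ge0.
Qed.

Lemma stepI_measurable r L c j : grid r -> adapted_coef r c ->
  measurable_fun setT (stepI r L c j).
Proof. by move=> gr ac; apply: measurable_sum => l; exact: step_term_measurable. Qed.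

Lemma stepI_L2 r L c j : grid r -> adapted_coef r c ->
  L1 Pr (fun o => stepI r L c j o ^+ 2).
Proof.
move=> gr ac; apply: (@L1_sqr_sum _ _ _ _ _ _
  (fun (l : 'I_L) o => c l o * incr w j (r l) (r l.+1) o)) => l.
- exact: step_term_measurable.
- exact: step_term_L2.
Qed.

Lemma stepI_adapted r L c j : grid r -> adapted_coef r c ->
  meas_wrt (F (r L)) (stepI r L c j).
Proof.
move=> gr ac; have sF l : sigma_algebra setT (F (r l)).
  exact: (filtration_sigma uF (grid_ge0 l gr)).
apply: (meas_wrt_sum (sF L)) => l.
have rl : r l <= r L by apply: grid_mono => //; exact: ltnW.
apply: (meas_wrtM (sF L)).
  by apply: meas_wrt_sub (ac l).1; apply: (filtration_nd uF) => //; exact: grid_ge0.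
apply: (incr_adapted uF W) => //; try exact: grid_ge0.
by apply: grid_mono.
Qed.

(** The products of different cells have mean 0, since the later increment is
    centred and independent of everything that precedes it. *)
Lemma stepI_cov r L c c' j j' : grid r -> adapted_coef r c -> adapted_coef r c' ->
  \int[Pr]_o (stepI r L c j o * stepI r L c' j' o) =
  K j j' * \sum_(l < L) (r l.+1 - r l) * \int[Pr]_o (c l o * c' l o).
Proof.
move=> gr ac ac'; elim: L => [|L IH].
  rewrite big_ord0 mulr0 -[RHS](mul0r (fine (Pr setT))) -Rintegral_cst//.
  by apply: eq_Rintegral => o _; rewrite /stepI big_ord0 mul0r.
have r0 := grid_ge0 L gr; have rL := gr.2 L.
have sF : sigma_algebra setT (F (r L)) by exact: (filtration_sigma uF).
pose T (c : nat -> Omega -> R) j o := c L o * incr w j (r L) (r L.+1) o.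
have LS c0 c1 j0 : adapted_coef r c0 -> adapted_coef r c1 ->
    L1 Pr (fun o => stepI r L c0 j0 o * c1 L o).
  move=> a0 a1; apply: L1_sqr_prod.
  - exact: stepI_measurable.
  - exact: adapted_coef_measurable a1.
  - exact: stepI_L2.
  - have [m1 [C b1]] := a1 L; apply: (@L1_bounded _ _ _ _ _ (C ^+ 2)).
      exact/measurable_funX/(adapted_coef_measurable _ gr a1).
    by move=> o; rewrite normrX lerXn2r ?nnegrE// (le_trans _ (b1 o)).
have cross c0 c1 j0 j1 : adapted_coef r c0 -> adapted_coef r c1 ->
    L1 Pr (fun o => stepI r L c0 j0 o * T c1 j1 o) /\
    \int[Pr]_o (stepI r L c0 j0 o * T c1 j1 o) = 0.
  move=> a0 a1.
  have := incr_mean uF W j1 r0 rL (meas_wrtM sF (stepI_adapted L j0 gr a0) (a1 L).1)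
    (LS _ _ j0 a0 a1).
  by under [X in L1 Pr X]eq_fun do rewrite -mulrA; under eq_Rintegral do rewrite -mulrA.
have [Lc1 Ec1] := cross c c' j j' ac ac'.
have [Lc2 Ec2] := cross c' c j' j ac' ac.
have acc := adapted_coefM gr ac ac'.
have [Lc3 Ec3] := incr_cov uF W j j' r0 rL (acc L).1 (adapted_coef_L1 L gr acc).
have -> : \int[Pr]_o (stepI r L.+1 c j o * stepI r L.+1 c' j' o) =
  \int[Pr]_o ((stepI r L c j o * stepI r L c' j' o + stepI r L c j o * T c' j' o) +
   (stepI r L c' j' o * T c j o +
   (c L o * c' L o) * (incr w j (r L) (r L.+1) o * incr w j' (r L) (r L.+1) o))).
  by apply: eq_Rintegral => o _; rewrite /stepI !big_ord_recr/= /T; ring.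
have LII : L1 Pr (fun o => stepI r L c j o * stepI r L c' j' o).
  by apply: L1_sqr_prod; [exact: stepI_measurable|exact: stepI_measurable|
    exact: stepI_L2|exact: stepI_L2].
rewrite RintD; [|exact: L1D|exact: L1D].
rewrite RintD// RintD// Ec1 Ec2 Ec3 IH big_ord_recr/=; ring.
Qed.

(** The energy of a step process over its first [l] cells, known when the last of
    these cells starts; this is why [cutcoef] is adapted. *)
Definition runsq (dt : nat -> R) (c : nat -> Omega -> R) (l : nat) (o : Omega) : R :=
  \sum_(i < l) dt i * c i o ^+ 2.

Definition cutcoef (dt : nat -> R) (eta : R) (c : nat -> Omega -> R) (l : nat)
    (o : Omega) : R :=
  c l o * (runsq dt c l.+1 o <= eta)%R%:R.

Section Cut.
Variables (dt : nat -> R) (c : nat -> Omega -> R) (eta : R).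
Hypothesis dt0 : forall l, 0 <= dt l.

Lemma runsq_mono o : {homo (runsq dt c ^~ o) : m n / (m <= n)%N >-> m <= n}.
Proof.
move=> m n; elim: n => [|n IH]; first by rewrite leqn0 => /eqP ->.
rewrite leq_eqVlt ltnS => /predU1P[->//|/IH h]; apply: le_trans h _.
by rewrite /runsq big_ord_recr/= lerDl mulr_ge0// sqr_ge0.
Qed.

Lemma cutcoefE l L o : (l < L)%N -> runsq dt c L o <= eta ->
  cutcoef dt eta c l o = c l o.
Proof.
move=> lL rL; rewrite /cutcoef (_ : _ <= _) ?mulr1//.
by apply: le_trans rL; exact: runsq_mono.
Qed.

Lemma runsq_cut_le L o : 0 <= eta -> runsq dt (cutcoef dt eta c) L o <= eta.
Proof.
move=> eta0; elim: L => [|L IH]; first by rewrite /runsq big_ord0.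
have [rL|rL] := leP (runsq dt c L.+1 o) eta.
  apply: (le_trans _ rL); apply: ler_sum => l _.
  by rewrite (cutcoefE (L := L.+1)).
rewrite /runsq big_ord_recr/= -/(runsq _ _ _ _).
by rewrite [X in _ + dt L * X](_ : _ = 0) ?mulr0 ?addr0// /cutcoef leNgt rL/= mulr0 expr0n.
Qed.

Lemma cutcoef_adapted r : grid r -> adapted_coef r c ->
  adapted_coef r (cutcoef dt eta c).
Proof.
move=> gr ac l; have [mc [C bC]] := ac l; split; last first.
  exists C => o; rewrite /cutcoef normrM; apply: le_trans (bC o).
  by rewrite ler_piMr// normr_nat lern1 leq_b1.
have sF : sigma_algebra setT (F (r l)) by apply: (filtration_sigma uF); exact: grid_ge0.
apply: (meas_wrtM sF) => //.
have mr : meas_wrt (F (r l)) (runsq dt c l.+1).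
  apply: (meas_wrt_sum sF) => i; apply: (meas_wrtM sF); first exact: meas_wrt_cst.
  have mi : meas_wrt (F (r l)) (c i).
    apply: meas_wrt_sub (ac i).1; apply: (filtration_nd uF); first exact: grid_ge0.
    by apply: grid_mono => //; rewrite -ltnS.
  by under eq_fun do rewrite expr2; exact: meas_wrtM.
rewrite (_ : (fun _ => _) = \1_[set o | runsq dt c l.+1 o <= eta]).
  by apply: (meas_wrt_indic sF); exact: (meas_wrt_le eta mr).
apply/funext => o; rewrite indicE; case: (leP (runsq dt c l.+1 o) eta) => h.
  by rewrite mem_set.
by rewrite memNset//=; apply/negP; rewrite -ltNge.
Qed.

End Cut.

Lemma K_diag_ge0 j : 0 <= K j j.
Proof.
have := incr_prod_mean uF W j j (lexx 0) ler01; rewrite subr0 mulr1 => <-.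
by apply: Rintegral_ge0 => o _; rewrite -expr2 sqr_ge0.
Qed.

Definition dgrid (r : nat -> R) l := r l.+1 - r l.

Lemma dgrid_ge0 r l : grid r -> 0 <= dgrid r l.
Proof. by move=> gr; rewrite subr_ge0 gr.2. Qed.

Lemma runsq_measurable r c L : grid r -> adapted_coef r c ->
  measurable_fun setT (runsq (dgrid r) c L).
Proof.
move=> gr ac; apply: measurable_sum => l; apply: measurable_funM => //.
exact/measurable_funX/(adapted_coef_measurable _ gr ac).
Qed.

Lemma stepI_sqr r L c j (eta : R) : grid r -> adapted_coef r c ->
  (forall o, runsq (dgrid r) c L o <= eta) ->
  (\int[Pr]_o (stepI r L c j o ^+ 2)%:E <= (K j j * eta)%:E)%E.
Proof.
move=> gr ac ceta.
rewrite -L1E; last exact: stepI_L2.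
rewrite lee_fin; under eq_Rintegral do rewrite expr2.
rewrite stepI_cov// ler_wpM2l ?K_diag_ge0//.
have Lc l : L1 Pr (fun o => c l o * c l o) by exact: (adapted_coef_L1 l gr (adapted_coefM gr ac ac)).
under eq_bigr do rewrite -RintZ//.
rewrite -Rint_sum; last by move=> l; exact: L1Zl.
apply: (@le_trans _ _ (\int[Pr]_o eta)).
  apply: Rint_le; [by apply: L1_sum => l; exact: L1Zl|exact: L1_cst|].
  by move=> o; apply: le_trans (ceta o); under eq_bigr do rewrite -expr2.
by rewrite Rintegral_prob_cst.
Qed.

(** Where the energy does not exceed [eta], the step integral is the one of the
    cut coefficients, whose second moment is at most [K j j * eta]; the event where
    it does is small by Markov's inequality. This replaces the isometry for
    integrands that are small in probability only, on an event [A] which may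
    depend on the future of each cell. *)
Lemma stepI_lenglart r L c j (A : set Omega) (eta : R) : grid r -> adapted_coef r c ->
  measurable A -> 0 < eta -> eta <= 1 ->
  (pmet Pr (fun o => (\1_A o * stepI r L c j o ^+ 2)%:E) <=
   (K j j * eta)%:E + (eta^-1)%:E * pmet Pr (fun o => (\1_A o * runsq (dgrid r) c L o)%:E))%E.
Proof.
move=> gr ac mA eta0 eta1.
pose c' := cutcoef (dgrid r) eta c.
have ac' : adapted_coef r c' by exact: cutcoef_adapted.
have dr0 l := dgrid_ge0 l gr.
have rs0 o : 0 <= runsq (dgrid r) c L o.
  by apply: sumr_ge0 => l _; rewrite mulr_ge0// sqr_ge0.
set D := runsq (dgrid r) c L in rs0 *.
have mD : measurable_fun setT D by exact: runsq_measurable.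
have m1A : measurable_fun setT (\1_A : Omega -> R) by exact: measurable_indic.
have nAD : nnmeas (fun o => (\1_A o * D o)%:E).
  split; first exact/measurable_EFinP/measurable_funM.
  by move=> o; rewrite lee_fin mulr_ge0.
set E := [set o | (eta%:E <= (\1_A o * D o)%:E)%E].
have mE : measurable E.
  by rewrite -[X in measurable X]setTI; apply: emeasurable_fun_c_infty => //; exact: nAD.1.
have mI : measurable_fun setT (fun o => (stepI r L c' j o ^+ 2)%:E : \bar R).
  exact/measurable_EFinP/measurable_funX/stepI_measurable.
have m1E : measurable_fun setT (fun o => (\1_E o)%:E : \bar R).
  by apply/measurable_EFinP; exact: measurable_indic.
apply: (@le_trans _ _ (\int[Pr]_o ((stepI r L c' j o ^+ 2)%:E + (\1_E o)%:E))%E).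
  apply: ge0_le_integral => //.
  - by move=> o _; rewrite le_min lee_fin mulr_ge0 ?sqr_ge0/=.
  - apply: measurable_mine => //; apply/measurable_EFinP/measurable_funM => //.
    exact/measurable_funX/stepI_measurable.
  - exact: emeasurable_funD.
  - move=> o _; have [oE|oE] := pselect (E o).
      have -> : \1_E o = 1 :> R by rewrite indicE mem_set.
      by rewrite ge_min leeDr ?orbT// lee_fin sqr_ge0.
    have -> : \1_E o = 0 :> R by rewrite indicE memNset.
    rewrite ge_min; apply/orP; left; rewrite adde0 lee_fin.
    rewrite indicE; have [oA|oA] := boolP (o \in A); last by rewrite mul0r sqr_ge0.
    rewrite mul1r (_ : stepI r L c' j o = stepI r L c j o)//.
    apply: eq_bigr => l _; congr (_ * _); apply: (cutcoefE dr0 (ltn_ord l)).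
    apply/ltW; rewrite ltNge; apply/negP => h; apply: oE.
    by rewrite /E/= indicE oA mul1r lee_fin.
rewrite ge0_integralD//; last by move=> o _; rewrite lee_fin sqr_ge0.
rewrite leeD//.
  by apply: stepI_sqr => // o; apply: runsq_cut_le => //; exact: ltW.
rewrite integral_indic// setIT.
rewrite -(@lee_pmul2l _ eta%:E) ?lte_fin// muleA -EFinM divff ?gt_eqF// mul1e.
exact: pmet_markov.
Qed.

End StepIntegral.

(** * Time integrals, and stochastic integrals up to an intermediate time *)
Section RestrictedLebesgue.
Variable R : realType.
Local Notation mu := (@lebesgue_measure R).

Lemma lebesgue_itv0_lty (t : R) : (mu `[0%R, t] < +oo)%E.
Proof. by rewrite lebesgue_measure_itv/=; case: ifP => _; rewrite ?ltry// -EFinB ltry. Qed.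

(** A finite measure on the whole line, so that Fubini's theorem applies to its
    product with the probability. *)
Definition lebT (t : R) : {finite_measure set (measurableTypeR R) -> \bar R} :=
  @mfrestr _ (measurableTypeR R) R _
    (@lebesgue_measure R : {measure set (measurableTypeR R) -> \bar R})
    (measurable_itv `[0%R, t]) (lebesgue_itv0_lty t).

Lemma lebT_null (t : R) : lebT t (~` `[0%R, t]%classic) = 0%E.
Proof. by rewrite /lebT/= /mfrestr /mrestr setICl measure0. Qed.

Lemma ae_lebT (t : R) : {ae lebT t, forall s, 0 <= s <= t}.
Proof.
exists (~` `[0%R, t]%classic); split; last by move=> s /=; rewrite in_itv.
  by apply: measurableC; exact: measurable_itv.
exact: lebT_null.
Qed.

Lemma ae_lebT_imp (s : R) (P : R -> Prop) : (forall u, 0 <= u <= s -> P u) ->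
  {ae lebT s, forall u, P u}.
Proof.
move=> h; have [N [mN N0 sN]] := ae_lebT s; exists N; split => // u /= Pu.
by apply: sN => /= hu; apply: Pu; exact: h.
Qed.

Lemma ge0_lebT_integral (t : R) (f : R -> \bar R) : measurable_fun setT f ->
  (forall s, 0 <= f s)%E ->
  (\int[lebT t]_s f s = \int[mu]_(s in `[0%R, t]) f s)%E.
Proof.
move=> mf f0.
have mN : measurable (~` `[0%R, t]%classic : set (measurableTypeR R)).
  by apply: measurableC; exact: measurable_itv.
have E := @ge0_negligible_integral _ (measurableTypeR R) R (lebT t) setT _ f mN
  measurableT mf (fun s _ => f0 s) (lebT_null t).
rewrite setTD setCK in E; apply: etrans E _.
apply: eq_measure_integral => A mA AD.
by rewrite /lebT/= /mfrestr /mrestr setIidl.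
Qed.

Lemma lebT_integral (t : R) (f : R -> \bar R) : measurable_fun setT f ->
  (\int[lebT t]_s f s = \int[mu]_(s in `[0%R, t]) f s)%E.
Proof.
move=> mf; rewrite integralE [RHS]integralE.
by rewrite !ge0_lebT_integral//; [exact: measurable_funeneg|exact: measurable_funepos].
Qed.

Lemma lebT_Rintegral (t : R) (f : R -> R) : measurable_fun setT f ->
  \int[lebT t]_s f s = \int[mu]_(s in `[0%R, t]) f s.
Proof. by move=> mf; rewrite /Rintegral lebT_integral//; exact/measurable_EFinP. Qed.

Lemma L1_lebT (t : R) (f : R -> R) : measurable_fun setT f ->
  mu.-integrable `[0%R, t] (EFin \o f) -> L1 (lebT t) f.
Proof.
move=> mf /integrableP[_ foo]; apply/integrableP; split; first exact/measurable_EFinP.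
by rewrite ge0_lebT_integral//; apply: measurableT_comp => //; exact/measurable_EFinP.
Qed.

Lemma lebT_itv (t a b : R) : 0 <= a -> a <= b -> 0 <= t ->
  \int[lebT t]_s (\1_(`]a, b]%classic) s : R) = Num.min b t - Num.min a t.
Proof.
move=> a0 ab t0; rewrite /Rintegral integral_indic ?setIT//.
rewrite /lebT/= /mfrestr /mrestr.
have [ta|at_] := leP t a.
  rewrite (min_r (le_trans ta ab)) subrr.
  rewrite (_ : `]a, b] `&` `[0, t] = set0) ?measure0//.
  apply/seteqP; split => // s /= []; rewrite !in_itv/= => /andP[as_ _] /andP[_ st].
  by have := lt_le_trans as_ st; rewrite ltNge ta.
have -> : `]a, b]%classic `&` `[0, t]%classic = `]a, Num.min b t]%classic :> set R.
  apply/seteqP; split => s /=; rewrite !in_itv/= le_min.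
    by move=> [/andP[-> ->] /andP[_ ->]].
  by move=> /and3P[as_ -> ->]; rewrite as_ (le_trans a0 (ltW as_)).
rewrite lebesgue_measure_itv/= lte_fin lt_min at_ andbT.
have [ab'|ba] := ltP a b; first by rewrite -EFinB.
rewrite (min_l (le_trans ba (ltW at_))).
by apply/eqP; rewrite eq_sym subr_eq0 eq_le ba ab.
Qed.

End RestrictedLebesgue.

#[global] Opaque lebT.

Section Refinement.
Context (R : realType) (d : measure_display) (Omega : measurableType d).
Variables (Pr : probability Omega R) (F : R -> set (set Omega)).
Variables (q : nat) (K : 'M[R]_q) (w : R -> Omega -> 'cV[R]_q).
Hypothesis uF : usual_filtration Pr F.
Hypothesis W : wiener_process Pr F K w.

Definition clipg (r : nat -> R) (s : R) (l : nat) : R := Num.min (r l) s.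

Definition clipc (r : nat -> R) (s : R) (c : nat -> Omega -> R) (l : nat) (o : Omega) : R :=
  c l o * (r l < s)%R%:R.

(** Clipping the grid at [s] stops the integral at time [s]. *)
Definition stepIs (r : nat -> R) (L : nat) (c : nat -> Omega -> R) (j : 'I_q)
    (s : R) (o : Omega) : R :=
  \sum_(l < L) c l o * incr w j (clipg r s l) (clipg r s l.+1) o.

Definition stepV (r : nat -> R) (L : nat) (c : nat -> Omega -> R) (s : R) (o : Omega) : R :=
  \sum_(l < L) c l o * \1_(`]r l, r l.+1]%classic) s.

Lemma grid_clip r s : grid r -> 0 <= s -> grid (clipg r s).
Proof.
move=> [r0 rS] s0; split; first by rewrite /clipg le_min r0.
by move=> l; rewrite /clipg le_min !ge_min rS lexx orbT.
Qed.

Lemma clip_adapted r s c : grid r -> 0 <= s -> adapted_coef F r c ->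
  adapted_coef F (clipg r s) (clipc r s c).
Proof.
move=> gr s0 ac l; have [mc [C bC]] := ac l; split; last first.
  exists C => o; rewrite /clipc normrM; apply: le_trans (bC o).
  by rewrite ler_piMr// normr_nat lern1 leq_b1.
have sF : sigma_algebra setT (F (clipg r s l)).
  exact: (filtration_sigma uF (grid_ge0 l (grid_clip gr s0))).
rewrite /clipc; move: sF; rewrite /clipg; have [rs sF|sr sF] := ltP (r l) s; last first.
  by under eq_fun do rewrite mulr0; exact: (meas_wrt_cst sF 0).
by under eq_fun do rewrite mulr1.
Qed.

Lemma clip_eq r s l : grid r -> s <= r l -> clipg r s l = clipg r s l.+1.
Proof. by move=> gr sr; rewrite /clipg !min_r//; exact: le_trans sr (gr.2 l). Qed.

Lemma stepI_clip r L c j s : grid r ->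
  stepI w (clipg r s) L (clipc r s c) j = stepIs r L c j s.
Proof.
move=> gr; apply/funext => o; apply: eq_bigr => l _; rewrite /clipc.
have [rs|sr] := ltP (r l) s; first by rewrite mulr1.
by rewrite -(clip_eq gr sr) /incr subrr !mulr0.
Qed.

Lemma runsq_clip r L c s o : grid r ->
  runsq (dgrid (clipg r s)) (clipc r s c) L o = runsq (dgrid (clipg r s)) c L o.
Proof.
move=> gr; apply: eq_bigr => l _; rewrite /clipc /dgrid.
have [rs|sr] := ltP (r l) s; first by rewrite mulr1.
by rewrite -(clip_eq gr sr) subrr !mul0r.
Qed.

Lemma stepIs_measurable r L c j s : grid r -> 0 <= s -> adapted_coef F r c ->
  measurable_fun setT (stepIs r L c j s).
Proof.
move=> gr s0 ac; rewrite -stepI_clip//.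
exact: (stepI_measurable uF W L j (grid_clip gr s0) (clip_adapted gr s0 ac)).
Qed.

Lemma stepIs_L2 r L c j s : grid r -> 0 <= s -> adapted_coef F r c ->
  L1 Pr (fun o => stepIs r L c j s o ^+ 2).
Proof.
move=> gr s0 ac; rewrite -stepI_clip//.
exact: (stepI_L2 uF W L j (grid_clip gr s0) (clip_adapted gr s0 ac)).
Qed.

Lemma stepIs_lenglart r L c j s (A : set Omega) (eta : R) : grid r -> 0 <= s ->
  adapted_coef F r c -> measurable A -> 0 < eta -> eta <= 1 ->
  (pmet Pr (fun o => (\1_A o * stepIs r L c j s o ^+ 2)%:E) <=
   (K j j * eta)%:E + (eta^-1)%:E *
     pmet Pr (fun o => (\1_A o * runsq (dgrid (clipg r s)) c L o)%:E))%E.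
Proof.
move=> gr s0 ac mA eta0 eta1; rewrite -stepI_clip//.
have -> : (fun o => (\1_A o * runsq (dgrid (clipg r s)) c L o)%:E) =
    (fun o => (\1_A o * runsq (dgrid (clipg r s)) (clipc r s c) L o)%:E).
  by apply/funext => o; rewrite runsq_clip.
exact: (stepI_lenglart uF W L j (grid_clip gr s0) (clip_adapted gr s0 ac)).
Qed.

Lemma stepIs_cov r L c c' j j' s : grid r -> 0 <= s -> adapted_coef F r c ->
  adapted_coef F r c' ->
  \int[Pr]_o (stepIs r L c j s o * stepIs r L c' j' s o) =
  K j j' * \sum_(l < L) dgrid (clipg r s) l * \int[Pr]_o (c l o * c' l o).
Proof.
move=> gr s0 ac ac'; rewrite -!stepI_clip//.
rewrite (stepI_cov uF W L _ _ (grid_clip gr s0) (clip_adapted gr s0 ac)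
  (clip_adapted gr s0 ac')).
congr (_ * _); apply: eq_bigr => l _; rewrite -/(dgrid _ _) /clipc.
have [rs|sr] := ltP (r l) s; first by under eq_Rintegral do rewrite !mulr1.
by rewrite /dgrid -(clip_eq gr sr) subrr !mul0r.
Qed.

Lemma stepIs_martingale r L c j s t Z (C : R) : grid r -> adapted_coef F r c ->
  0 <= s -> s <= t -> meas_wrt (F s) Z -> (forall o, `|Z o| <= C) ->
  \int[Pr]_o (Z o * stepIs r L c j t o) = \int[Pr]_o (Z o * stepIs r L c j s o).
Proof.
move=> gr ac s0 st FZ bZ; have t0 := le_trans s0 st.
have mZ := meas_wrt_measurable (filtration_sub uF s0) FZ.
have LZ u : 0 <= u -> L1 Pr (fun o => Z o * stepIs r L c j u o).
  move=> u0; apply: L1M_bounded bZ => //.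
  by apply: L1_of_sqr; [exact: stepIs_measurable|exact: stepIs_L2].
apply/eqP; rewrite -subr_eq0 -RintB//; [|exact: LZ|exact: LZ].
pose a l := Num.max s (clipg r t l).
have diffE o : Z o * stepIs r L c j t o - Z o * stepIs r L c j s o =
    \sum_(l < L) (Z o * c l o) * incr w j (a l) (a l.+1) o.
  rewrite -mulrBr -sumrB mulr_sumr; apply: eq_bigr => l _.
  rewrite -mulrBr -mulrA; congr (_ * (_ * _)).
  have E x : w (Num.min x t) o j 0 - w (Num.min x s) o j 0 =
      w (Num.max s (Num.min x t)) o j 0 - w s o j 0.
    have [xs|/ltW sx] := leP x s.
      by rewrite (min_l (le_trans xs st)) (max_l xs) !subrr.
    by rewrite (max_r (y := Num.min x t))// le_min sx st.
  have := E (r l); have := E (r l.+1); rewrite /incr /a /clipg; lra.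
under eq_Rintegral do rewrite diffE.
have a0 l : 0 <= a l by rewrite le_max s0.
have aS l : a l <= a l.+1.
  by rewrite ge_max !le_max lexx/= (grid_clip gr t0).2 orbT.
have term l : L1 Pr (fun o => (Z o * c l o) * incr w j (a l) (a l.+1) o) /\
    \int[Pr]_o ((Z o * c l o) * incr w j (a l) (a l.+1) o) = 0.
  have [rt|tr] := leP (r l) t; last first.
    have -> : a l = a l.+1 by rewrite /a (clip_eq gr (ltW tr)).
    have -> : (fun o => (Z o * c l o) * incr w j (a l.+1) (a l.+1) o) = fun=> 0.
      by apply/funext => o; rewrite /incr subrr mulr0.
    by split; [exact: L1_cst|rewrite Rintegral_prob_cst].
  have rla : r l <= a l by rewrite /a /clipg le_max min_l// lexx orbT.
  have [mc [C' bC']] := ac l.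
  apply: (incr_mean uF W) => //.
  - apply: meas_wrtM; first exact: (filtration_sigma uF).
      by apply: meas_wrt_sub FZ; apply: (filtration_nd uF) => //; rewrite le_max lexx.
    by apply: meas_wrt_sub mc; apply: (filtration_nd uF) => //; exact: grid_ge0.
  - apply: L1M_bounded bZ => //.
    exact: (adapted_coef_L1 uF l gr ac).
rewrite Rint_sum; last by move=> l; exact: (term l).1.
by rewrite big1// => l _; rewrite (term l).2.
Qed.

Lemma cell_unique (r : nat -> R) s l l' : grid r -> r l < s -> s <= r l.+1 ->
  r l' < s -> s <= r l'.+1 -> l = l'.
Proof.
move=> gr h1 h2 h3 h4; apply/eqP; rewrite eqn_leq; apply/andP; split;
  rewrite leqNgt; apply/negP => ll.
  have := grid_mono gr ll; rewrite leNgt (lt_le_trans h1 h4)//.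
have := grid_mono gr ll; rewrite leNgt (lt_le_trans h3 h2)//.
Qed.

Lemma stepVM r L c c' s o : grid r ->
  stepV r L c s o * stepV r L c' s o =
  \sum_(l < L) (c l o * c' l o) * \1_(`]r l, r l.+1]%classic) s.
Proof.
move=> gr; rewrite /stepV mulr_suml; apply: eq_bigr => l _.
rewrite [X in _ * X](bigD1 l)//= mulrDr [X in _ + X]mulr_sumr [X in _ + X]big1 ?addr0; last first.
  move=> l' l'l; rewrite !indicE; have [sl|sl] := boolP (s \in `]r l, r l.+1]%classic); last first.
    by rewrite mulr0 mul0r.
  have [sl'|sl'] := boolP (s \in `]r l', r l'.+1]%classic); last by rewrite !mulr0.
  move: sl sl'; rewrite !inE/= !in_itv/= => /andP[h1 h2] /andP[h3 h4].
  by move: l'l; rewrite -val_eqE/= (cell_unique gr h1 h2 h3 h4) eqxx.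
by rewrite indicE; case: (_ \in _); rewrite !(mulr1, mulr0)// .
Qed.

Lemma stepV_integral r L c c' t o : grid r -> 0 <= t ->
  \int[lebT t]_s (stepV r L c s o * stepV r L c' s o) =
  \sum_(l < L) dgrid (clipg r t) l * (c l o * c' l o).
Proof.
move=> gr t0; under eq_Rintegral do rewrite stepVM//.
have Li l : L1 (lebT t) (fun s => \1_(`]r l, r l.+1]%classic) s : R).
  apply: (@L1_bounded _ _ _ _ _ 1).
    by apply: measurable_indic; exact: measurable_itv.
  by move=> s; rewrite indicE normr_nat lern1 leq_b1.
rewrite Rint_sum; last by move=> l; exact: L1Zl.
apply: eq_bigr => l _; rewrite RintZ// lebT_itv ?gr.2 ?grid_ge0//.
by rewrite mulrC.
Qed.

Lemma stepV_measurable r L c : grid r -> adapted_coef F r c ->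
  measurable_fun setT (fun z : measurableTypeR R * Omega => stepV r L c z.1 z.2).
Proof.
move=> gr ac; apply: measurable_sum => l; apply: measurable_funM.
  apply: measurableT_comp; last exact: measurable_snd.
  exact: (adapted_coef_measurable uF l gr ac).
apply: measurableT_comp; last exact: measurable_fst.
by apply: measurable_indic; exact: measurable_itv.
Qed.

End Refinement.

(** * Refinement of simple processes *)
Section RefineSimple.
Context (R : realType) (d : measure_display) (Omega : measurableType d).
Variables (Pr : probability Omega R) (F : R -> set (set Omega)).
Variables (q : nat) (w : R -> Omega -> 'cV[R]_q).
Hypothesis uF : usual_filtration Pr F.

(** The end points of the interval being grid points, the cells that it contains
    cover it. *)
Lemma telescope_cells (phi : R -> R) (r : nat -> R) (L : nat) (a b t : R) : grid r ->
  (forall l, r l <= t) -> a <= b ->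
  (exists2 p, (p <= L)%N & Num.min a t = r p) ->
  (exists2 p, (p <= L)%N & Num.min b t = r p) ->
  \sum_(l < L) ((a <= r l) && (r l.+1 <= b))%:R * (phi (r l.+1) - phi (r l)) =
  phi (Num.min b t) - phi (Num.min a t).
Proof.
move=> gr rt ab [p pL pE] [p' p'L p'E].
wlog pp' : p' p'L p'E / (p <= p')%N.
  move=> hw; have [pp'|/ltnW p'p] := leqP p p'; first exact: hw pp'.
  apply: (hw p) => //; rewrite -pE; apply/eqP; rewrite eq_le.
  rewrite [X in X && _](_ : _ = true).
    by rewrite le_min !ge_min ab lexx orbT.
  by rewrite p'E pE; exact: grid_mono.
have mono := grid_mono gr.
transitivity (\sum_(l < L | (p <= l < p')%N) (phi (r l.+1) - phi (r l))).
  rewrite [RHS]big_mkcond/=; apply: eq_bigr => l _.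
  have degen : r l.+1 <= r l -> phi (r l.+1) - phi (r l) = 0.
    move=> h; rewrite (_ : r l.+1 = r l) ?subrr//.
    by apply/eqP; rewrite eq_le h gr.2.
  have at_ : Num.min a t <= a by rewrite ge_min lexx.
  have bt_ : Num.min b t <= b by rewrite ge_min lexx.
  have [lp|pl] := ltnP l p => /=.
    case: andP => [[h1 h2]|_]; last by rewrite mul0r.
    rewrite degen ?mulr0//; apply: le_trans h1.
    by apply: le_trans at_; rewrite pE; exact: mono.
  have [lp'|p'l] := ltnP l p' => /=.
    have h2 : r l.+1 <= b by apply: le_trans bt_; rewrite p'E; exact: mono.
    have [at'|ta] := leP a t.
      rewrite min_l// in pE.
      by rewrite h2 pE (mono p l)// mul1r.
    rewrite min_r in pE; last exact: ltW.
    by rewrite degen ?mulr0// (le_trans (rt _))// pE; exact: mono.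
  case: andP => [[h1 h2]|_]; last by rewrite mul0r.
  rewrite degen ?mulr0//; apply: (@le_trans _ _ (Num.min b t)).
    by rewrite le_min h2 rt.
  by rewrite p'E; exact: mono.
rewrite p'E pE -(telescope_sumr (phi \o r) pp')/=.
rewrite (@big_nat_widenl _ _ _ p 0%N)// (@big_nat_widen _ _ _ 0%N p' L)// big_mkord.
by apply: eq_bigl => i; rewrite andTb.
Qed.

(** The coefficients of [H] read on a finer grid: each cell of [r] lies in at most
    one of the intervals of [H], up to degenerate cells. *)
Definition refc (H : simple_process F) (r : nat -> R) (l : nat) (o : Omega) : R :=
  \sum_(k < sp_size H) sp_coef H k o *
    ((sp_time H k <= r l) && (r l.+1 <= sp_time H k.+1))%:R.

Definition refines (H : simple_process F) (r : nat -> R) (L : nat) (t : R) :=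
  forall k, (k <= sp_size H)%N -> exists2 p, (p <= L)%N & Num.min (sp_time H k) t = r p.

Lemma sp_time_nonneg (H : simple_process F) k : 0 <= sp_time H k.
Proof. by elim: k => [|k IH]; [exact: sp_time_ge0|exact: le_trans IH (sp_time_nd H k)]. Qed.

Lemma refc_adapted H r : grid r -> adapted_coef F r (refc H r).
Proof.
move=> gr l; split.
  have sF : sigma_algebra setT (F (r l)) by exact: (filtration_sigma uF (grid_ge0 l gr)).
  apply: (meas_wrt_sum sF) => k; have [h|h] := leP (sp_time H k) (r l) => /=.
    apply: (meas_wrtM sF); last exact: meas_wrt_cst.
    apply: meas_wrt_sub (sp_coef_meas H k).
    by apply: (filtration_nd uF) => //; exact: sp_time_nonneg.
  by under eq_fun do rewrite mulr0; exact: (meas_wrt_cst sF 0).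
have [C HC] := choice (sp_coef_bounded H).
exists (\sum_(k < sp_size H) C k) => o.
apply: le_trans (ler_norm_sum _ _ _) _; apply: ler_sum => k _.
by rewrite normrM; apply: le_trans (HC k o); rewrite ler_piMr// normr_nat lern1 leq_b1.
Qed.

Lemma refc_sum (phi : R -> R) H r L t o : grid r -> (forall l, r l <= t) ->
  refines H r L t ->
  \sum_(l < L) refc H r l o * (phi (r l.+1) - phi (r l)) =
  \sum_(k < sp_size H) sp_coef H k o *
    (phi (Num.min (sp_time H k.+1) t) - phi (Num.min (sp_time H k) t)).
Proof.
move=> gr rt Hr; under eq_bigr do rewrite mulr_suml.
rewrite exchange_big/=; apply: eq_bigr => k _.
under eq_bigr do rewrite -mulrA.
rewrite -mulr_sumr (telescope_cells _ gr rt) ?sp_time_nd//; apply: Hr => //.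
exact: ltnW.
Qed.

Lemma refc_integral H r L t s j o : grid r -> (forall l, r l <= t) ->
  refines H r L t -> s <= t ->
  stepIs w r L (refc H r) j s o = sp_integral (fun s o => w s o j 0) H s o.
Proof.
move=> gr rt Hr st; rewrite /stepIs /incr /clipg.
rewrite (refc_sum (fun y => w (Num.min y s) o j 0) o gr rt Hr).
apply: eq_bigr => k _.
by rewrite -!minA (min_r st).
Qed.

Lemma itv_indic_diff (a b s : R) : a <= b ->
  \1_(`]a, b]%classic) s = (s <= b)%R%:R - (s <= a)%R%:R :> R.
Proof.
move=> ab; rewrite indicE; have [sa|as_] := leP s a.
  by rewrite (le_trans sa ab) subrr memNset//= in_itv/= ltNge sa.
have [sb|bs] := leP s b; first by rewrite mem_set ?subr0//= in_itv/= as_.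
by rewrite memNset ?subr0//= in_itv/= leNgt bs andbF.
Qed.

Lemma refc_val H r L t s o : grid r -> (forall l, r l <= t) ->
  refines H r L t -> s <= t ->
  stepV r L (refc H r) s o = sp_val H s o.
Proof.
move=> gr rt Hr st.
transitivity (\sum_(l < L) refc H r l o * ((s <= r l.+1)%R%:R - (s <= r l)%R%:R)).
  by apply: eq_bigr => l _; rewrite itv_indic_diff// gr.2.
rewrite (refc_sum (fun y => (s <= y)%R%:R) o gr rt Hr).
apply: eq_bigr => k _; rewrite itv_indic_diff ?sp_time_nd//.
by rewrite !le_min st !andbT.
Qed.

End RefineSimple.

Section CommonGrid.
Variable R : realType.

(** Only finitely many points are prescribed, so they can be merged with a
    regular grid of step at most [h] and sorted. *)
Lemma common_grid (pts : seq R) (t h : R) : 0 <= t -> 0 < h ->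
  {in pts, forall x, 0 <= x <= t} ->
  exists (r : nat -> R) (L : nat),
    [/\ grid r, forall l, r l <= t, r 0%N = 0 & forall l, r l.+1 <= r l + h] /\
    [/\ forall x, x \in pts -> exists p, (p <= L)%N /\ x = r p &
      exists p, (p <= L)%N /\ r p = t].
Proof.
move=> t0 h0 pts_t; pose N := (Num.truncn (t / h)).+1.
pose fine_pts := [seq Num.min (i%:R * h) t | i <- iota 0 N.+1].
pose s := sort <=%R (0 :: t :: pts ++ fine_pts).
have s_t x : x \in s -> 0 <= x <= t.
  rewrite mem_sort !inE mem_cat => /or3P[/eqP->|/eqP->|/orP[/pts_t//|/mapP[i _ ->]]].
  - by rewrite lexx t0.
  - by rewrite lexx t0.
  - by rewrite le_min ge_min lexx t0 orbT mulr_ge0// ltW.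
pose r l := nth t s l.
have rin l : r l \in s.
  rewrite /r; have [ls|ls] := ltnP l (size s); first exact: mem_nth.
  by rewrite nth_default// mem_sort !inE eqxx orbT.
have ss : sorted <=%R s by exact: sort_le_sorted.
have rmono : {homo r : m n / (m <= n)%N >-> m <= n}.
  move=> m n mn; rewrite /r; have [ns|ns] := ltnP n (size s).
    by apply: (sorted_leq_nth le_trans lexx t ss) => //; rewrite inE// (leq_ltn_trans mn).
  by rewrite [leRHS]nth_default//; have /andP[] := s_t _ (rin m).
have gr : grid r.
  split; first by have /andP[] := s_t _ (rin 0%N).
  by move=> l; exact: rmono.
have sr x : x \in s -> exists2 p, (p <= size s)%N & x = r p.
  by move=> xs; exists (index x s); rewrite ?index_size// /r nth_index.
exists r, (size s); split; last first.
  split; last by exists (size s); split => //; rewrite /r nth_default.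
  move=> x xp; have [|p pL pE] := sr x; last by exists p.
  by rewrite mem_sort !inE mem_cat xp !orbT.
split => //.
- by move=> l; have /andP[] := s_t _ (rin l).
- have [|p _ p0] := sr 0; first by rewrite mem_sort inE eqxx.
  by apply/eqP; rewrite eq_le [X in X && _](_ : _ = true) ?gr.1// p0; exact: rmono.
- move=> l; have /andP[rl0 rlt] := s_t _ (rin l).
  have /andP[rS0 rSt] := s_t _ (rin l.+1).
  have [tl|lt] := leP t (r l + h); first exact: le_trans rSt tl.
  pose i := (Num.truncn (r l / h)).+1.
  have rh0 : 0 <= r l / h by rewrite divr_ge0// ltW.
  have /andP[i1 i2] := truncn_itv rh0.
  rewrite -/i in i2.
  have ih1 : r l < i%:R * h by rewrite -ltr_pdivrMr.
  have ih2 : i%:R * h <= r l + h.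
    by rewrite /i -natr1 mulrDl mul1r lerD2r -ler_pdivlMr.
  have [p _ pE] : exists2 p, (p <= size s)%N & i%:R * h = r p.
    apply: sr; rewrite mem_sort !inE mem_cat; apply/orP; right; apply/orP; right.
    apply/orP; right; apply/mapP; exists i.
      rewrite mem_iota add0n ltnS /i ltnS; apply: le_truncn.
      by rewrite ler_pM2r ?invr_gt0.
    by rewrite min_l// (le_trans ih2)// ltW.
  have lp : (l < p)%N.
    by rewrite ltnNge; apply/negP => /rmono; rewrite -pE leNgt ih1.
  by apply: le_trans ih2; rewrite pE; exact: rmono.
Qed.

End CommonGrid.

(** * Time integrals of adapted processes are adapted *)
Section ProgressiveIntegral.
Context (R : realType) (d : measure_display) (Omega : measurableType d).
Variable Pr : probability Omega R.
Variable G : set (set Omega).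
Hypothesis sG : sigma_algebra setT G.
Hypothesis GM : G `<=` measurable.
Hypothesis Gnull : forall N, Pr.-negligible N -> G N.

(** The Radon-Nikodym derivative, on [G], of the charge with density [Z]. *)
Lemma conditional_expectation (Z : Omega -> R) : L1 Pr Z ->
  exists Z' : Omega -> R, [/\ meas_wrt G Z', L1 Pr Z' &
    forall A, G A -> \int[Pr]_(o in A) Z o = \int[Pr]_(o in A) Z' o].
Proof.
move=> LZ; have GE := measurable_g_measurableTypeE sG.
pose Om' := g_sigma_algebraType G.
have mid : measurable_fun setT (id : Omega -> Om').
  by move=> _ A; rewrite GE => GA; rewrite setTI; exact: GM.
pose id_mix := isMeasurableFun.Build _ _ _ _ _ mid.
pose idp : {mfun Omega >-> Om'} := HB.pack (id : Omega -> Om') id_mix.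
pose P' := distribution Pr idp.
pose nu0 : {charge set Om' -> \bar R} := pushforward (induced_charge LZ) idp.
pose nu := nu0 mid.
have nuP : nu `<< P'.
  apply/null_content_dominatesP => A mA P0.
  rewrite /nu /nu0/= /pushforward/= /induced_charge.
  apply: null_set_integral => //.
  - by apply: GM; rewrite -GE.
  - by apply: measurable_funTS; exact: measurable_int LZ.
pose g := Radon_Nikodym nu P'.
have gi : P'.-integrable setT g by exact: Radon_Nikodym_integrable.
have gf o : g o \is a fin_num by exact: Radon_Nikodym_fin_num.
have mg : measurable_fun (setT : set Om') g by exact: measurable_int gi.
have GZ' : meas_wrt G (fun o => fine (g o)).
  by apply/meas_wrtP => //; apply: measurableT_comp => //.
have mZ' : measurable_fun (setT : set Omega) (fun o => fine (g o)).
  exact: meas_wrt_measurable GM GZ'.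
have LZ' : L1 Pr (fun o => fine (g o)).
  apply/integrableP; split; first exact/measurable_EFinP.
  have /integrableP[_] := gi; rewrite ge0_integral_distribution//; last exact: measurableT_comp.
  move=> goo; apply: le_lt_trans goo; rewrite le_eqVlt; apply/orP; left; apply/eqP.
  by apply: eq_integral => o _; rewrite /= -[in RHS](fineK (gf o)).
exists (fun o => fine (g o)); split => // A GA.
have mA : measurable (A : set Om') by rewrite GE.
have mA' : measurable A by exact: GM.
rewrite /Rintegral; congr fine.
have := Radon_Nikodym_integral nuP mA.
rewrite /nu /nu0/= /pushforward/= /induced_charge preimage_id => ->.
rewrite -/g integral_mkcond integral_distribution//; last 2 first.
- apply: (proj1 (measurable_restrictT g mA)); apply: (measurable_funS measurableT _ mg); exact: subsetT.
- rewrite (_ : _ \o _ = (EFin \o (fun o => fine (g o))) \_ A).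
    by apply/(integrable_mkcond _ mA'); exact: integrableS LZ'.
  by apply/funext => o; rewrite /patch/=; case: ifP => //; rewrite fineK.
rewrite [RHS]integral_mkcond; apply: eq_integral => o _ /=.
by rewrite /patch; case: ifP => //; rewrite fineK.
Qed.

(** Indicators of level sets of [h] approximate it uniformly. *)
Lemma orthogonal_bounded (D h : Omega -> R) (m : nat) : L1 Pr D ->
  (forall A, G A -> \int[Pr]_(o in A) D o = 0) ->
  meas_wrt G h -> (forall o, 0 <= h o <= m%:R) ->
  \int[Pr]_o (h o * D o) = 0.
Proof.
move=> LD D0 Gh hm.
have mh := meas_wrt_measurable GM Gh.
have hb o : `|h o| <= m%:R by have /andP[h0 h1] := hm o; rewrite ger0_norm.
have LhD := L1M_bounded mh LD hb.
pose E (n k : nat) := [set o | (k.+1%:R <= n.+1%:R * h o)%R].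
have GE n k : G (E n k).
  have GN : meas_wrt G (fun o => - (n.+1%:R * h o)).
    by apply: (@meas_wrt_comp _ _ _ _ sG _ (fun x => - (n.+1%:R * x))) Gh; apply: measurable_funN; exact: measurable_funM.
  have := meas_wrt_le (- k.+1%:R) GN.
  by rewrite (_ : [set _ | _] = E n k)//; apply/seteqP; split => o; rewrite /E/= lerN2.
pose hn n o := n.+1%:R^-1 * \sum_(k < m * n.+1) (\1_(E n k) o : R).
have hnE n o : `|h o - hn n o| <= n.+1%:R^-1.
  have /andP[h0 h1] := hm o.
  set y := n.+1%:R * h o.
  have y0 : 0 <= y by rewrite mulr_ge0.
  have ym : (Num.truncn y <= m * n.+1)%N.
    apply: leq_trans (le_truncn (_ : y <= (m * n.+1)%:R)) _; last by rewrite natrK.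
    by rewrite natrM mulrC /y ler_wpM2l.
  rewrite /hn.
  have -> : \sum_(k < m * n.+1) (\1_(E n k) o : R) = (Num.truncn y)%:R.
    rewrite -[in RHS](card_ord (Num.truncn y)) -sum1_card natr_sum.
    rewrite (big_ord_widen_cond (m * n.+1) predT (fun=> 1%:R))//=.
    rewrite [RHS]big_mkcond; apply: eq_bigr => k _; rewrite indicE.
    rewrite (truncn_gt_nat y k).
    by case: ifPn => yk; [rewrite mem_set//|rewrite memNset//; exact/negP].
  rewrite -(ler_pM2l (ltr0Sn R n)) mulfV ?pnatr_eq0// -{1}(ger0_norm (ler0n R n.+1)).
  rewrite -normrM mulrBr mulrA mulfV ?pnatr_eq0// mul1r -/y.
  have /andP[t1 t2] := truncn_itv y0.
  by rewrite ger0_norm ?subr_ge0// lerBlDl natr1 ltW.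
have mE n k : measurable (E n k) by exact: GM.
have Lhn n : L1 Pr (fun o => hn n o * D o).
  apply: (@L1M_bounded _ _ _ _ _ _ (m%:R + 1)) => //.
    apply: measurable_funM => //; apply: measurable_sum => k.
    exact: measurable_indic.
  move=> o; have hnn : hn n o = h o - (h o - hn n o) by rewrite opprB addrC subrK.
  rewrite hnn; apply: le_trans (ler_normB _ _) _; apply: lerD => //.
  by apply: le_trans (hnE n o) _; rewrite invf_le1// ler1n.
have Ehn n : \int[Pr]_o (hn n o * D o) = 0.
  under eq_Rintegral do rewrite /hn -mulrA mulr_suml.
  have Lk k : L1 Pr (fun o => \1_(E n k) o * D o).
    apply: (@L1M_bounded _ _ _ _ (\1_(E n k) : Omega -> R) _ 1) => //.
    by move=> o; rewrite indicE normr_nat lern1 leq_b1.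
  rewrite RintZ; last exact: L1_sum.
  rewrite Rint_sum// big1 ?mulr0// => k _.
  rewrite -[RHS](D0 _ (GE n k)) [RHS]Rintegral_mkcond; apply: eq_Rintegral => o _.
  by rewrite /patch indicE; case: ifP; rewrite ?mul1r ?mul0r.
have LaD := L1_abs LD.
have bound n : `|\int[Pr]_o (h o * D o)| <= n.+1%:R^-1 * \int[Pr]_o `|D o|.
  rewrite -[X in `|X|]subr0 -(Ehn n) -RintB//.
  apply: (le_trans (Rint_abs (L1B LhD (Lhn n)))); rewrite -RintZ//.
  apply: Rint_le; [exact: L1_abs (L1B LhD (Lhn n))|exact: L1Zl|].
  by move=> o; rewrite -mulrBl normrM ler_wpM2r.
apply/eqP; rewrite -normr_le0; apply/ler_addgt0Pr => e e0; rewrite add0r.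
have I0 : 0 <= \int[Pr]_o `|D o| by exact: Rintegral_ge0.
pose n := Num.truncn ((\int[Pr]_o `|D o|) / e).
apply: le_trans (bound n) _.
rewrite ler_pdivrMl// -ler_pdivrMr//.
exact/ltW/truncnS_gt.
Qed.

Lemma null_ae_sub (A B : set Omega) : G A -> {ae Pr, forall o, A o <-> B o} -> G B.
Proof.
move=> GA [N [mN N0 AB]].
have GN : G N by apply: Gnull; exists N; split.
have GE := measurable_g_measurableTypeE sG.
have GBN : G (B `&` N) by apply: Gnull; exists N; split => // o [].
rewrite (_ : B = (A `\` N) `|` (B `&` N)).
  rewrite -GE in GA GN GBN *; apply: measurableU => //; exact: measurableD.
apply/seteqP; split => o.
  move=> Bo; have [No|No] := pselect (N o); first by right.
  left; split => //; apply: contrapT => Ao; apply: No; apply: AB => /= h.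
  by apply: Ao; apply/h.
move=> [[Ao No]|[]//]; apply: contrapT => Bo; apply: No; apply: AB => /= h.
by apply: Bo; apply/h.
Qed.

Lemma L1prod_snd d1 (S : measurableType d1) (nu : {finite_measure set S -> \bar R})
    (D : Omega -> R) : L1 Pr D -> L1prod nu Pr (fun _ o => D o).
Proof.
move=> LD; apply/integrable12ltyP.
  apply/measurable_EFinP; apply: measurableT_comp (L1_measurable LD) _.
  exact: measurable_snd.
have /integrableP[_ Doo] := LD.
have D0 : (0 <= \int[Pr]_o `|(D o)%:E|)%E by apply: integral_ge0.
rewrite (_ : (fun _ => _) = cst (\int[Pr]_o `|(D o)%:E|)%E)// integral_cst//.
apply: lte_mul_pinfty => //; first by rewrite ge0_fin_numE.
by rewrite -ge0_fin_numE// fin_num_measure.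
Qed.

(** The square of the distance of the time integral [Z] to the truncation [h]
    of its conditional expectation vanishes, because every section of [g] is
    orthogonal to [Z] minus that conditional expectation. *)
Lemma prog_bounded d1 (S : measurableType d1) (nu : {finite_measure set S -> \bar R})
    (g : S -> Omega -> R) (m : nat) : jmeas g -> (forall r o, 0 <= g r o <= m%:R) ->
  (forall r, meas_wrt G (g r)) ->
  forall c : R, G [set o | \int[nu]_r g r o <= c].
Proof.
move=> jg gm Gg c.
have gb r o : `|g r o| <= m%:R by have /andP[g0 g1] := gm r o; rewrite ger0_norm.
pose Z o := \int[nu]_r g r o.
have Lg : L1prod nu Pr g by exact: L1prod_bounded gb.
have LZ : L1 Pr Z by exact: L1prod_inner2 Lg.
have [Z' [GZ' LZ' ZZ']] := conditional_expectation LZ.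
have mZ := L1_measurable LZ; have mZ' := L1_measurable LZ'.
have nufin : fine (nu setT) >= 0 by exact: fine_ge0.
pose M := (Num.truncn (m%:R * fine (nu setT))).+1.
have Lgo o : L1 nu (fun r => g r o).
  by apply: (@L1_bounded _ _ _ _ _ m%:R) => //; exact: jmeas2.
have ZM o : 0 <= Z o <= M%:R.
  rewrite Rintegral_ge0/=; last by move=> r _; have /andP[] := gm r o.
  apply: le_trans (ltW (truncnS_gt _)); rewrite -Rintegral_cst//.
  by apply: Rint_le => //; [exact: L1_cst|move=> r; have /andP[] := gm r o].
pose h o := Num.max 0 (Num.min (Z' o) M%:R).
have Gh : meas_wrt G h.
  apply: (@meas_wrt_comp _ _ _ _ sG _ (fun x => Num.max 0 (Num.min x M%:R))) GZ'.
  by apply: measurable_maxr => //; exact: measurable_minr.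
have mh := meas_wrt_measurable GM Gh.
have hM o : 0 <= h o <= M%:R by rewrite le_max lexx/= ge_max ler0n/= ge_min lexx orbT.
pose D o := Z o - Z' o.
have LD : L1 Pr D by exact: L1B.
have D0 A : G A -> \int[Pr]_(o in A) D o = 0.
  move=> GA; have mA := GM GA.
  rewrite RintegralB//; [by rewrite ZZ' ?subrr|exact: integrableS LZ|exact: integrableS LZ'].
have hD := orthogonal_bounded LD D0 Gh hM.
have ZD : \int[Pr]_o (Z o * D o) = 0.
  have LgD : L1prod nu Pr (fun r o => g r o * D o).
    apply: (@L1prod_le _ _ _ _ _ _ _ _ (fun _ o => m%:R * `|D o|)).
    - apply: (@measurable_funM _ _ _ setT (fun z => g z.1 z.2) (D \o snd)) => //.
      by apply: measurableT_comp => //; exact: L1_measurable LD.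
    - by move=> r o; rewrite normrM ler_wpM2r.
    - apply: (@L1prod_snd _ _ _ (fun o => m%:R * `|D o|)).
      exact: (L1Zl _ (L1_abs LD)).
  transitivity (\int[Pr]_o \int[nu]_r (g r o * D o)).
    by apply: eq_Rintegral => o _; rewrite RintegralZr//; exact: Lgo.
  rewrite -(RFubini LgD).
  under eq_Rintegral do rewrite (orthogonal_bounded LD D0 (Gg _) (gm _)).
  by rewrite Rintegral_cst// mul0r.
have hb o : `|h o| <= M%:R by have /andP[h0 h1] := hM o; rewrite ger0_norm.
have Zb o : `|Z o| <= M%:R by have /andP[h0 h1] := ZM o; rewrite ger0_norm.
have LhD := L1M_bounded mh LD hb; have LZD := L1M_bounded mZ LD Zb.
have mZh : measurable_fun setT (fun o => (Z o - h o) ^+ 2).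
  exact/measurable_funX/measurable_funB.
have LZh : L1 Pr (fun o => (Z o - h o) ^+ 2).
  apply: (@L1_bounded _ _ _ _ _ ((M%:R + M%:R) ^+ 2)) => // o.
  rewrite normrX lerXn2r ?nnegrE//.
  by apply: le_trans (ler_normB _ _) _; exact: lerD.
have : \int[Pr]_o (Z o - h o) ^+ 2 <= 0.
  apply: (@le_trans _ _ (\int[Pr]_o (Z o * D o - h o * D o))).
    apply: Rint_le => //; first exact: L1B.
    move=> o; have /andP[z0 z1] := ZM o; rewrite -mulrBl /D /h.
    have [zM|Mz] := leP (Z' o) M%:R.
      have [z'0|z'0] := leP 0 (Z' o); first by rewrite expr2.
      rewrite subr0 expr2 ler_wpM2l//; lra.
    rewrite max_r ?ler0n// expr2 -subr_ge0 -mulrBr mulr_le0//; lra.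
  by rewrite RintB// ZD hD subrr.
move=> le0; apply: (@null_ae_sub [set o | h o <= c]); first exact: meas_wrt_le.
have : {ae Pr, forall o, setT o -> ((Z o - h o) ^+ 2)%:E = 0%E}.
  apply/(ae_eq_integral_abs _ measurableT) => //; first exact/measurable_EFinP.
  under eq_integral do rewrite gee0_abs ?lee_fin ?sqr_ge0//.
  rewrite -L1E//; congr (_%:E); apply/eqP; rewrite eq_le le0/=.
  by apply: Rintegral_ge0 => o _; exact: sqr_ge0.
apply: filterS => o /(_ I) [] /eqP; rewrite sqrf_eq0 subr_eq0 => /eqP zh.
by rewrite /= -zh.
Qed.

(** The time integral agrees almost surely with its conditional expectation, and
    [G] contains the null sets; truncating [g] reduces to the bounded case. *)
Lemma prog_integral d1 (S : measurableType d1) (nu : {finite_measure set S -> \bar R})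
    (g : S -> Omega -> R) : jmeas g -> (forall r o, 0 <= g r o) ->
  (forall r, meas_wrt G (g r)) ->
  forall c : R, G [set o | (\int[nu]_r (g r o)%:E <= c%:E)%E].
Proof.
move=> jg g0 Gg c.
pose gk (k : nat) r o := Num.min (g r o) k%:R.
have jgk k : jmeas (gk k) by exact: measurable_minr.
have gk0 k r o : 0 <= gk k r o <= k%:R.
  by rewrite le_min g0 ler0n/= ge_min lexx orbT.
have Lgk k o : L1 nu (fun r => gk k r o).
  apply: (@L1_bounded _ _ _ _ _ k%:R); first exact: jmeas2.
  by move=> r; have /andP[h0 h1] := gk0 k r o; rewrite ger0_norm.
have -> : [set o | (\int[nu]_r (g r o)%:E <= c%:E)%E] =
    \bigcap_k [set o | \int[nu]_r gk k r o <= c].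
  apply/seteqP; split => o /=.
    move=> gc k _ /=; rewrite -lee_fin L1E//; apply: le_trans gc.
    apply: ge0_le_integral => //.
    - by move=> r _; rewrite lee_fin; have /andP[] := gk0 k r o.
    - exact/measurable_EFinP/jmeas2.
    - exact/measurable_EFinP/jmeas2.
    - by move=> r _; rewrite lee_fin ge_min lexx.
  move=> gc; apply: integral_trunc_le => [|//|k]; first exact: jmeas2.
  rewrite -(L1E (Lgk k o)) lee_fin; exact: gc k I.
have GE := measurable_g_measurableTypeE sG.
rewrite -GE; apply: bigcapT_measurable => k; rewrite GE.
by apply: (@prog_bounded _ _ _ _ k) => // r; apply: (@meas_wrt_comp _ _ _ _ sG _ (fun x => Num.min x k%:R)) => //;
  exact: measurable_minr.
Qed.

End ProgressiveIntegral.

(** * Isometry, martingale property and Lenglart bound for simple processes *)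
Section SimpleProcesses.
Context (R : realType) (d : measure_display) (Omega : measurableType d).
Variables (Pr : probability Omega R) (F : R -> set (set Omega)).
Variables (q : nat) (K : 'M[R]_q) (w : R -> Omega -> 'cV[R]_q).
Hypothesis uF : usual_filtration Pr F.
Hypothesis W : wiener_process Pr F K w.
Implicit Types H : simple_process F.

Definition spI (j : 'I_q) H (s : R) (o : Omega) : R :=
  sp_integral (fun s o => w s o j 0) H s o.

Lemma refine_pair H H' (s : R) : 0 <= s -> exists (r : nat -> R) (L : nat),
  [/\ grid r, forall l, r l <= s, refines H r L s & refines H' r L s].
Proof.
move=> s0.
pose pts (H : simple_process F) :=
  [seq Num.min (sp_time H k) s | k <- iota 0 (sp_size H).+1].
have ptsP H0 x : x \in pts H0 -> 0 <= x <= s.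
  by move=> /mapP[k _ ->]; rewrite le_min ge_min lexx s0 orbT sp_time_nonneg.
have [r [L [[gr rs _ _] [ptsr _]]]] := @common_grid _ (pts H ++ pts H') s 1 s0 ltr01
  (fun x => ltac:(rewrite mem_cat => /orP[]; exact: ptsP)).
have mem H0 k : (k <= sp_size H0)%N -> Num.min (sp_time H0 k) s \in pts H0.
  by move=> ks; apply/mapP; exists k => //; rewrite mem_iota add0n ltnS.
exists r, L; split => // k ks.
  by have [|p [pL pE]] := ptsr (Num.min (sp_time H k) s); [rewrite mem_cat mem|exists p].
by have [|p [pL pE]] := ptsr (Num.min (sp_time H' k) s);
  [rewrite mem_cat mem ?orbT|exists p].
Qed.

Lemma spI_measurable j H s : 0 <= s -> measurable_fun setT (spI j H s).
Proof.
move=> s0; have [r [L [gr rs rH _]]] := refine_pair H H s0.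
rewrite (_ : spI j H s = stepIs w r L (refc H r) j s).
  by apply: (stepIs_measurable uF W) => //; exact: (refc_adapted uF).
by apply/funext => o; rewrite (refc_integral w j o gr rs rH).
Qed.

Lemma spI_L2 j H s : 0 <= s -> L1 Pr (fun o => spI j H s o ^+ 2).
Proof.
move=> s0; have [r [L [gr rs rH _]]] := refine_pair H H s0.
rewrite (_ : spI j H s = stepIs w r L (refc H r) j s).
  by apply: (stepIs_L2 uF W) => //; exact: (refc_adapted uF).
by apply/funext => o; rewrite (refc_integral w j o gr rs rH).
Qed.

Lemma sp_val_measurable H : jmeas (sp_val H : measurableTypeR R -> Omega -> R).
Proof.
apply: measurable_sum => l; apply: measurable_funM.
  apply: measurableT_comp; last exact: measurable_snd.
  apply: (meas_wrt_measurable (filtration_sub uF (sp_time_nonneg H l))).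
  exact: sp_coef_meas.
apply: measurableT_comp; last exact: measurable_fst.
by apply: measurable_indic; exact: measurable_itv.
Qed.

Lemma sp_val_bounded H : exists C, forall s o, `|sp_val H s o| <= C.
Proof.
have [C HC] := choice (sp_coef_bounded H).
exists (\sum_(k < sp_size H) C k) => s o.
apply: le_trans (ler_norm_sum _ _ _) _; apply: ler_sum => k _.
rewrite normrM; apply: le_trans (HC k o).
by rewrite ler_piMr// indicE normr_nat lern1 leq_b1.
Qed.

Lemma stepV_ae (s : R) (f g : R -> R) : measurable_fun setT f -> measurable_fun setT g ->
  (forall u, 0 <= u <= s -> f u = g u) -> \int[lebT s]_u f u = \int[lebT s]_u g u.
Proof.
by move=> mf mg fg; apply: Rint_ae => //; exact: ae_lebT_imp.
Qed.

Lemma sp_val_prod_L1 H H' s : L1prod (lebT s) Pr (fun u o => sp_val H u o * sp_val H' u o).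
Proof.
have [C HC] := sp_val_bounded H; have [C' HC'] := sp_val_bounded H'.
apply: (@L1prod_bounded _ _ _ _ _ _ _ _ (C * C')).
  by apply: measurable_funM; exact: sp_val_measurable.
by move=> u o; rewrite normrM ler_pM.
Qed.

Lemma jmeas_prod (f g : measurableTypeR R -> Omega -> R) : jmeas f -> jmeas g ->
  jmeas (fun u o => f u o * g u o).
Proof. exact: measurable_funM. Qed.

(** The Ito isometry in polarized form: on a common refinement both sides are
    sums over the same cells. *)
Lemma sp_cov H H' j j' s : 0 <= s ->
  \int[Pr]_o (spI j H s o * spI j' H' s o) =
  K j j' * \int[Pr]_o \int[lebT s]_u (sp_val H u o * sp_val H' u o).
Proof.
move=> s0; have [r [L [gr rs rH rH']]] := refine_pair H H' s0.
have aH := refc_adapted uF H gr; have aH' := refc_adapted uF H' gr.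
rewrite /spI; under eq_Rintegral do
  rewrite -(refc_integral w j _ gr rs rH) // -(refc_integral w j' _ gr rs rH') //.
rewrite (stepIs_cov uF W)//; congr (_ * _).
have acc := adapted_coefM uF gr aH aH'.
under eq_bigr do rewrite -RintZ ?(adapted_coef_L1 uF _ gr acc)//.
rewrite -Rint_sum; last by move=> l; apply: L1Zl; exact: (adapted_coef_L1 uF _ gr acc).
apply: eq_Rintegral => o _; rewrite -stepV_integral//.
apply: stepV_ae.
- by apply: (jmeas2 o (jmeas_prod _ _)); exact: (stepV_measurable uF).
- by apply: (jmeas2 o (jmeas_prod _ _)); exact: sp_val_measurable.
- by move=> u /andP[_ us]; rewrite !(refc_val _ gr rs)//.
Qed.

(** The increments after [s] are independent of the past and centred. *)
Lemma sp_martingale H j s t Z (C : R) : 0 <= s -> s <= t -> meas_wrt (F s) Z ->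
  (forall o, `|Z o| <= C) ->
  \int[Pr]_o (Z o * spI j H t o) = \int[Pr]_o (Z o * spI j H s o).
Proof.
move=> s0 st FZ bZ; have t0 := le_trans s0 st.
have [r [L [gr rs rH _]]] := refine_pair H H t0.
have E u o : u <= t -> spI j H u o = stepIs w r L (refc H r) j u o.
  by move=> ut; rewrite (refc_integral w j o gr rs rH).
under eq_Rintegral do rewrite E//; under [RHS]eq_Rintegral do rewrite E//.
by apply: (stepIs_martingale uF W) bZ => //; exact: (refc_adapted uF).
Qed.

Lemma sp_lenglart H H' j s (A : set Omega) (eta : R) : 0 <= s -> measurable A ->
  0 < eta -> eta <= 1 ->
  (pmet Pr (fun o => (\1_A o * (spI j H s o - spI j H' s o) ^+ 2)%:E) <=
   (K j j * eta)%:E + (eta^-1)%:E *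
     pmet Pr (fun o => (\1_A o * \int[lebT s]_u ((sp_val H u o - sp_val H' u o) ^+ 2))%:E))%E.
Proof.
move=> s0 mA eta0 eta1; have [r [L [gr rs rH rH']]] := refine_pair H H' s0.
have aH := refc_adapted uF H gr; have aH' := refc_adapted uF H' gr.
pose c l o := refc H r l o - refc H' r l o.
have ac : adapted_coef F r c.
  move=> l; have [m1 [C1 b1]] := aH l; have [m2 [C2 b2]] := aH' l; split.
    by apply: meas_wrtB => //; exact: (filtration_sigma uF (grid_ge0 l gr)).
  by exists (C1 + C2) => o; apply: le_trans (ler_normB _ _) _; exact: lerD.
have := stepIs_lenglart uF W L j gr s0 ac mA eta0 eta1.
have -> : stepIs w r L c j s = (fun o => spI j H s o - spI j H' s o).
  apply/funext => o; rewrite /spI -(refc_integral w j o gr rs rH)//.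
  rewrite -(refc_integral w j o gr rs rH')// /stepIs -sumrB.
  by apply: eq_bigr => l _; rewrite mulrBl.
have -> // : runsq (dgrid (clipg r s)) c L =
    (fun o => \int[lebT s]_u ((sp_val H u o - sp_val H' u o) ^+ 2)).
apply/funext => o; transitivity (\int[lebT s]_u (stepV r L c u o * stepV r L c u o)).
  rewrite stepV_integral//; apply: eq_bigr => l _; by rewrite expr2.
apply: stepV_ae.
- by apply: (jmeas2 o (jmeas_prod _ _)); exact: (stepV_measurable uF).
- apply: measurable_funX; apply: measurable_funB; apply: (jmeas2 o); exact: sp_val_measurable.
- move=> u /andP[_ us]; rewrite -(refc_val o gr rs rH us) -(refc_val o gr rs rH' us) -expr2; congr (_ ^+ 2).
  by rewrite /stepV -sumrB; apply: eq_bigr => l _; rewrite mulrBl.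
Qed.

End SimpleProcesses.

(** * Approximation of the stopped integrand *)
Section TimeIntegrals.
Context (R : realType) (d : measure_display) (Omega : measurableType d).
Variable nu : {finite_measure set (measurableTypeR R) -> \bar R}.
Implicit Types f g : measurableTypeR R -> Omega -> R.

Lemma nnmeas_timeint f : jmeas f -> (forall u o, 0 <= f u o) ->
  nnmeas (fun o => \int[nu]_u (f u o)%:E)%E.
Proof.
move=> jf f0; split; last by move=> o; apply: integral_ge0 => u _; rewrite lee_fin.
apply: (@measurable_fun_fubini_tonelli_G _ _ _ _ _ nu (fun z => (f z.1 z.2)%:E)).
- exact/measurable_EFinP.
- by move=> z; rewrite lee_fin.
Qed.

Lemma jmeas_sqr f : jmeas f -> jmeas (fun u o => f u o ^+ 2).
Proof. exact: measurable_funX. Qed.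

Lemma jmeasB f g : jmeas f -> jmeas g -> jmeas (fun u o => f u o - g u o).
Proof. exact: measurable_funB. Qed.

Lemma jmeasM f g : jmeas f -> jmeas g -> jmeas (fun u o => f u o * g u o).
Proof. exact: measurable_funM. Qed.

Lemma jmeasD f g : jmeas f -> jmeas g -> jmeas (fun u o => f u o + g u o).
Proof. exact: measurable_funD. Qed.

Lemma timeintD_le f g h (a b : R) o : jmeas f -> jmeas g -> jmeas h ->
  (forall u, 0 <= f u o) -> (forall u, 0 <= g u o) -> (forall u, 0 <= h u o) ->
  0 <= a -> 0 <= b ->
  {ae nu, forall u, f u o <= a * g u o + b * h u o} ->
  (\int[nu]_u (f u o)%:E <= a%:E * \int[nu]_u (g u o)%:E + b%:E * \int[nu]_u (h u o)%:E)%E.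
Proof.
move=> jf jg jh f0 g0 h0 a0 b0 fgh.
have mf := jmeas2 o jf; have mg := jmeas2 o jg; have mh := jmeas2 o jh.
rewrite -!ge0_integralZl ?lee_fin//; try exact/measurable_EFinP;
  try by move=> u _; rewrite lee_fin.
rewrite -ge0_integralD//.
- apply: ae_ge0_le_integral => //.
  + by move=> u _; rewrite lee_fin.
  + exact/measurable_EFinP.
  + by move=> u _; rewrite -!EFinM -EFinD lee_fin addr_ge0// mulr_ge0.
  + by apply: emeasurable_funD; apply: measurable_funeM; exact/measurable_EFinP.
  + by apply: filterS fgh => u fu _; rewrite -!EFinM -EFinD lee_fin.
- by move=> u _; rewrite -EFinM lee_fin mulr_ge0.
- by apply: measurable_funeM; exact/measurable_EFinP.
- by move=> u _; rewrite -EFinM lee_fin mulr_ge0.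
- by apply: measurable_funeM; exact/measurable_EFinP.
Qed.

End TimeIntegrals.

Section StoppedApproximation.
Context (R : realType) (d : measure_display) (Omega : measurableType d).
Variables (Pr : probability Omega R) (F : R -> set (set Omega)).
Hypothesis uF : usual_filtration Pr F.
Variables (t : R) (B : R -> Omega -> bool) (h : measurableTypeR R -> Omega -> R) (N : nat).
Hypothesis t0 : 0 <= t.

(** The event [B s] is that the stopping time has not occurred by time [s]. *)
Definition survival (s : measurableTypeR R) (o : Omega) : R := (B s o)%:R.
Local Notation chi := survival.

Hypothesis jchi : jmeas chi.
Hypothesis FB : forall s, 0 <= s <= t -> F s [set o | B s o].
Hypothesis Bmono : forall s s' o, 0 <= s -> s <= s' -> s' <= t -> B s' o -> B s o.
Hypothesis Bleft : forall s o, 0 < s -> s <= t -> ~~ B s o ->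
  exists2 s', 0 <= s' < s & ~~ B s' o.
Hypothesis jh : jmeas h.
Hypothesis chih : forall o, (\int[lebT t]_u (chi u o * h u o ^+ 2)%:E <= N%:R%:E)%E.
Hypothesis hfin : {ae Pr, forall o, (\int[lebT t]_u (h u o ^+ 2)%:E < +oo)%E}.

Variable Hk : nat -> simple_process F.
Hypothesis Hkh : cvp0 Pr (fun k o => \int[lebT t]_u ((sp_val (Hk k) u o - h u o) ^+ 2)%:E)%E.

Let chi_sq s o : chi s o ^+ 2 = chi s o.
Proof. by rewrite /survival; case: (B s o); rewrite ?expr1n ?expr0n. Qed.

(** Where it is 0, sampling [B] at the left end of a cell of length at most
    [1 / (k + 1)] makes no error at [u]. *)
Definition lag (k : nat) (u : measurableTypeR R) (o : Omega) : R :=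
  (B (Num.max 0 (u - k.+1%:R^-1)) o && ~~ B u o)%:R.

Lemma lag_measurable k : jmeas (lag k).
Proof.
have -> : lag k = (fun u o => chi (Num.max 0 (u - k.+1%:R^-1)) o * (1 - chi u o)).
  apply/funext => u; apply/funext => o; rewrite /lag /survival.
  by case: (B u o); case: (B _ o); rewrite ?(subrr, subr0, mulr0, mul0r, mulr1).
apply: measurable_funM; last by apply: measurable_funB => //; exact: jchi.
apply: (@measurableT_comp _ _ _ _ _ _ (fun z : measurableTypeR R * Omega => chi z.1 z.2) _
  (fun z : measurableTypeR R * Omega => (Num.max 0 (z.1 - k.+1%:R^-1), z.2))) => //.
apply: measurable_fun_pair => //.
by apply: measurable_maxr => //; apply: measurable_funB.
Qed.

Lemma lag_cvg u o : 0 <= u <= t -> (fun k => lag k u o) @ \oo --> (0 : R).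
Proof.
move=> /andP[u0 ut]; apply: cvg_near_cst.
have [Bu|Bu] := boolP (B u o).
  by apply: nearW => k; rewrite /lag Bu andbF.
have [u_gt0|u_le0] := ltP 0 u; last first.
  have uE : u = 0 by apply/eqP; rewrite eq_le u0 u_le0.
  apply: nearW => k; rewrite /lag (max_l (x := 0)) ?uE ?sub0r ?oppr_le0 ?invr_ge0//.
  by rewrite -uE (negbTE Bu).
have [s' /andP[s'0 s'u] Bs'] := Bleft u_gt0 ut Bu.
near=> k; rewrite /lag.
case: (boolP (B _ o)) => //= Bm; exfalso; move/negP: Bs'; apply.
apply: Bmono Bm => //.
  rewrite le_max; apply/orP; right; rewrite lerBrDr -lerBrDl.
  near: k; exists (Num.truncn (u - s')^-1) => // k /= hk.
  rewrite invf_ple ?posrE ?subr_gt0//; apply: ltW.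
  by apply: lt_le_trans (truncnS_gt _) _; rewrite ler_nat.
by rewrite ge_max t0/= (le_trans _ ut)// gerBl.
Unshelve. all: by end_near. Qed.

(** For every path and every [u], the lag is 0 for large [k] since the stopping is
    left continuous; dominated convergence applies because the paths of [h] are
    square integrable. *)
Lemma lag_negligible : cvp0 Pr (fun k o => \int[lebT t]_u (lag k u o * h u o ^+ 2)%:E)%E.
Proof.
have nn k : nnmeas (fun o => \int[lebT t]_u (lag k u o * h u o ^+ 2)%:E)%E.
  apply: nnmeas_timeint; first by apply: jmeasM; [exact: lag_measurable|exact: jmeas_sqr].
  by move=> u o; rewrite mulr_ge0 ?sqr_ge0// /lag ler0n.
apply: cvp0_ae => //; apply: filterS hfin => o ho.
have mh2 : measurable_fun setT (fun u => (h u o ^+ 2)%:E).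
  by apply/measurable_EFinP; exact: (jmeas2 o (jmeas_sqr jh)).
have [] := @dominated_convergence _ _ _ (lebT t) setT measurableT
  (fun k u => (lag k u o * h u o ^+ 2)%:E) (cst 0%E) (fun u => (h u o ^+ 2)%:E).
- move=> k; apply/measurable_EFinP.
  exact: (jmeas2 o (jmeasM (lag_measurable k) (jmeas_sqr jh))).
- exact: measurable_cst.
- apply: ae_lebT_imp => u ut _.
  rewrite -[X in _ --> X]/(0%:E) -(mul0r (h u o ^+ 2)).
  apply: cvg_EFin; first by apply: nearW.
  exact: (cvgM (lag_cvg _ ut) (cvg_cst (h u o ^+ 2))).
- apply: (@L1_ge0 _ _ _ _ (fun u => h u o ^+ 2)) => //; first exact: (jmeas2 o (jmeas_sqr jh)).
  by move=> u; exact: sqr_ge0.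
- apply: aeW => u k _; have h0 := sqr_ge0 (h u o).
  have l0 : 0 <= lag k u o by rewrite /lag ler0n.
  rewrite gee0_abs ?lee_fin; last exact: mulr_ge0.
  by rewrite ler_piMl// lern1 leq_b1.
by move=> _ _; rewrite integral0.
Qed.

(** The [k]-th approximation of [h], refined to a grid of mesh at most
    [1 / (k + 1)], is multiplied by the value of [chi] at the left end of each cell:
    this keeps it adapted, and the lag measures the error. *)
Lemma sampled_process k : exists (r : nat -> R) (L : nat) (c : nat -> Omega -> R),
  [/\ grid r, forall l, r l <= t, adapted_coef F r c &
    forall u o, 0 <= u <= t ->
    (stepV r L c u o - chi u o * h u o) ^+ 2 <=
      2 * (sp_val (Hk k) u o - h u o) ^+ 2 + 2 * (lag k u o * h u o ^+ 2)].
Proof.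
pose pts := [seq Num.min (sp_time (Hk k) l) t | l <- iota 0 (sp_size (Hk k)).+1].
have ptsP x : x \in pts -> 0 <= x <= t.
  by move=> /mapP[l _ ->]; rewrite le_min ge_min lexx t0 orbT sp_time_nonneg.
have h0 : 0 < k.+1%:R^-1 :> R by rewrite invr_gt0.
have [r [L [[gr rt r0 mesh] [ptsr _]]]] := common_grid t0 h0 ptsP.
have rH : refines (Hk k) r L t.
  move=> l ll; have [|p [pL pE]] := ptsr (Num.min (sp_time (Hk k) l) t); last by exists p.
  by apply/mapP; exists l => //; rewrite mem_iota add0n ltnS.
have aH := refc_adapted uF (Hk k) gr.
have rl0 l : 0 <= r l by exact: grid_ge0.
pose c l o := refc (Hk k) r l o * chi (r l) o.
have ac : adapted_coef F r c.
  apply: (adapted_coefM uF gr aH) => l; split.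
    have -> : chi (r l) = \1_[set o | B (r l) o].
      by apply/funext => o; rewrite /survival indicE mem_setE.
    apply: meas_wrt_indic; first exact: (filtration_sigma uF).
    by apply: FB; rewrite rl0 rt.
  by exists 1 => o; rewrite /survival normr_nat lern1 leq_b1.
exists r, L, c; split => // u o /andP[u0 ut].
have HE : sp_val (Hk k) u o = stepV r L (refc (Hk k) r) u o by rewrite (refc_val o gr rt rH ut).
set lg := lag k u o; set hu := h u o.
have lg0 : 0 <= lg * hu ^+ 2 by rewrite mulr_ge0 ?sqr_ge0// /lg /lag ler0n.
have chib : chi u o = 0 \/ chi u o = 1 by rewrite /survival; case: (B u o); [right|left].
have [[l /andP[ul1 ul2]]|nocell] := pselect (exists l : 'I_L, r l < u <= r l.+1); last first.
  have V0 c0 : stepV r L c0 u o = 0.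
    apply: big1 => l _; rewrite indicE memNset ?mulr0//= in_itv/=.
    by move=> ul; apply: nocell; exists l.
  rewrite HE !V0 !sub0r !sqrrN; apply: (@le_trans _ _ (2 * hu ^+ 2)).
    have := sqr_ge0 hu; case: chib => ->; rewrite ?mul0r ?mul1r ?expr0n/=; lra.
  by rewrite lerDl mulr_ge0.
have Vl c0 : stepV r L c0 u o = c0 l o.
  rewrite /stepV (bigD1 l)//= big1 ?addr0.
    by rewrite indicE mem_set ?mulr1//= in_itv/= ul1 ul2.
  move=> l' l'l; rewrite indicE memNset ?mulr0//= in_itv/= => /andP[h3 h4].
  by move: l'l; rewrite -val_eqE/= (cell_unique gr ul1 ul2 h3 h4) eqxx.
rewrite HE !Vl /c; set a := refc _ _ _ _.
have [Bu|Bu] := boolP (B u o).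
  have -> : chi (r l) o = 1.
    by rewrite /survival (Bmono (s := r l) (s' := u))// ltW.
  rewrite /survival Bu mulr1 mul1r; have := sqr_ge0 (a - hu); lra.
rewrite {2}/survival (negbTE Bu) mul0r subr0.
have [Br|Br] := boolP (B (r l) o); last first.
  rewrite /survival (negbTE Br) mulr0 expr0n/=.
  by rewrite addr_ge0// mulr_ge0// sqr_ge0.
(* The stopping occurs between the left end of the cell and u: the sampled value
   has survived, and the lag pays for it. *)
have -> : lg = 1.
  rewrite /lg /lag Bu andbT (Bmono (s := Num.max 0 (u - k.+1%:R^-1)) (s' := r l))//.
    by rewrite le_max lexx.
  by rewrite ge_max rl0/= lerBlDr (le_trans ul2).
rewrite /survival Br mulr1 mul1r.
have := sqr_ge0 (a - 2 * hu); rewrite !sqrrB; lra.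
Qed.

Definition spcost (H : simple_process F) (o : Omega) : \bar R :=
  (\int[lebT t]_u ((sp_val H u o - chi u o * h u o) ^+ 2)%:E)%E.

(** The sampled processes converge in probability only. Cutting them when their
    energy reaches [N + 1] makes them bounded in energy, so that the convergence
    becomes convergence in mean; the cut is active with vanishing probability, the
    energy of [chi h] being at most [N]. *)
Lemma stopped_approximation : exists H : nat -> simple_process F,
  (forall k o, (\int[lebT t]_u (sp_val (H k) u o ^+ 2)%:E <= N.+1%:R%:E)%E) /\
  (fun k => \int[Pr]_o spcost (H k) o)%E @ \oo --> 0%E.
Proof.
pose eta : R := N.+1%:R.
have eta0 : 0 <= eta by rewrite ler0n.
have jch : jmeas (fun u o => chi u o * h u o) by exact: jmeasM.
pose ch2 o := (\int[lebT t]_u ((chi u o * h u o) ^+ 2)%:E)%E.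
have ch2N o : (ch2 o <= N%:R%:E)%E.
  by rewrite /ch2; under eq_integral do rewrite exprMn chi_sq; exact: chih.
have step k : exists H : simple_process F,
    (forall o, (\int[lebT t]_u (sp_val H u o ^+ 2)%:E <= eta%:E)%E) /\
    exists2 V : R -> Omega -> R, jmeas (V : measurableTypeR R -> Omega -> R) &
    (forall o, (\int[lebT t]_u (V u o ^+ 2)%:E <= eta%:E)%E ->
       forall u, V u o = sp_val H u o) /\
    forall u o, 0 <= u <= t ->
    (V u o - chi u o * h u o) ^+ 2 <=
      2 * (sp_val (Hk k) u o - h u o) ^+ 2 + 2 * (lag k u o * h u o ^+ 2).
  have [r [L [c [gr rt ac Vle]]]] := sampled_process k.
  have clipE l : clipg r t l = r l by rewrite /clipg min_l.
  have dE : dgrid (clipg r t) = dgrid r by apply/funext => l; rewrite /dgrid !clipE.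
  have dr0 l := dgrid_ge0 l gr.
  pose c' := cutcoef (dgrid r) eta c.
  have ac' : adapted_coef F r c' by exact: (cutcoef_adapted uF).
  pose H := @SimpleProcess _ _ _ F L r c' gr.1 gr.2 (fun l => (ac' l).1) (fun l => (ac' l).2).
  have stepE c0 o : adapted_coef F r c0 ->
      (\int[lebT t]_u (stepV r L c0 u o ^+ 2)%:E = (runsq (dgrid r) c0 L o)%:E)%E.
    move=> ac0; have mV := jmeas2 o (stepV_measurable uF L gr ac0).
    have mS : measurable_fun setT (fun u => (stepV r L c0 u o ^+ 2)%:E : \bar R).
      by apply/measurable_EFinP; exact: measurable_funX.
    have LS : L1 (lebT t) (fun u => stepV r L c0 u o ^+ 2).
      have [C HC] := choice (fun l => (ac0 l).2).
      apply: (@L1_bounded _ _ _ _ _ ((\sum_(l < L) C l) ^+ 2)).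
        exact: measurable_funX.
      move=> u; rewrite normrX lerXn2r ?nnegrE//.
        by apply: sumr_ge0 => l _; apply: le_trans (HC l o).
      apply: le_trans (ler_norm_sum _ _ _) _; apply: ler_sum => l _.
      by rewrite normrM; apply: le_trans (HC l o); rewrite ler_piMr// indicE normr_nat lern1 leq_b1.
    rewrite -L1E//; congr (_%:E).
    under eq_Rintegral do rewrite expr2.
    by rewrite stepV_integral// dE; apply: eq_bigr => l _; rewrite expr2.
  exists H; split.
    move=> o; rewrite [X in (X <= _)%E](stepE c' o ac') lee_fin.
    exact: runsq_cut_le.
  exists (stepV r L c); first exact: (stepV_measurable uF).
  split => // o; rewrite stepE// lee_fin => le u.
  apply: eq_bigr => l _; congr (_ * _).
  exact: (esym (cutcoefE dr0 (ltn_ord l) le)).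
have [H HP] := choice step.
exists H; split; first by move=> k; exact: (HP k).1.
pose Wk k o : \bar R := (2%:E * (\int[lebT t]_u ((sp_val (Hk k) u o - h u o) ^+ 2)%:E) +
  2%:E * (\int[lebT t]_u (lag k u o * h u o ^+ 2)%:E))%E.
have jHk k : jmeas (fun u o => (sp_val (Hk k) u o - h u o) ^+ 2).
  exact: (jmeas_sqr (jmeasB (sp_val_measurable uF (Hk k)) jh)).
have jlag k : jmeas (fun u o => lag k u o * h u o ^+ 2).
  exact: (jmeasM (lag_measurable k) (jmeas_sqr jh)).
have lag0 k u o : 0 <= lag k u o * h u o ^+ 2.
  by rewrite mulr_ge0 ?sqr_ge0// /lag ler0n.
have n1 k := nnmeas_timeint (lebT t) (jHk k) (fun u o => sqr_ge0 _).
have n2 k := nnmeas_timeint (lebT t) (jlag k) (lag0 k).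
have nscale (Z : Omega -> \bar R) : nnmeas Z -> nnmeas (fun o => 2%:E * Z o)%E.
  move=> [mZ Z0]; split; first exact: measurable_funeM.
  by move=> o; rewrite mule_ge0.
have nW k : nnmeas (Wk k).
  have [m1 p1] := nscale _ (n1 k); have [m2 p2] := nscale _ (n2 k).
  by split; [exact: emeasurable_funD|move=> o; rewrite adde_ge0].
have cW : cvp0 Pr Wk.
  apply: cvp0_add.
  - by move=> k; exact: nscale.
  - by move=> k; exact: nscale.
  - by apply: (cvp0_scale _ n1) => //; rewrite ler1n.
  - by apply: (cvp0_scale _ n2 lag_negligible); rewrite ler1n.
have jcost k : jmeas (fun u o => (sp_val (H k) u o - chi u o * h u o) ^+ 2).
  exact: (jmeas_sqr (jmeasB (sp_val_measurable uF (H k)) jch)).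
have nC k : nnmeas (spcost (H k)).
  exact: (nnmeas_timeint (lebT t) (jcost k) (fun u o => sqr_ge0 _)).
pose b : R := 2 * eta + 2 * N%:R.
have b0 : 0 <= b by rewrite addr_ge0// mulr_ge0.
have Cb k o : (spcost (H k) o <= b%:E)%E.
  apply: (@le_trans _ _ (2%:E * (\int[lebT t]_u (sp_val (H k) u o ^+ 2)%:E) + 2%:E * ch2 o)%E).
    apply: (@timeintD_le _ _ _ _ (fun u o => (sp_val (H k) u o - chi u o * h u o) ^+ 2)
      (fun u o => sp_val (H k) u o ^+ 2)
      (fun u o => (chi u o * h u o) ^+ 2) 2 2 o) => //; try (by move=> u; exact: sqr_ge0).
    - exact: (jcost k).
    - exact: (jmeas_sqr (sp_val_measurable uF (H k))).
    - exact: (jmeas_sqr jch).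
    - apply: aeW => u; have := sqr_ge0 (sp_val (H k) u o + chi u o * h u o).
      by rewrite sqrrB sqrrD; lra.
  have -> : (b%:E = 2%:E * eta%:E + 2%:E * N%:R%:E)%E by [].
  by apply: leeD; apply: lee_wpmul2l => //; exact: (HP k).1.
(* With the weight a in Young's inequality, an energy of the sampled process above
   N + 1 forces the error Wk above e0, as the energy of chi h is at most N; where
   this happens, the cost is at most b, hence at most b / e0 times Wk. *)
pose a : R := (2 * eta)^-1.
have eta1 : 1 <= eta by rewrite ler1n.
have a_gt0 : 0 < a by rewrite invr_gt0; lra.
have aeta : 2 * (a * eta) = 1 by rewrite /a invfM; field; rewrite gt_eqF//; lra.
pose e0 : R := (2 * (1 + a^-1))^-1.
have e0_gt0 : 0 < e0 by rewrite invr_gt0 mulr_gt0// addr_gt0// invr_gt0.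
pose D : R := 1 + b / e0.
have D1 : 1 <= D by rewrite lerDl divr_ge0// ltW.
have CW k o : (spcost (H k) o <= D%:E * Wk k o)%E.
  have [_ [V jV [VH VW]]] := HP k.
  have W0 := (nW k).2 o.
  have VWk : (\int[lebT t]_u ((V u o - chi u o * h u o) ^+ 2)%:E <= Wk k o)%E.
    apply: (@timeintD_le _ _ _ _ (fun u o => (V u o - chi u o * h u o) ^+ 2)
      (fun u o => (sp_val (Hk k) u o - h u o) ^+ 2)
      (fun u o => lag k u o * h u o ^+ 2) 2 2 o) => //; try (by move=> u; exact: sqr_ge0).
    - exact: (jmeas_sqr (jmeasB jV jch)).
    - exact: (jHk k).
    - exact: (ae_lebT_imp (fun u ut => VW u o ut)).
  have [le|gt] := leP (\int[lebT t]_u (V u o ^+ 2)%:E)%E eta%:E.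
    rewrite /spcost; under eq_integral do rewrite -(VH o le).
    by apply: le_trans VWk _; rewrite -[leLHS]mul1e lee_wpmul2r// lee_fin.
  have e0W : (e0%:E <= Wk k o)%E.
    rewrite leNgt; apply/negP => We0; move: gt; rewrite ltNge => /negP; apply.
    apply: (@le_trans _ _ ((1 + a)%:E * ch2 o + (1 + a^-1)%:E * Wk k o)%E).
      apply: (@le_trans _ _ ((1 + a)%:E * ch2 o + (1 + a^-1)%:E *
          (\int[lebT t]_u ((V u o - chi u o * h u o) ^+ 2)%:E))%E).
        apply: (@timeintD_le _ _ _ _ (fun u o => V u o ^+ 2)
      (fun u o => (chi u o * h u o) ^+ 2)
      (fun u o => (V u o - chi u o * h u o) ^+ 2) (1 + a) (1 + a^-1) o) => //; try (by move=> u; exact: sqr_ge0).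
        - exact: (jmeas_sqr jV).
        - exact: (jmeas_sqr jch).
        - exact: (jmeas_sqr (jmeasB jV jch)).
        - by rewrite addr_ge0// ltW.
        - by rewrite addr_ge0// invr_ge0 ltW.
        - apply: aeW => u; set x := V u o; set y := chi u o * h u o.
          have -> : (1 + a) * y ^+ 2 + (1 + a^-1) * (x - y) ^+ 2 =
              x ^+ 2 + (a * y - (x - y)) ^+ 2 / a by field; rewrite gt_eqF.
          by rewrite lerDl divr_ge0 ?sqr_ge0// ltW.
      by rewrite leeD2l// lee_wpmul2l// lee_fin addr_ge0// invr_ge0 ltW.
    apply: (@le_trans _ _ ((1 + a)%:E * N%:R%:E + (1 + a^-1)%:E * e0%:E)%E).
      apply: leeD; apply: lee_wpmul2l.
      - by rewrite lee_fin addr_ge0// ltW.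
      - exact: ch2N.
      - by rewrite lee_fin addr_ge0// invr_ge0 ltW.
      - exact: ltW.
    rewrite -!EFinM -EFinD lee_fin.
    have -> : (1 + a^-1) * e0 = 2^-1.
      rewrite /e0 invfM mulrCA mulfV ?mulr1// gt_eqF// addr_gt0// invr_gt0//.
    have : eta = N%:R + 1 by rewrite /eta -natr1.
    have : 0 <= N%:R :> R by rewrite ler0n.
    nra.
  apply: le_trans (Cb k o) _.
  apply: (@le_trans _ _ (D%:E * e0%:E)%E); last by rewrite lee_wpmul2l// lee_fin (le_trans ler01).
  rewrite -EFinM lee_fin /D mulrDl mul1r divfK ?gt_eqF// lerDr ltW//.
have cC : cvp0 Pr (fun k => spcost (H k)).
  apply: (@cvp0_le _ _ _ _ _ (fun k o => D%:E * Wk k o)%E) => //.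
  - move=> k; split; first exact: measurable_funeM (nW k).1.
    by move=> o; rewrite mule_ge0 ?(nW k).2// lee_fin (le_trans ler01).
  - by move=> k; apply: aeW => o; exact: CW.
  - exact: cvp0_scale.
apply: (@cvg0_le _ _ (fun k => (1 + b)%:E * pmet Pr (spcost (H k)))%E).
- by move=> k; apply: integral_ge0 => o _; exact: (nC k).2.
- move=> k; apply: pmet_bounded => //; first by rewrite lerDl.
  by apply: aeW => o; apply: le_trans (Cb k o) _; rewrite lee_fin lerDr.
- exact: cvg0_scale.
Qed.

End StoppedApproximation.

(** * Convergence of the stopped stochastic integrals *)
Section StoppedIntegral.
Context (R : realType) (d : measure_display) (Omega : measurableType d).
Variables (Pr : probability Omega R) (F : R -> set (set Omega)).
Variables (q : nat) (K : 'M[R]_q) (w : R -> Omega -> 'cV[R]_q).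
Hypothesis uF : usual_filtration Pr F.
Hypothesis W : wiener_process Pr F K w.

Lemma cvp0_sqr (Y : nat -> Omega -> R) : (forall k, measurable_fun setT (Y k)) ->
  cvp0 Pr (fun k o => (`|Y k o|)%:E) -> cvp0 Pr (fun k o => (Y k o ^+ 2)%:E).
Proof.
move=> mY; apply: cvg0_le => k.
  by apply: pmet_ge0 => o; rewrite lee_fin sqr_ge0.
apply: ge0_le_integral => //.
- by move=> o _; rewrite le_min lee_fin sqr_ge0/=.
- by apply: measurable_mine => //; apply/measurable_EFinP; exact: measurable_funX.
- by apply: measurable_mine => //; apply/measurable_EFinP; exact: measurableT_comp.
- move=> o _; rewrite -!EFin_min lee_fin.
  have [y1|/ltW y1] := leP 1 `|Y k o|; first by rewrite ge_min lexx orbT.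
  rewrite ge_min -real_normK ?num_real//; apply/orP; left.
  by rewrite expr2 ler_piMr.
Qed.

Lemma pmet_le_mean (Z : Omega -> \bar R) : nnmeas Z -> (pmet Pr Z <= \int[Pr]_o Z o)%E.
Proof.
move=> nZ; have [mZ Z0] := nnmeas_mine nZ.
apply: ge0_le_integral => //; first exact: nZ.1.
by move=> o _; rewrite ge_min lexx.
Qed.

Lemma lebT_mono (s t : R) (f : R -> R) : s <= t -> measurable_fun setT f ->
  (forall u, 0 <= f u) ->
  (\int[lebT s]_u (f u)%:E <= \int[lebT t]_u (f u)%:E)%E.
Proof.
move=> st mf f0; have mE : measurable_fun setT (fun u => (f u)%:E) by exact/measurable_EFinP.
rewrite !ge0_lebT_integral//; try by move=> u; rewrite lee_fin.
apply: ge0_subset_integral => //.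
- exact: measurable_funTS.
- by move=> u _; rewrite lee_fin.
- by move=> u /=; rewrite !in_itv/= => /andP[-> /le_trans]; apply.
Qed.

Variables (t : R) (B : R -> Omega -> bool) (h : measurableTypeR R -> Omega -> R).
Local Notation chi := (survival B).
Hypothesis jchi : jmeas chi.
Hypothesis FB : forall s, 0 <= s <= t -> F s [set o | B s o].
Hypothesis Bmono : forall s s' o, 0 <= s -> s <= s' -> s' <= t -> B s' o -> B s o.
Hypothesis jh : jmeas h.

(** On the event that the stopping has not occurred by time [s], the stopped and the
    original integrand agree on [0, s], where [H] and [G] are thus close in
    mean square; the Lenglart bound transfers this to their integrals. *)
Lemma stopped_integral_cvg (s : R) (j : 'I_q) (H G : nat -> simple_process F)
    (J : Omega -> R) : 0 <= s <= t -> measurable_fun setT J ->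
  (fun k => \int[Pr]_o spcost t B h (H k) o)%E @ \oo --> 0%E ->
  cvp0 Pr (fun k o => \int[lebT s]_u ((sp_val (G k) u o - h u o) ^+ 2)%:E)%E ->
  cvp0 Pr (fun k o => (`|spI w j (G k) s o - J o|)%:E) ->
  cvp0 Pr (fun k o => (chi s o * (spI w j (H k) s o - J o) ^+ 2)%:E).
Proof.
move=> /andP[s0 st] mJ cH cG cJ.
set A := [set o | B s o].
have mA : measurable A by apply: (filtration_sub uF s0); apply: FB; rewrite s0.
have chiA o : chi s o = \1_A o by rewrite /survival indicE mem_setE.
have m1 : measurable_fun setT (\1_A : Omega -> R) by exact: measurable_indic.
have mH k := spI_measurable uF W j (H k) s0.
have mG k := spI_measurable uF W j (G k) s0.
have jch : jmeas (fun u o => chi u o * h u o) by exact: jmeasM.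
have jH k : jmeas (fun u o => (sp_val (H k) u o - chi u o * h u o) ^+ 2).
  exact: (jmeas_sqr (jmeasB (sp_val_measurable uF (H k)) jch)).
have jG k : jmeas (fun u o => (sp_val (G k) u o - h u o) ^+ 2).
  exact: (jmeas_sqr (jmeasB (sp_val_measurable uF (G k)) jh)).
have jHG k : jmeas (fun u o => (sp_val (H k) u o - sp_val (G k) u o) ^+ 2).
  exact: (jmeas_sqr (jmeasB (sp_val_measurable uF (H k)) (sp_val_measurable uF (G k)))).
have nH k := nnmeas_timeint (lebT t) (jH k) (fun u o => sqr_ge0 _).
have nG k := nnmeas_timeint (lebT s) (jG k) (fun u o => sqr_ge0 _).
have nscale (Z : Omega -> \bar R) : nnmeas Z -> nnmeas (fun o => 2%:E * Z o)%E.
  move=> [mZ Z0]; split; first exact: measurable_funeM.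
  by move=> o; rewrite mule_ge0.
pose D k o := \int[lebT s]_u ((sp_val (H k) u o - sp_val (G k) u o) ^+ 2).
have LHG k o : L1 (lebT s) (fun u => (sp_val (H k) u o - sp_val (G k) u o) ^+ 2).
  have [C HC] := sp_val_bounded (H k); have [C' HC'] := sp_val_bounded (G k).
  apply: (@L1_bounded _ _ _ _ _ ((C + C') ^+ 2)).
    exact: (jmeas2 o (jHG k)).
  move=> u; rewrite normrX lerXn2r ?nnegrE//.
    by rewrite addr_ge0// (le_trans _ (HC 0 o), le_trans _ (HC' 0 o)).
  by apply: le_trans (ler_normB _ _) _; exact: lerD.
have D0 k o : 0 <= D k o by apply: Rintegral_ge0 => u _; exact: sqr_ge0.
have mD k : measurable_fun setT (D k).
  apply/measurable_EFinP; rewrite (_ : EFin \o D k =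
    (fun o => \int[lebT s]_u ((sp_val (H k) u o - sp_val (G k) u o) ^+ 2)%:E)%E).
    exact: (nnmeas_timeint (lebT s) (jHG k) (fun u o => sqr_ge0 _)).1.
  by apply/funext => o /=; rewrite L1E.
have cD : cvp0 Pr (fun k o => (\1_A o * D k o)%:E).
  apply: (@cvp0_le _ _ _ _ _ (fun k o =>
    2%:E * (\int[lebT t]_u ((sp_val (H k) u o - chi u o * h u o) ^+ 2)%:E) +
    2%:E * (\int[lebT s]_u ((sp_val (G k) u o - h u o) ^+ 2)%:E))%E).
  - move=> k; split; first by apply/measurable_EFinP; exact: measurable_funM.
    by move=> o; rewrite lee_fin mulr_ge0.
  - move=> k; have [m3 p3] := nscale _ (nH k); have [m4 p4] := nscale _ (nG k).
    by split; [exact: emeasurable_funD|move=> o; rewrite adde_ge0].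
  - move=> k; apply: aeW => o; rewrite indicE.
    have [oA|oA] := boolP (o \in A); last first.
      by rewrite mul0r adde_ge0 ?(nscale _ (nH k)).2 ?(nscale _ (nG k)).2.
    rewrite mul1r /D L1E//.
    apply: (@le_trans _ _ (2%:E * (\int[lebT s]_u ((sp_val (H k) u o - chi u o * h u o) ^+ 2)%:E) +
      2%:E * (\int[lebT s]_u ((sp_val (G k) u o - h u o) ^+ 2)%:E))%E).
      apply: (@timeintD_le _ _ _ _ (fun u o => (sp_val (H k) u o - sp_val (G k) u o) ^+ 2)
        (fun u o => (sp_val (H k) u o - chi u o * h u o) ^+ 2)
        (fun u o => (sp_val (G k) u o - h u o) ^+ 2) 2 2 o (jHG k) (jH k) (jG k)) => //;
        try (by move=> u; exact: sqr_ge0).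
      apply: ae_lebT_imp => u /andP[u0 us].
      have -> : chi u o = 1.
        rewrite /survival (Bmono (s := u) (s' := s))//.
        by move: oA; rewrite inE.
      set x := sp_val (H k) u o; set y := sp_val (G k) u o; set z := h u o.
      rewrite mul1r; have := sqr_ge0 ((x - z) + (y - z)).
      have -> : (x - y) ^+ 2 = 2 * (x - z) ^+ 2 + 2 * (y - z) ^+ 2 - ((x - z) + (y - z)) ^+ 2.
        by ring.
      lra.
    rewrite leeD2r// lee_wpmul2l//; apply: lebT_mono => //.
      exact: (jmeas2 o (jH k)).
    by move=> u; exact: sqr_ge0.
  - apply: cvp0_add.
    + by move=> k; exact: nscale.
    + by move=> k; exact: nscale.
    + apply: (cvp0_scale _ nH); first by rewrite ler1n.
      apply: cvg0_le cH => k; first by apply: pmet_ge0 => o; exact: (nH k).2.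
      exact: pmet_le_mean (nH k).
    + by apply: (cvp0_scale _ nG) => //; rewrite ler1n.
have cHG : cvp0 Pr (fun k o => (\1_A o * (spI w j (H k) s o - spI w j (G k) s o) ^+ 2)%:E).
  apply: squeeze_eps cD _.
  - by move=> k; apply: pmet_ge0 => o; rewrite lee_fin mulr_ge0// sqr_ge0.
  - by move=> k; apply: pmet_ge0 => o; rewrite lee_fin mulr_ge0.
  - move=> e e0; have K0 := K_diag_ge0 uF W j.
    pose eta := Num.min 1 (e / (K j j + 1)).
    have K1 : 0 < K j j + 1 by rewrite ltr_wpDl.
    have eta0 : 0 < eta by rewrite lt_min ltr01 divr_gt0.
    have eta1 : eta <= 1 by rewrite ge_min lexx.
    exists eta^-1; first by rewrite invr_ge0 ltW.
    move=> k; apply: le_trans (sp_lenglart uF W (H k) (G k) j s0 mA eta0 eta1) _.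
    rewrite leeD2r// lee_fin; apply: (@le_trans _ _ (K j j * (e / (K j j + 1)))).
      by rewrite ler_wpM2l// ge_min lexx orbT.
    by rewrite mulrA ler_pdivrMr// mulrC ler_wpM2l ?(ltW e0)// lerDl.
have nHG k : nnmeas (fun o => (\1_A o * (spI w j (H k) s o - spI w j (G k) s o) ^+ 2)%:E).
  split; last by move=> o; rewrite lee_fin mulr_ge0// sqr_ge0.
  apply/measurable_EFinP; apply: measurable_funM => //.
  exact/measurable_funX/measurable_funB.
have nGJ k : nnmeas (fun o => ((spI w j (G k) s o - J o) ^+ 2)%:E).
  split; last by move=> o; rewrite lee_fin sqr_ge0.
  apply/measurable_EFinP; exact/measurable_funX/measurable_funB.
apply: (@cvp0_le _ _ _ _ _ (fun k o =>
    2%:E * (\1_A o * (spI w j (H k) s o - spI w j (G k) s o) ^+ 2)%:E +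
    2%:E * ((spI w j (G k) s o - J o) ^+ 2)%:E)%E).
- move=> k; split; last by move=> o; rewrite lee_fin chiA mulr_ge0// sqr_ge0.
  apply/measurable_EFinP; apply: measurable_funM; first exact: (jmeas1 s jchi).
  exact/measurable_funX/measurable_funB.
- move=> k; have [m3 p3] := nscale _ (nHG k); have [m4 p4] := nscale _ (nGJ k).
  by split; [exact: emeasurable_funD|move=> o; rewrite adde_ge0].
- move=> k; apply: aeW => o; rewrite chiA -!EFinM -EFinD lee_fin.
  set x := spI w j (H k) s o; set y := spI w j (G k) s o; set z := J o.
  rewrite indicE; case: (o \in A); last by rewrite !mul0r mulr0 add0r mulr_ge0// sqr_ge0.
  rewrite !mul1r; have := sqr_ge0 ((x - y) - (y - z)).
  have -> : (x - z) ^+ 2 = 2 * (x - y) ^+ 2 + 2 * (y - z) ^+ 2 - ((x - y) - (y - z)) ^+ 2.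
    by ring.
  lra.
- apply: cvp0_add.
  + by move=> k; exact: nscale.
  + by move=> k; exact: nscale.
  + by apply: (cvp0_scale _ nHG) => //; rewrite ler1n.
  + apply: (cvp0_scale _ nGJ); first by rewrite ler1n.
    by apply: cvp0_sqr => // k; exact: measurable_funB.
Qed.

End StoppedIntegral.

(** * Running integrals and quadratic forms *)
Section RunningIntegral.
Context (R : realType).
Local Notation mu := (@lebesgue_measure R).

(** The running integral stays an integral against the fixed measure [lebT t], so
    that it is jointly measurable in all its arguments. *)
Definition runint (t : R) (a : R -> R) (s : R) : R :=
  \int[lebT t]_u ((u <= s)%R%:R * a u).

Lemma measurable_le_cst (s : R) :
  measurable_fun setT (fun u : measurableTypeR R => (u <= s)%R%:R : R).
Proof.
rewrite (_ : (fun _ => _) = \1_(`]-oo, s]%classic)).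
  by apply: measurable_indic; exact: measurable_itv.
by apply/funext => u; rewrite indicE mem_setE in_itv.
Qed.

Lemma measurable_lt_cst (s : R) :
  measurable_fun setT (fun u : measurableTypeR R => (u < s)%R%:R : R).
Proof.
rewrite (_ : (fun _ => _) = \1_(`]-oo, s[%classic)).
  by apply: measurable_indic; exact: measurable_itv.
by apply/funext => u; rewrite indicE mem_setE in_itv.
Qed.

Lemma measurable_bool_natr d' (T : measurableType d') (f : T -> bool) :
  measurable_fun setT f -> measurable_fun setT (fun x => (f x)%:R : R).
Proof.
move=> mf; rewrite (_ : (fun _ => _) = (fun x => if f x then 1 else 0 : R)).
  exact: measurable_fun_ifT.
by apply/funext => x; case: (f x).
Qed.

Lemma measurable_le2 : measurable_fun setT
  (fun z : measurableTypeR R * measurableTypeR R => (z.1 <= z.2)%R%:R : R).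
Proof.
have mle : measurable_fun setT (fun z : measurableTypeR R * measurableTypeR R => z.1 <= z.2).
  by apply: measurable_fun_ler; [exact: measurable_fst|exact: measurable_snd].
exact: measurable_bool_natr.
Qed.

Lemma bool_mul_norm (b : bool) (x : R) : `|b%:R * x| <= `|x|.
Proof. by rewrite normrM normr_nat ler_piMl// lern1 leq_b1. Qed.

Lemma lebT_set1 (t s : R) : lebT t [set s] = 0%E.
Proof.
apply/eqP; rewrite eq_le measure_ge0 andbT.
have <- : mu [set s] = 0%E by exact: lebesgue_measure_set1.
rewrite [leLHS](_ : _ = mu ([set s] `&` `[0, t])); last by [].
apply: le_measure; rewrite ?inE//.
by apply: measurableI => //; exact: measurable_itv.
Qed.

Lemma runint_lt (t s : R) (a : R -> R) : measurable_fun setT a ->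
  \int[lebT t]_u ((u < s)%R%:R * a u) = runint t a s.
Proof.
move=> ma; apply: Rint_ae.
- by apply: measurable_funM => //; exact: measurable_lt_cst.
- by apply: measurable_funM => //; exact: measurable_le_cst.
- exists [set s]; split => //; first exact: lebT_set1.
  move=> u /= h; apply: contrapT => us; apply: h.
  by rewrite lt_neqAle (_ : u != s)//; apply/eqP.
Qed.

(** The product of two integrals is an integral over the square, which splits
    along the diagonal. *)
Lemma runint_by_parts (t C : R) (a b : R -> R) : measurable_fun setT a ->
  measurable_fun setT b -> (forall u, `|a u| <= C) -> (forall u, `|b u| <= C) ->
  (\int[lebT t]_u a u) * (\int[lebT t]_u b u) =
  \int[lebT t]_s (runint t a s * b s + runint t b s * a s).
Proof.
move=> ma mb aC bC; have C0 : 0 <= C by apply: le_trans (aC 0).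
have La : L1 (lebT t) a by apply: (@L1_bounded _ _ _ _ _ C).
have Lb : L1 (lebT t) b by apply: (@L1_bounded _ _ _ _ _ C).
have mle := measurable_le2.
pose p (s u : measurableTypeR R) := (u <= s)%R%:R * a u * b s.
pose p' (s u : measurableTypeR R) := (s < u)%R%:R * a u * b s.
have mlesu : measurable_fun setT
    (fun z : measurableTypeR R * measurableTypeR R => (z.2 <= z.1)%R%:R : R).
  apply: (@measurableT_comp _ _ _ _ _ _
    (fun z : measurableTypeR R * measurableTypeR R => (z.1 <= z.2)%R%:R : R) _
    (fun z : measurableTypeR R * measurableTypeR R => (z.2, z.1))) => //.
  exact: measurable_fun_pair.
have ma2 : measurable_fun setT (fun z : measurableTypeR R * measurableTypeR R => a z.2).
  by apply: measurableT_comp ma _; exact: measurable_snd.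
have mb1 : measurable_fun setT (fun z : measurableTypeR R * measurableTypeR R => b z.1).
  by apply: measurableT_comp mb _; exact: measurable_fst.
have jp : jmeas p by apply: measurable_funM => //; exact: measurable_funM.
have jp' : jmeas p'.
  rewrite /jmeas (_ : (fun _ => _) = (fun z : measurableTypeR R * measurableTypeR R =>
    a z.2 * b z.1 - p z.1 z.2)).
    by apply: measurable_funB => //; exact: measurable_funM.
  by apply/funext => z; rewrite /p /p' ltNge; case: (_ <= _) => /=; ring.
have bnd (c : bool) u s : `|c%:R * a u * b s| <= C * C.
  rewrite -mulrA; apply: le_trans (bool_mul_norm _ _) _.
  by rewrite normrM ler_pM.
have Lp : L1prod (lebT t) (lebT t) p.
  by apply: (@L1prod_bounded _ _ _ _ _ _ _ _ (C * C)) => // s u; exact: bnd.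
have Lp' : L1prod (lebT t) (lebT t) p'.
  by apply: (@L1prod_bounded _ _ _ _ _ _ _ _ (C * C)) => // s u; exact: bnd.
have Lle (f : R -> R) s : measurable_fun setT f -> (forall u, `|f u| <= C) ->
    L1 (lebT t) (fun u => (u <= s)%R%:R * f u).
  move=> mf fC; apply: (@L1_bounded _ _ _ _ _ C).
    by apply: measurable_funM => //; exact: measurable_le_cst.
  by move=> u; exact: le_trans (bool_mul_norm _ _) (fC u).
have Llt (f : R -> R) s : measurable_fun setT f -> (forall u, `|f u| <= C) ->
    L1 (lebT t) (fun u => (u < s)%R%:R * f u).
  move=> mf fC; apply: (@L1_bounded _ _ _ _ _ C).
    by apply: measurable_funM => //; exact: measurable_lt_cst.
  by move=> u; exact: le_trans (bool_mul_norm _ _) (fC u).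
have Lgt s : L1 (lebT t) (fun u => (s < u)%R%:R * a u).
  have -> : (fun u => (s < u)%R%:R * a u) = (fun u => a u - (u <= s)%R%:R * a u).
    by apply/funext => u; rewrite ltNge; case: (_ <= _) => /=; ring.
  by apply: L1B => //; exact: Lle.
have E1 s : runint t a s * b s = \int[lebT t]_u p s u.
  by rewrite /p RintegralZr//; exact: Lle.
have E2 s : runint t b s * a s = \int[lebT t]_u p' u s.
  rewrite /p' -runint_lt// -RintegralZr//; last exact: Llt.
  by apply: eq_Rintegral => u _; ring.
have -> : \int[lebT t]_s (runint t a s * b s + runint t b s * a s) =
    \int[lebT t]_s (\int[lebT t]_u p s u + \int[lebT t]_u p' u s).
  by apply: eq_Rintegral => s _; rewrite E1 E2.
rewrite (RintD (L1prod_inner1 Lp) (L1prod_inner2 Lp')) -(RFubini Lp').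
rewrite -(RintD (L1prod_inner1 Lp) (L1prod_inner1 Lp')) -RintegralZl//.
apply: eq_Rintegral => s _; rewrite /p /p'.
have Ep : \int[lebT t]_u ((u <= s)%R%:R * a u * b s) =
    \int[lebT t]_u ((u <= s)%R%:R * a u) * b s by rewrite RintegralZr//; exact: Lle.
have Ep' : \int[lebT t]_u ((s < u)%R%:R * a u * b s) =
    \int[lebT t]_u ((s < u)%R%:R * a u) * b s by rewrite RintegralZr//; exact: Lgt.
rewrite Ep Ep' -mulrDl -(RintD (Lle _ s ma aC) (Lgt s)); congr (_ * _).
by apply: eq_Rintegral => u _; rewrite ltNge; case: (_ <= _) => /=; ring.
Qed.

End RunningIntegral.

Section QuadraticForms.
Variables (R : realType) (n : nat) (S : 'M[R]_n).

(** The quadratic form of [S] on a family of components, as stochastic processes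
    are handled by components. *)
Definition qform (y : 'I_n -> R) : R := \sum_i \sum_i' S i i' * (y i * y i').

Lemma qformE (y : 'I_n -> R) : qform y = quadf S (\col_i y i).
Proof.
rewrite /quadf /dotv; apply: eq_bigr => i _; rewrite !mxE mulr_sumr.
by apply: eq_bigr => i' _; rewrite !mxE; ring.
Qed.

Hypothesis psdS : psd S.

Lemma qform_ge0 y : 0 <= qform y.
Proof. by rewrite qformE; exact: psdS.2. Qed.

(** The gap is [e^-1] times the form at [e y - (x - y)]. *)
Lemma qform_young (e : R) (x y : 'I_n -> R) : 0 < e ->
  qform x <= (1 + e) * qform y + (1 + e^-1) * qform (fun i => x i - y i).
Proof.
move=> e0.
have -> : (1 + e) * qform y + (1 + e^-1) * qform (fun i => x i - y i) =
    qform x + e^-1 * qform (fun i => e * y i - (x i - y i)).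
  rewrite /qform !mulr_sumr -!big_split/=; apply: eq_bigr => i _.
  rewrite !mulr_sumr -!big_split/=; apply: eq_bigr => i' _.
  by field; rewrite gt_eqF.
by rewrite lerDl mulr_ge0 ?qform_ge0// invr_ge0 ltW.
Qed.

Definition mxnorm1 : R := \sum_i \sum_i' `|S i i'|.

Lemma qform_le (y : 'I_n -> R) : qform y <= mxnorm1 * \sum_i y i ^+ 2.
Proof.
rewrite /mxnorm1 mulr_suml; apply: ler_sum => i _; rewrite mulr_suml.
apply: ler_sum => i' _; apply: le_trans (ler_norm _) _; rewrite normrM.
apply: ler_wpM2l => //.
have le1 k : y k ^+ 2 <= \sum_i y i ^+ 2.
  by rewrite (bigD1 k)//= lerDl; apply: sumr_ge0 => l _; exact: sqr_ge0.
have := le1 i; have := le1 i'; set s := \sum_(_ < _) _ => h1 h2.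
rewrite ler_norml; have := sqr_ge0 (y i + y i'); have := sqr_ge0 (y i - y i').
by rewrite sqrrB sqrrD => *; apply/andP; split; lra.
Qed.

Lemma mxnorm1_ge0 : 0 <= mxnorm1.
Proof. by apply: sumr_ge0 => i _; apply: sumr_ge0 => i' _. Qed.

End QuadraticForms.

(** * Limits of means *)
Section LimitTheorems.
Context (R : realType).

Lemma real_cvg_eps (a : nat -> R) (l : R) (v : nat -> \bar R) :
  (forall k, 0 <= v k)%E -> v @ \oo --> 0%E ->
  (forall e : R, 0 < e -> exists2 C : R, 0 <= C &
     forall k, ((`|a k - l|)%:E <= e%:E + C%:E * v k)%E) ->
  a @ \oo --> l.
Proof.
move=> v0 vv H; have := @squeeze_eps _ (fun k => (`|a k - l|)%:E) v _ v0 vv H.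
move=> /(_ (fun k => normr_ge0 _)).
move/ge0_cvg0P => /(_ (fun k => normr_ge0 _)) H0.
apply/cvgrPdist_le => e e0; apply: filterS (H0 e e0) => k.
by rewrite lee_fin distrC.
Qed.

Lemma Rdominated_cvg d (T : measurableType d) (mu : {measure set T -> \bar R})
    (f_ : nat -> T -> R) (f g : T -> R) :
  (forall k, measurable_fun setT (f_ k)) -> measurable_fun setT f ->
  {ae mu, forall x, (fun k => f_ k x) @ \oo --> f x} ->
  (forall k x, `|f_ k x| <= g x) -> L1 mu g ->
  (fun k => \int[mu]_x f_ k x) @ \oo --> \int[mu]_x f x.
Proof.
move=> mf_ mf ff fg Lg.
have Lf_ k : L1 mu (f_ k) by exact: (L1_le (mf_ k) (fg k) Lg).
have [] := @dominated_convergence _ _ _ mu setT measurableT (fun k x => (f_ k x)%:E)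
  (fun x => (f x)%:E) (fun x => (g x)%:E).
- by move=> k; exact/measurable_EFinP.
- exact/measurable_EFinP.
- by apply: filterS ff => x fx _; exact: cvg_comp fx _.
- exact: Lg.
- by apply: aeW => x k _; rewrite lee_fin.
move=> Lf _ cf; have {}Lf : L1 mu f by [].
by apply: fine_cvg; rewrite L1E.
Qed.

Lemma real_cvg_sum (I : Type) (r : seq I) (f : I -> nat -> R) (a : I -> R) :
  (forall i, f i @ \oo --> a i) ->
  (fun k => \sum_(i <- r) f i k) @ \oo --> \sum_(i <- r) a i.
Proof.
move=> fa; elim: r => [|i r IH].
  by under eq_fun do rewrite big_nil; rewrite big_nil; exact: cvg_cst.
by under eq_fun do rewrite big_cons; rewrite big_cons; exact: cvgD.
Qed.

End LimitTheorems.

Section ConvergenceOfMeans.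
Context (R : realType) (d : measure_display) (Omega : measurableType d).
Variable Pr : probability Omega R.

Lemma pmetE (f : Omega -> R) : measurable_fun setT f -> (forall o, 0 <= f o) ->
  L1 Pr (fun o => Num.min (f o) 1) /\
  pmet Pr (fun o => (f o)%:E) = (\int[Pr]_o Num.min (f o) 1)%:E.
Proof.
move=> mf f0.
have L : L1 Pr (fun o => Num.min (f o) 1).
  apply: (@L1_bounded _ _ _ _ _ 1); first exact: measurable_minr.
  by move=> o; rewrite ger0_norm ?le_min ?f0 ?ler01// ge_min lexx orbT.
by split=> //; rewrite L1E//; apply: eq_integral => o _; rewrite EFin_min.
Qed.

(** Completing a square: for [|x| <= 1] the last term is [e^-1 x^2], otherwise it
    is [e^-1]. *)
Lemma abs_split (e x : R) : 0 < e -> `|x| <= e + e * x ^+ 2 + e^-1 * Num.min (x ^+ 2) 1.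
Proof.
move=> e0; have ei : 0 < e^-1 by rewrite invr_gt0.
have ee : e * e^-1 = 1 by rewrite divff// gt_eqF.
rewrite -(real_normK (num_real x)); have := normr_ge0 x; set y := `|x| => y0.
have y2 : 0 <= y ^+ 2 by exact: sqr_ge0.
have ey2 : 0 <= e * y ^+ 2 by rewrite mulr_ge0// ltW.
have [y1|y1] := leP (y ^+ 2) 1.
  have : 0 <= e^-1 * (y - e) ^+ 2 by rewrite mulr_ge0 ?sqr_ge0// ltW.
  have -> : e^-1 * (y - e) ^+ 2 = e^-1 * y ^+ 2 - 2 * (e * e^-1) * y + e * (e * e^-1).
    by ring.
  by rewrite ee; lra.
have : 0 <= e * (y - e^-1) ^+ 2 by rewrite mulr_ge0 ?sqr_ge0// ltW.
have -> : e * (y - e^-1) ^+ 2 = e * y ^+ 2 - 2 * (e * e^-1) * y + e^-1 * (e * e^-1).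
  by ring.
by rewrite ee; lra.
Qed.

(** A bound in [L^2] upgrades convergence in probability to convergence of the
    means: by [abs_split] the mean is at most [e (1 + C)] plus a multiple of the
    distance [pmet]. *)
Lemma mean_cvg0 (D : nat -> Omega -> R) (C : R) :
  (forall k, measurable_fun setT (D k)) -> (forall k, L1 Pr (fun o => D k o ^+ 2)) ->
  (forall k, \int[Pr]_o (D k o ^+ 2) <= C) ->
  cvp0 Pr (fun k o => (D k o ^+ 2)%:E) ->
  (fun k => \int[Pr]_o D k o) @ \oo --> (0 : R).
Proof.
move=> mD LD DC D0.
have C0 : 0 <= C.
  by apply: le_trans (DC 0%N); apply: Rintegral_ge0 => o _; exact: sqr_ge0.
have mD2 k : measurable_fun setT (fun o => D k o ^+ 2) by exact: measurable_funX.
apply: (real_cvg_eps _ D0).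
  by move=> k; apply: pmet_ge0 => o; rewrite lee_fin sqr_ge0.
move=> e e0; pose e' := e / (1 + C); have e'0 : 0 < e' by rewrite divr_gt0// ltr_wpDr.
exists e'^-1; first by rewrite invr_ge0 ltW.
move=> k; have [Lm ->] := pmetE (mD2 k) (fun o => sqr_ge0 _).
rewrite -EFinM -EFinD lee_fin subr0.
have LDk : L1 Pr (D k) by exact: L1_of_sqr.
apply: le_trans (Rint_abs LDk) _.
apply: (@le_trans _ _ (\int[Pr]_o (e' + e' * D k o ^+ 2 + e'^-1 * Num.min (D k o ^+ 2) 1))).
  apply: Rint_le => //; first exact: L1_abs.
    by apply: L1D; [apply: L1D; [exact: L1_cst|exact: L1Zl]|exact: L1Zl].
  by move=> o; exact: abs_split.
rewrite RintD; [|by apply: L1D; [exact: L1_cst|exact: L1Zl]|exact: L1Zl].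
rewrite RintD; [|exact: L1_cst|exact: L1Zl].
rewrite (RintZ e' (LD k)) (RintZ _ Lm) Rintegral_prob_cst lerD2r.
have -> : e = e' * (1 + C) by rewrite /e' divfK// gt_eqF// ltr_wpDr.
by rewrite mulrDr mulr1 lerD2l ler_wpM2l// ltW.
Qed.

Variables (n : nat) (S : 'M[R]_n).
Hypothesis psdS : psd S.

Lemma qform_measurable (Y : 'I_n -> Omega -> R) : (forall i, measurable_fun setT (Y i)) ->
  measurable_fun setT (fun o => qform S (fun i => Y i o)).
Proof.
move=> mY; apply: measurable_sum => i; apply: measurable_sum => i'.
by apply: measurable_funM => //; exact: measurable_funM.
Qed.

(** Young's inequality bounds the form of [Y] by [1 + e] times the one of [Yk], plus
    a multiple of [|Y - Yk|^2]. Truncating the left-hand side at a level [m] allows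
    to truncate the error at 1, whose mean then vanishes; [e] tends to 0 and [m] to
    infinity afterwards. *)
Lemma fatou_prob (Y : 'I_n -> Omega -> R) (Yk : nat -> 'I_n -> Omega -> R)
    (c : nat -> R) (l : R) :
  (forall i, measurable_fun setT (Y i)) ->
  (forall k i, measurable_fun setT (Yk k i)) ->
  cvp0 Pr (fun k o => (\sum_i (Y i o - Yk k i o) ^+ 2)%:E) ->
  (forall k, (\int[Pr]_o (qform S (fun i => Yk k i o))%:E <= (c k)%:E)%E) ->
  c @ \oo --> l ->
  (\int[Pr]_o (qform S (fun i => Y i o))%:E <= l%:E)%E.
Proof.
move=> mY mYk D0 Vc cl.
have mV := qform_measurable mY; have mVk k := qform_measurable (mYk k).
have V0 o : 0 <= qform S (fun i => Y i o) by exact: qform_ge0.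
have Vk0 k o : 0 <= qform S (fun i => Yk k i o) by exact: qform_ge0.
pose D k o := \sum_i (Y i o - Yk k i o) ^+ 2.
have D0' k o : 0 <= D k o by apply: sumr_ge0 => i _; exact: sqr_ge0.
have mD k : measurable_fun setT (D k).
  by apply: measurable_sum => i; apply: measurable_funX; exact: measurable_funB.
apply: integral_trunc_le => // m.
have mm : measurable_fun setT (fun o => Num.min (qform S (fun i => Y i o)) m%:R).
  exact: measurable_minr.
have Lm : L1 Pr (fun o => Num.min (qform S (fun i => Y i o)) m%:R).
  apply: (@L1_bounded _ _ _ _ _ m%:R) => //.
  by move=> o; rewrite ger0_norm ?le_min ?V0 ?ler0n// ge_min lexx orbT.
rewrite -L1E// lee_fin.
have LVk k : L1 Pr (fun o => qform S (fun i => Yk k i o)).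
  by apply: L1_ge0 => //; apply: le_lt_trans (Vc k) _; exact: ltry.
have Ve (e : R) : 0 < e ->
    \int[Pr]_o Num.min (qform S (fun i => Y i o)) m%:R <= (1 + e) * l.
  move=> e0; pose Ce := (1 + e^-1) * mxnorm1 S.
  have Ce0 : 0 <= Ce by rewrite mulr_ge0 ?mxnorm1_ge0// addr_ge0// invr_ge0 ltW.
  have bnd k : \int[Pr]_o Num.min (qform S (fun i => Y i o)) m%:R <=
      (1 + e) * c k + (Ce + m%:R) * fine (pmet Pr (fun o => (D k o)%:E)).
    have [Lp ->] := pmetE (mD k) (D0' k); rewrite /=.
    apply: (@le_trans _ _ (\int[Pr]_o ((1 + e) * qform S (fun i => Yk k i o) +
        (Ce + m%:R) * Num.min (D k o) 1))).
      apply: Rint_le => //; first by apply: L1D; exact: L1Zl.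
      move=> o; have := qform_young psdS (fun i => Y i o) (fun i => Yk k i o) e0.
      have : (1 + e^-1) * qform S (fun i => Y i o - Yk k i o) <= Ce * D k o.
        rewrite /Ce -mulrA ler_wpM2l ?qform_le// addr_ge0// invr_ge0; exact: ltW.
      have := Vk0 k o; set a := qform S _; set b := _ * qform _ _.
      set v := qform S _; move=> a0 bD vab.
      have ea : 0 <= (1 + e) * a by rewrite mulr_ge0// addr_ge0// ltW.
      have [D1|D1] := leP (D k o) 1.
        rewrite ge_min; apply/orP; left; rewrite mulrDl.
        have : 0 <= m%:R * D k o by rewrite mulr_ge0.
        by move: vab; lra.
      by rewrite ge_min; apply/orP; right; move: ea Ce0; lra.
    rewrite RintD; [|exact: L1Zl|exact: L1Zl].
    rewrite (RintZ _ (LVk k)) (RintZ _ Lp) lerD2r; apply: ler_wpM2l.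
      by rewrite addr_ge0// ltW.
    by rewrite -lee_fin L1E.
  have cv : (fun k => (1 + e) * c k + (Ce + m%:R) * fine (pmet Pr (fun o => (D k o)%:E)))
      @ \oo --> (1 + e) * l + (Ce + m%:R) * 0.
    apply: cvgD; first exact: cvgMr.
    by apply: cvgMr; exact: fine_cvg.
  by rewrite mulr0 addr0 in cv; apply: (cvgr_to_ge cv); apply: nearW.
have l0 : 0 <= l.
  apply: (cvgr_to_ge cl); apply: nearW => k; rewrite -lee_fin.
  by apply: le_trans (Vc k); apply: integral_ge0 => o _; rewrite lee_fin.
apply/ler_addgt0Pr => e e0.
have e'0 : 0 < e / (1 + l) by rewrite divr_gt0// ltr_wpDr.
apply: le_trans (Ve _ e'0) _; rewrite mulrDl mul1r lerD2l.
rewrite -mulrA [_^-1 * l]mulrC; apply: ler_piMr; first exact: ltW.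
by rewrite ler_pdivrMr ?ltr_wpDr// mul1r lerDr.
Qed.

End ConvergenceOfMeans.

(** * Limits and measurability of parametric integrals *)
Section ProductLimits.
Context d (T : measurableType d) (R : realType).
Variable mu : {measure set T -> \bar R}.

Lemma sqr_sum_le q (a : 'I_q -> R) :
  (\sum_j a j) ^+ 2 <= q%:R ^+ 2 * \sum_j a j ^+ 2.
Proof.
have := qform_le (const_mx 1) a; rewrite /qform /mxnorm1.
have -> : \sum_i \sum_i' (const_mx 1 : 'M[R]_q) i i' * (a i * a i') = (\sum_j a j) ^+ 2.
  rewrite expr2 mulr_suml; apply: eq_bigr => i _; rewrite mulr_sumr.
  by apply: eq_bigr => i' _; rewrite mxE mul1r.
have -> : \sum_i \sum_i' `|(const_mx 1 : 'M[R]_q) i i'| = q%:R ^+ 2.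
  under eq_bigr do under eq_bigr do rewrite mxE normr1.
  by rewrite !sumr_const card_ord expr2 mulr_natr.
by [].
Qed.

(** The difference of the products is bounded by a small multiple of the energies
    of the limits plus a multiple of the squared errors. *)
Lemma L2_product_cvg (f_ g_ : nat -> T -> R) (f g : T -> R) :
  (forall k, measurable_fun setT (f_ k)) -> (forall k, measurable_fun setT (g_ k)) ->
  measurable_fun setT f -> measurable_fun setT g ->
  (forall k, L1 mu (fun x => f_ k x ^+ 2)) -> (forall k, L1 mu (fun x => g_ k x ^+ 2)) ->
  L1 mu (fun x => f x ^+ 2) -> L1 mu (fun x => g x ^+ 2) ->
  (fun k => \int[mu]_x ((f_ k x - f x) ^+ 2)) @ \oo --> (0 : R) ->
  (fun k => \int[mu]_x ((g_ k x - g x) ^+ 2)) @ \oo --> (0 : R) ->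
  (fun k => \int[mu]_x (f_ k x * g_ k x)) @ \oo --> \int[mu]_x (f x * g x).
Proof.
move=> mf_ mg_ mf mg Lf_ Lg_ Lf Lg cf cg.
have Ld (u v : T -> R) : measurable_fun setT u -> measurable_fun setT v ->
    L1 mu (fun x => u x ^+ 2) -> L1 mu (fun x => v x ^+ 2) ->
    L1 mu (fun x => (u x - v x) ^+ 2).
  move=> mu' mv Lu Lv; apply: (L1_sqrD mu' (g := fun x => - v x)) => //.
    exact: measurableT_comp.
  by under eq_fun do rewrite sqrrN.
have Lfd k := Ld _ _ (mf_ k) mf (Lf_ k) Lf; have Lgd k := Ld _ _ (mg_ k) mg (Lg_ k) Lg.
pose v k := (\int[mu]_x ((f_ k x - f x) ^+ 2) + \int[mu]_x ((g_ k x - g x) ^+ 2))%:E.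
have v0 k : (0 <= v k)%E.
  by rewrite lee_fin addr_ge0//; apply: Rintegral_ge0 => x _; exact: sqr_ge0.
have vv : v @ \oo --> 0%E.
  have : (fun k => \int[mu]_x ((f_ k x - f x) ^+ 2) + \int[mu]_x ((g_ k x - g x) ^+ 2))
    @ \oo --> (0 + 0 : R) by exact: cvgD.
  by rewrite addr0 => h; exact: cvg_comp h _.
apply: (real_cvg_eps v0 vv) => e e0.
pose E := \int[mu]_x (f x ^+ 2) + \int[mu]_x (g x ^+ 2).
have E0 : 0 <= E by rewrite addr_ge0//; apply: Rintegral_ge0 => x _; exact: sqr_ge0.
pose e' := e / (1 + E); have e'0 : 0 < e' by rewrite divr_gt0// ltr_wpDr.
have ei0 : 0 < e'^-1 by rewrite invr_gt0.
exists (1 + e'^-1); first by rewrite addr_ge0// ltW.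
move=> k; rewrite /v -EFinM -EFinD lee_fin.
have L1p : L1 mu (fun x => f_ k x * g_ k x) by exact: L1_sqr_prod.
have L1q : L1 mu (fun x => f x * g x) by exact: L1_sqr_prod.
rewrite -RintB//; apply: le_trans (Rint_abs _) _; first exact: L1B.
have -> : \int[mu]_x ((f_ k x - f x) ^+ 2) + \int[mu]_x ((g_ k x - g x) ^+ 2) =
    \int[mu]_x ((f_ k x - f x) ^+ 2 + (g_ k x - g x) ^+ 2).
  by rewrite (RintD (Lfd k) (Lgd k)).
apply: (@le_trans _ _ (e' * \int[mu]_x (f x ^+ 2 + g x ^+ 2) +
  (1 + e'^-1) * \int[mu]_x ((f_ k x - f x) ^+ 2 + (g_ k x - g x) ^+ 2))); last first.
  rewrite lerD2r (RintD Lf Lg) -/E.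
  have -> : e = e' * (1 + E) by rewrite /e' divfK// gt_eqF// ltr_wpDr.
  by apply: ler_wpM2l; [exact: ltW|rewrite lerDr].
have LA := L1D Lf Lg; have LB := L1D (Lfd k) (Lgd k).
rewrite -(RintZ e' LA) -(RintZ (1 + e'^-1) LB) -RintD; [|exact: L1Zl|exact: L1Zl].
apply: Rint_le.
- by apply: L1_abs; exact: L1B.
- by apply: L1D; exact: L1Zl.
move=> x; set a := f_ k x; set b := g_ k x; set c := f x; set y := g x.
have ee : e' * e'^-1 = 1 by rewrite divff// gt_eqF.
have Y (z s : R) : `|z * s| <= e' / 2 * z ^+ 2 + e'^-1 / 2 * s ^+ 2.
  have h1 : 0 <= e'^-1 * (e' * z - s) ^+ 2 by rewrite mulr_ge0 ?sqr_ge0// ltW.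
  have h2 : 0 <= e'^-1 * (e' * z + s) ^+ 2 by rewrite mulr_ge0 ?sqr_ge0// ltW.
  have E1 : e'^-1 * (e' * z - s) ^+ 2 =
    e' * (e' * e'^-1) * z ^+ 2 - 2 * (e' * e'^-1) * (z * s) + e'^-1 * s ^+ 2 by ring.
  have E2 : e'^-1 * (e' * z + s) ^+ 2 =
    e' * (e' * e'^-1) * z ^+ 2 + 2 * (e' * e'^-1) * (z * s) + e'^-1 * s ^+ 2 by ring.
  by rewrite E1 ee in h1; rewrite E2 ee in h2; rewrite ler_norml; apply/andP; split; lra.
have -> : a * b - c * y = (a - c) * (b - y) + c * (b - y) + y * (a - c) by ring.
apply: le_trans (ler_normD _ _) _; apply: le_trans (lerD (ler_normD _ _) (lexx _)) _.
have h1 := Y c (b - y); have h2 := Y y (a - c).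
have h3 : `|(a - c) * (b - y)| <= ((a - c) ^+ 2 + (b - y) ^+ 2) / 2.
  have := sqr_ge0 (a - c - (b - y)); have := sqr_ge0 (a - c + (b - y)).
  by rewrite ler_norml => ? ?; apply/andP; split; lra.
have h4 : 0 <= e' * (c ^+ 2 + y ^+ 2).
  by apply: mulr_ge0; [exact: ltW|rewrite addr_ge0// sqr_ge0].
have h5 : 0 <= e'^-1 * ((a - c) ^+ 2 + (b - y) ^+ 2).
  by apply: mulr_ge0; [exact: ltW|rewrite addr_ge0// sqr_ge0].
have h6 : 0 <= (a - c) ^+ 2 by exact: sqr_ge0.
have h7 : 0 <= (b - y) ^+ 2 by exact: sqr_ge0.
by move: h1 h2 h3 h4 h5 h6 h7; lra.
Qed.

End ProductLimits.

Section ParameterIntegrals.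
Context d1 d2 (T1 : measurableType d1) (T2 : measurableType d2) (R : realType).

(** The theorem of Tonelli applies to the positive and to the negative part. *)
Lemma parameter_integral_measurable (nu : {finite_measure set T2 -> \bar R})
    (f : T1 -> T2 -> R) : jmeas f ->
  measurable_fun setT (fun x => \int[nu]_y f x y).
Proof.
move=> jf; rewrite /Rintegral.
apply: measurableT_comp => //.
under eq_fun do rewrite integralE.
have P (h : T1 * T2 -> \bar R) : measurable_fun setT h -> (forall z, 0 <= h z)%E ->
    measurable_fun setT (fun x => \int[nu]_y h (x, y))%E.
  by move=> mh h0; exact: (@measurable_fun_fubini_tonelli_F _ _ _ _ _ nu h).
have mE : measurable_fun setT (fun z : T1 * T2 => (f z.1 z.2)%:E).
  exact/measurable_EFinP.
apply: emeasurable_funB.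
  apply: eq_measurable_fun (P _ (measurable_funepos mE) (funepos_ge0 _)) => x _.
  by apply: eq_integral => y _; rewrite !funeposE.
apply: eq_measurable_fun (P _ (measurable_funeneg mE) (funeneg_ge0 _)) => x _.
by apply: eq_integral => y _; rewrite !funenegE.
Qed.

End ParameterIntegrals.

Section RunningIntegralProcess.
Context (R : realType) (d : measure_display) (Omega : measurableType d).

Lemma runint_bound (t s : R) (a c : R -> R) : measurable_fun setT a ->
  (forall u, `|a u| <= c u) -> L1 (lebT t) c ->
  `|runint t a s| <= \int[lebT t]_u c u.
Proof.
move=> ma ac Lc.
have La : L1 (lebT t) (fun u => (u <= s)%R%:R * a u).
  apply: (L1_le _ _ Lc).
    by apply: measurable_funM => //; exact: measurable_le_cst.
  by move=> u; exact: le_trans (bool_mul_norm _ _) (ac u).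
apply: le_trans (Rint_abs La) _; apply: Rint_le => //; first exact: L1_abs.
by move=> u; exact: le_trans (bool_mul_norm _ _) (ac u).
Qed.

Lemma jmeas_runint t (a : measurableTypeR R -> Omega -> R) : jmeas a ->
  jmeas (fun s o => runint t (a ^~ o) s).
Proof.
move=> ja.
apply: (@parameter_integral_measurable _ _ (measurableTypeR R * Omega)%type _ R (lebT t)
  (fun z u => (u <= z.1)%R%:R * a u z.2)).
pose TT := ((measurableTypeR R * Omega) * measurableTypeR R)%type.
have m2 : measurable_fun setT (fun z : TT => z.2) by exact: measurable_snd.
have m11 : measurable_fun setT (fun z : TT => z.1.1).
  exact: measurableT_comp measurable_fst measurable_fst.
have m12 : measurable_fun setT (fun z : TT => z.1.2).
  exact: measurableT_comp measurable_snd measurable_fst.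
apply: measurable_funM.
  exact: (measurableT_comp (@measurable_le2 R) (measurable_fun_pair m2 m11)).
exact: (measurableT_comp ja (measurable_fun_pair m2 m12)).
Qed.

Lemma runint_lebT (s t : R) (a : R -> R) : s <= t -> measurable_fun setT a ->
  runint t a s = \int[lebT s]_u a u.
Proof.
move=> st ma; rewrite /runint lebT_Rintegral; last first.
  by apply: measurable_funM => //; exact: measurable_le_cst.
rewrite lebT_Rintegral// Rintegral_mkcond [RHS]Rintegral_mkcond; congr Rintegral.
apply/funext => u; rewrite /patch !mem_setE !in_itv/=.
have [u0|u0]//= := leP 0 u; have [us|us] := leP u s.
  by rewrite (le_trans us st) mul1r.
by rewrite mul0r if_same.
Qed.

End RunningIntegralProcess.

Section ProductIntegral.
Context d1 d2 (T1 : measurableType d1) (T2 : measurableType d2) (R : realType).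
Variable m1 : {finite_measure set T1 -> \bar R}.
Variable m2 : {finite_measure set T2 -> \bar R}.

(** Double integrals are gathered into an integral over the product, where linearity
    and dominated convergence apply at once. *)
Definition Pint (f : T1 -> T2 -> R) : R := \int[(m1 \x m2)%E]_z f z.1 z.2.

Lemma PintE1 f : L1prod m1 m2 f -> \int[m1]_x \int[m2]_y f x y = Pint f.
Proof. by move=> Lf; apply: EFin_inj; rewrite (RFubini1 Lf) /Pint L1E. Qed.

Lemma PintE2 f : L1prod m1 m2 f -> \int[m2]_y \int[m1]_x f x y = Pint f.
Proof. by move=> Lf; rewrite -(RFubini Lf) PintE1. Qed.

Lemma Pint_tonelli f : jmeas f -> (forall x y, 0 <= f x y) ->
  Pint f = fine (\int[m2]_y \int[m1]_x (f x y)%:E)%E.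
Proof.
move=> jf f0; rewrite /Pint /Rintegral; congr fine.
have := @fubini_tonelli2 _ _ _ _ _ m1 m2 (fun z => (f z.1 z.2)%:E).
move=> ->//; first exact/measurable_EFinP.
by move=> z; rewrite lee_fin.
Qed.

End ProductIntegral.

(** * The energy inequality for a stopped Ito process *)
Section Energy.
Context (R : realType) (d : measure_display) (Omega : measurableType d).
Variables (Pr : probability Omega R) (F : R -> set (set Omega)).
Variables (q : nat) (K : 'M[R]_q) (w : R -> Omega -> 'cV[R]_q).
Hypothesis uF : usual_filtration Pr F.
Hypothesis W : wiener_process Pr F K w.
Variables (t : R) (B : R -> Omega -> bool) (N : nat).
Local Notation chi := (survival B).
Hypothesis t0 : 0 <= t.
Hypothesis jchi : jmeas chi.
Hypothesis FB : forall s, 0 <= s <= t -> F s [set o | B s o].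
Hypothesis Bmono : forall s s' o, 0 <= s -> s <= s' -> s' <= t -> B s' o -> B s o.
Hypothesis Bleft : forall s o, 0 < s -> s <= t -> ~~ B s o ->
  exists2 s', 0 <= s' < s & ~~ B s' o.
Variables (n : nat) (X b : 'I_n -> measurableTypeR R -> Omega -> R).
Variable h : 'I_n -> 'I_q -> measurableTypeR R -> Omega -> R.
Hypothesis jX : forall i, jmeas (X i).
Hypothesis jb : forall i, jmeas (b i).
Hypothesis jh : forall i j, jmeas (h i j).
Hypothesis FX : forall i s, 0 <= s <= t -> meas_wrt (F s) (X i s).
Hypothesis Fb : forall i s, 0 <= s <= t -> meas_wrt (F s) (b i s).
Hypothesis bX : forall i i' o,
  (\int[lebT t]_u (chi u o * (`|b i u o| * (1 + `|X i' u o|)))%:E <= N%:R%:E)%E.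
Hypothesis chih : forall i j o,
  (\int[lebT t]_u (chi u o * h i j u o ^+ 2)%:E <= N%:R%:E)%E.
Hypothesis Xeq : forall s, 0 <= s <= t -> exists J : 'I_n -> 'I_q -> Omega -> R,
  (forall i j, ito_integral Pr F (fun s o => w s o j 0) s (h i j) (J i j)) /\
  {ae Pr, forall o, forall i, X i s o =
     \int[lebesgue_measure]_(u in `[0, s]) b i u o + \sum_j J i j o}.

Local Notation mm := (lebT t \x Pr)%E.

Let chi01 u o : chi u o = 0 \/ chi u o = 1.
Proof. by rewrite /survival; case: (B u o); [right|left]. Qed.
Let chi0 u o : 0 <= chi u o. Proof. by rewrite /survival ler0n. Qed.
Let chi1 u o : chi u o <= 1. Proof. by rewrite /survival lern1 leq_b1. Qed.
Let chiS u o : chi u o ^+ 2 = chi u o.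
Proof. by case: (chi01 u o) => ->; ring. Qed.

(** The drift until the stopping, its running integral and what remains of [X]:
    the stochastic integral, as long as the stopping has not occurred. *)
Definition stopped_drift i (u : measurableTypeR R) (o : Omega) : R := chi u o * b i u o.
Local Notation bt := stopped_drift.
Definition drift_part i (s : measurableTypeR R) (o : Omega) : R :=
  runint t (bt i ^~ o) s.
Local Notation Ab := drift_part.
Definition mart_part i (s : measurableTypeR R) (o : Omega) : R := X i s o - Ab i s o.
Local Notation Mp := mart_part.
(** The cut-off makes the drift bounded, hence integrable against the square
    integrable approximations of the martingale part. *)
Definition size_cut (r : nat) (u : measurableTypeR R) (o : Omega) : R :=
  (\sum_i (`|b i u o| + `|X i u o|) <= r%:R)%R%:R.
Definition cut_drift r i (u : measurableTypeR R) (o : Omega) : R :=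
  size_cut r u o * bt i u o.
Local Notation br := cut_drift.
Definition cut_drift_part r i (s : measurableTypeR R) (o : Omega) : R :=
  runint t (br r i ^~ o) s.
Local Notation Ar := cut_drift_part.

Let jbt i : jmeas (bt i). Proof. exact: jmeasM. Qed.
Let jAb i : jmeas (Ab i). Proof. exact: jmeas_runint. Qed.
Let jMp i : jmeas (Mp i). Proof. exact: jmeasB. Qed.

Let jcut r : jmeas (size_cut r).
Proof.
apply: measurable_bool_natr; apply: measurable_fun_ler => //.
apply: measurable_sum => i; apply: measurable_funD.
  exact: measurableT_comp (jb i).
exact: measurableT_comp (jX i).
Qed.
Let jbr r i : jmeas (br r i). Proof. exact: jmeasM. Qed.
Let jAr r i : jmeas (Ar r i). Proof. exact: jmeas_runint. Qed.

Let normX_ge0 i u o : 0 <= `|b i u o| + `|X i u o|. Proof. by rewrite addr_ge0. Qed.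

Let cut_bound r i u o : size_cut r u o * (`|b i u o| + `|X i u o|) <= r%:R.
Proof.
rewrite /size_cut.
have [h1|_] := leP (\sum_i (`|b i u o| + `|X i u o|)) r%:R; last by rewrite mul0r.
rewrite mul1r; apply: le_trans h1; rewrite (bigD1 i)//= lerDl.
by apply: sumr_ge0 => k _.
Qed.
Let cut01 r u o : 0 <= size_cut r u o <= 1.
Proof. by rewrite /size_cut ler0n lern1 leq_b1. Qed.
Let cutM r u o : size_cut r u o * size_cut r u o = size_cut r u o.
Proof. by rewrite /size_cut; case: (_ <= _); rewrite /= ?mul1r ?mul0r. Qed.

Let bt_le i u o : `|bt i u o| = chi u o * `|b i u o|.
Proof. by rewrite /bt normrM ger0_norm. Qed.
Let br_bt r i u o : `|br r i u o| <= `|bt i u o|.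
Proof.
have /andP[c0 c1] := cut01 r u o.
by rewrite /br normrM (ger0_norm c0) ler_piMl.
Qed.
Let br_le r i u o : `|br r i u o| <= r%:R.
Proof.
have /andP[c0 c1] := cut01 r u o.
apply: le_trans (cut_bound r i u o); rewrite /br normrM (ger0_norm c0).
apply: ler_wpM2l => //; rewrite bt_le; apply: le_trans (_ : `|b i u o| <= _).
  exact: ler_piMl.
by rewrite lerDl.
Qed.

Let Lbt i o : L1 (lebT t) (fun u => `|bt i u o|) /\ \int[lebT t]_u `|bt i u o| <= N%:R.
Proof.
have mb : measurable_fun setT (fun u => `|bt i u o|).
  exact: measurableT_comp (jmeas2 o (jbt i)).
have le : (\int[lebT t]_u (`|bt i u o|)%:E <= N%:R%:E)%E.
  apply: le_trans (bX i i o); apply: ge0_le_integral => //.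
  - exact/measurable_EFinP.
  - apply/measurable_EFinP; apply: measurable_funM; first exact: (jmeas2 o jchi).
    apply: measurable_funM; first exact: measurableT_comp (jmeas2 o (jb i)).
    by apply: measurable_funD => //; exact: measurableT_comp (jmeas2 o (jX i)).
  - move=> u _; rewrite lee_fin bt_le; apply: ler_wpM2l => //.
    by rewrite ler_peMr// lerDl.
have L : L1 (lebT t) (fun u => `|bt i u o|).
  by apply: L1_ge0 => //; apply: le_lt_trans le _; exact: ltry.
by split=> //; rewrite -lee_fin L1E.
Qed.

Let Ab_le i s o : `|Ab i s o| <= N%:R.
Proof.
apply: le_trans (Lbt i o).2; apply: runint_bound => //; last exact: (Lbt i o).1.
exact: (jmeas2 o (jbt i)).
Qed.
Let Ar_le r i s o : `|Ar r i s o| <= N%:R.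
Proof.
apply: le_trans (Lbt i o).2; apply: runint_bound => //; last exact: (Lbt i o).1.
exact: (jmeas2 o (jbr r i)).
Qed.

(** If the stopping has not occurred by time [s], it has not occurred before
    either, so that the stopped drift is the drift on [0, s]. *)
Lemma mart_part_eq s : 0 <= s <= t -> exists J : 'I_n -> 'I_q -> Omega -> R,
  (forall i j, ito_integral Pr F (fun s o => w s o j 0) s (h i j) (J i j)) /\
  {ae Pr, forall o, forall i, chi s o = 1 -> Mp i s o = \sum_j J i j o}.
Proof.
move=> /andP[s0 st]; have [|J [JI JE]] := @Xeq s; first by rewrite s0.
exists J; split => //; apply: filterS JE => o E i c1.
rewrite /Mp E /Ab runint_lebT//; last exact: (jmeas2 o (jbt i)).
have -> : \int[lebT s]_u bt i u o = \int[lebT s]_u b i u o.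
  apply: Rint_ae; [exact: (jmeas2 o (jbt i))|exact: (jmeas2 o (jb i))|].
  apply: ae_lebT_imp => u /andP[u0 us]; rewrite /bt.
  have -> : chi u o = 1; last by rewrite mul1r.
  have Bs : B s o.
    by move: c1; rewrite /survival; case: (B s o) => // /eqP; rewrite eq_sym oner_eq0.
  by rewrite /survival (Bmono u0 us st Bs).
by rewrite lebT_Rintegral ?(addrC (Rintegral _ _ _)) ?addrK//; exact: (jmeas2 o (jb i)).
Qed.

(** Brings the convergences in the definition of the Ito integral into the form
    which [stopped_integral_cvg] takes. *)
Lemma ito_integral_cvp0 (s : R) (j : 'I_q) (f : measurableTypeR R -> Omega -> R) J :
  0 <= s -> jmeas f -> ito_integral Pr F (fun s o => w s o j 0) s f J ->
  [/\ measurable_fun setT J,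
      {ae Pr, forall o, (\int[lebT s]_u (f u o ^+ 2)%:E < +oo)%E} &
      exists Gk : nat -> simple_process F,
        cvp0 Pr (fun k o => \int[lebT s]_u ((sp_val (Gk k) u o - f u o) ^+ 2)%:E)%E /\
        cvp0 Pr (fun k o => (`|spI w j (Gk k) s o - J o|)%:E)].
Proof.
move=> s0 jf [_ ffin FJ [Gk [G1 G2]]].
have mJ : measurable_fun setT J.
  exact: (meas_wrt_measurable (filtration_sub uF s0) FJ).
have m2 (g : R -> R) : measurable_fun setT g ->
    (\int[lebT s]_u (g u ^+ 2)%:E =
     \int[lebesgue_measure]_(u in `[0%R, s]) (g u ^+ 2)%:E)%E.
  move=> mg; apply: ge0_lebT_integral => [|u]; last by rewrite lee_fin sqr_ge0.
  by apply/measurable_EFinP; exact: measurable_funX.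
have jd k : jmeas (fun u o => sp_val (Gk k) u o - f u o).
  exact: jmeasB (sp_val_measurable uF (Gk k)) jf.
split => //.
  by apply: filterS ffin => o; rewrite m2//; exact: (jmeas2 o jf).
exists Gk; split; apply/cvp0P.
- move=> k; exact: (nnmeas_timeint _ (jmeas_sqr (jd k)) (fun _ _ => sqr_ge0 _)).
- rewrite (_ : (fun k o => _) = (fun k o => \int[lebesgue_measure]_(u in `[0%R, s])
      ((sp_val (Gk k) u o - f u o) ^+ 2)%:E)%E)//.
  by apply/funext => k; apply/funext => o; rewrite m2//; exact: (jmeas2 o (jd k)).
- move=> k; split=> [|o]; last by rewrite lee_fin.
  apply/measurable_EFinP; apply: measurableT_comp => //.
  by apply: measurable_funB => //; exact: (spI_measurable uF W).
- by move=> e e0; exact: G2.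
Qed.

Lemma approximants : exists Hs : 'I_n -> 'I_q -> nat -> simple_process F,
  forall i j,
  (forall k o, (\int[lebT t]_u (sp_val (Hs i j k) u o ^+ 2)%:E <= N.+1%:R%:E)%E) /\
  (fun k => \int[Pr]_o spcost t B (h i j) (Hs i j k) o)%E @ \oo --> 0%E.
Proof.
have [|J [JI _]] := @Xeq t; first by rewrite t0 lexx.
have ex (ij : 'I_n * 'I_q) : exists H : nat -> simple_process F,
    (forall k o, (\int[lebT t]_u (sp_val (H k) u o ^+ 2)%:E <= N.+1%:R%:E)%E) /\
    (fun k => \int[Pr]_o spcost t B (h ij.1 ij.2) (H k) o)%E @ \oo --> 0%E.
  have [_ hfin [Gk [G1 _]]] := ito_integral_cvp0 t0 (jh ij.1 ij.2) (JI ij.1 ij.2).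
  exact: (stopped_approximation uF t0 jchi FB Bmono Bleft (jh _ _)
    (@chih _ _) hfin G1).
have [H HP] := choice ex.
by exists (fun i j => H (i, j)) => i j; exact: (HP (i, j)).
Qed.

Section Approximants.
Variable Hs : 'I_n -> 'I_q -> nat -> simple_process F.
Hypothesis Hen : forall i j k o,
  (\int[lebT t]_u (sp_val (Hs i j k) u o ^+ 2)%:E <= N.+1%:R%:E)%E.
Hypothesis Hcost : forall i j,
  (fun k => \int[Pr]_o spcost t B (h i j) (Hs i j k) o)%E @ \oo --> 0%E.

(** A square integrable substitute for [mart_part], to which the isometry and the
    martingale property apply. *)
Definition mart k i (s : R) (o : Omega) : R := \sum_j spI w j (Hs i j k) s o.
Local Notation M := mart.

Let mM k i s : 0 <= s -> measurable_fun setT (M k i s).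
Proof. by move=> s0; apply: measurable_sum => j; exact: (spI_measurable uF W). Qed.

Let LM2 k i s : 0 <= s -> L1 Pr (fun o => M k i s o ^+ 2).
Proof.
move=> s0; apply: L1_sqr_sum => j; first exact: (spI_measurable uF W).
exact: (spI_L2 uF W).
Qed.

(** The isometry, as the energies of the approximations are at most [N + 1]. *)
Lemma mart_energy : exists2 C : R, 0 <= C &
  forall k i s, 0 <= s <= t -> \int[Pr]_o (M k i s o ^+ 2) <= C.
Proof.
exists (q%:R ^+ 2 * \sum_j (K j j * N.+1%:R)).
  rewrite mulr_ge0 ?sqr_ge0//; apply: sumr_ge0 => j _.
  by rewrite mulr_ge0// (K_diag_ge0 uF W).
move=> k i s /andP[s0 st].
have LI j := spI_L2 uF W j (Hs i j k) s0.
apply: (@le_trans _ _ (\int[Pr]_o (q%:R ^+ 2 * \sum_j spI w j (Hs i j k) s o ^+ 2))).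
  apply: Rint_le => [|| o]; [exact: LM2| |exact: sqr_sum_le].
  by apply: L1Zl; exact: L1_sum.
rewrite RintZ; last exact: L1_sum.
rewrite Rint_sum//; apply: ler_wpM2l; first exact: sqr_ge0.
apply: ler_sum => j _; have := sp_cov uF W (Hs i j k) (Hs i j k) j j s0.
under eq_Rintegral do rewrite -expr2.
move=> ->; apply: ler_wpM2l; first exact: (K_diag_ge0 uF W).
have jv := sp_val_measurable uF (Hs i j k).
have Lp := sp_val_prod_L1 (Pr := Pr) uF (Hs i j k) (Hs i j k) s.
rewrite -(@Rintegral_prob_cst _ _ _ Pr N.+1%:R).
apply: Rint_le; [exact: L1prod_inner2 Lp|exact: L1_cst|] => o.
rewrite -lee_fin L1E; last first.
  have [c hc] := sp_val_bounded (Hs i j k).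
  have mv := jmeas2 o jv.
  apply: (@L1_bounded _ _ _ _ _ (c * c)); first exact: measurable_funM.
  by move=> u; rewrite normrM ler_pM.
apply: le_trans (Hen i j k o).
under eq_integral do rewrite -expr2.
apply: lebT_mono => // [|u]; last exact: sqr_ge0.
by apply: measurable_funX; exact: (jmeas2 o jv).
Qed.

(** Before the stopping, the martingale part is the sum of the integrals [J], to
    which the approximations converge by [stopped_integral_cvg]. *)
Lemma mart_cvg i s : 0 <= s <= t ->
  cvp0 Pr (fun k o => (chi s o * (M k i s o - Mp i s o) ^+ 2)%:E).
Proof.
move=> st; have /andP[s0 _] := st.
have [J [JI JE]] := mart_part_eq st.
have mJ j : measurable_fun setT (J i j) by have [] := ito_integral_cvp0 s0 (jh i j) (JI i j).
have mchi : measurable_fun setT (chi s) by exact: jmeas1.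
have Zj j : cvp0 Pr (fun k o => (chi s o * (spI w j (Hs i j k) s o - J i j o) ^+ 2)%:E).
  have [_ _ [Gk [G1 G2]]] := ito_integral_cvp0 s0 (jh i j) (JI i j).
  exact: (stopped_integral_cvg uF W jchi FB Bmono (jh i j) st (mJ j) (Hcost i j) G1 G2).
have nj j k : nnmeas (fun o => (chi s o * (spI w j (Hs i j k) s o - J i j o) ^+ 2)%:E).
  split=> [|o]; last by rewrite lee_fin mulr_ge0// sqr_ge0.
  apply/measurable_EFinP; apply: measurable_funM => //; apply: measurable_funX.
  by apply: measurable_funB => //; exact: (spI_measurable uF W).
have ns k : nnmeas (fun o => (\sum_j (chi s o * (spI w j (Hs i j k) s o - J i j o) ^+ 2)%:E)%E).
  split=> [|o]; first by apply: emeasurable_sum => j; exact: (nj j k).1.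
  by apply: sume_ge0 => j _; exact: (nj j k).2.
have q1 : 1 <= q%:R ^+ 2 + 1 :> R by rewrite lerDr sqr_ge0.
have := cvp0_scale q1 ns (cvp0_sum (index_enum _) nj Zj).
apply: cvp0_le.
- move=> k; split=> [|o]; last by rewrite lee_fin mulr_ge0// sqr_ge0.
  apply/measurable_EFinP; apply: measurable_funM => //; apply: measurable_funX.
  by apply: measurable_funB; [exact: mM|exact: (jmeas1 s (jMp i))].
- move=> k; split=> [|o]; first by apply: measurable_funeM; exact: (ns k).1.
  by apply: mule_ge0; [rewrite lee_fin addr_ge0// sqr_ge0|exact: (ns k).2].
move=> k; apply: filterS JE => o /(_ i) E; rewrite sumEFin -EFinM lee_fin.
have [c|c] := chi01 s o.
  rewrite [leLHS](_ : _ = 0); last by rewrite c mul0r.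
  apply: mulr_ge0; first by rewrite addr_ge0// sqr_ge0.
  by apply: sumr_ge0 => j _; rewrite mulr_ge0// sqr_ge0.
rewrite c mul1r (E c) /M -sumrB; apply: le_trans (sqr_sum_le _) _.
under [in leRHS]eq_bigr do rewrite mul1r.
by apply: ler_wpM2r; [apply: sumr_ge0 => j _; exact: sqr_ge0|rewrite lerDl].
Qed.

Let mbr r i s : measurable_fun setT (br r i s). Proof. exact: jmeas1. Qed.

Let br_cut r i u o : br r i u o = size_cut r u o * br r i u o.
Proof. by rewrite /br mulrA cutM. Qed.

Let brMp_le r i i' u o : `|br r i u o * Mp i' u o| <= r%:R * (r%:R + N%:R).
Proof.
rewrite /Mp mulrBr; apply: le_trans (ler_normB _ _) _.
rewrite [leRHS]mulrDr; apply: lerD; last first.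
  by rewrite normrM ler_pM// ?br_le ?Ab_le.
have -> : br r i u o * X i' u o = br r i u o * (size_cut r u o * X i' u o).
  by rewrite {1}br_cut; ring.
rewrite normrM; apply: ler_pM => //.
have /andP[c0 _] := cut01 r u o; rewrite normrM (ger0_norm c0).
by apply: le_trans (cut_bound r i' u o); apply: ler_wpM2l => //; rewrite lerDr.
Qed.

(** The drift vanishes after the stopping, where [mart_cvg] gives no information;
    the second moments are bounded by [mart_energy]. *)
Lemma cut_drift_mart_cvg r i i' s : 0 <= s <= t ->
  (fun k => \int[Pr]_o (br r i s o * M k i' s o)) @ \oo -->
  \int[Pr]_o (br r i s o * Mp i' s o).
Proof.
move=> st; have /andP[s0 _] := st.
have mMp : measurable_fun setT (Mp i' s) by exact: (jmeas1 s (jMp i')).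
have LbMp : L1 Pr (fun o => br r i s o * Mp i' s o).
  apply: (@L1_bounded _ _ _ _ _ (r%:R * (r%:R + N%:R))); first exact: measurable_funM.
  exact: brMp_le.
have LM k : L1 Pr (M k i' s) by exact: (L1_of_sqr (mM k i' s0) (LM2 k i' s0)).
have LbM k : L1 Pr (fun o => br r i s o * M k i' s o).
  exact: (L1M_bounded (mbr r i s) (LM k) (br_le r i s)).
pose D k o := br r i s o * M k i' s o - br r i s o * Mp i' s o.
have mD k : measurable_fun setT (D k).
  by apply: measurable_funB; [exact: L1_measurable (LbM k)|exact: L1_measurable LbMp].
have [C C0 MC] := mart_energy.
pose c2 := (r%:R * (r%:R + N%:R)) ^+ 2 : R.
have Dle k o : D k o ^+ 2 <= 2 * (r%:R ^+ 2 * M k i' s o ^+ 2) + 2 * c2.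
  have h1 : (br r i s o * M k i' s o) ^+ 2 <= r%:R ^+ 2 * M k i' s o ^+ 2.
    rewrite exprMn; apply: ler_wpM2r; first exact: sqr_ge0.
    by rewrite -(real_normK (num_real _)) lerXn2r ?nnegrE// br_le.
  have h2 : (br r i s o * Mp i' s o) ^+ 2 <= c2.
    by rewrite -(real_normK (num_real _)) lerXn2r ?nnegrE ?brMp_le// mulr_ge0// addr_ge0.
  have := sqr_ge0 (br r i s o * M k i' s o + br r i s o * Mp i' s o).
  by rewrite /D; move: h1 h2; lra.
have LR k : L1 Pr (fun o => 2 * (r%:R ^+ 2 * M k i' s o ^+ 2) + 2 * c2).
  by apply: L1D; [apply: L1Zl; apply: L1Zl; exact: LM2|exact: L1_cst].
have LD k : L1 Pr (fun o => D k o ^+ 2).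
  apply: (L1_le _ _ (LR k)); first exact: measurable_funX.
  by move=> o; rewrite ger0_norm ?sqr_ge0.
have D0 : (fun k => \int[Pr]_o D k o) @ \oo --> (0 : R).
  apply: (@mean_cvg0 _ _ _ _ _ (2 * (r%:R ^+ 2 * C) + 2 * c2)) => // [k|].
    apply: le_trans (Rint_le (LD k) (LR k) (Dle k)) _.
    have L2 := LM2 k i' s0; have L3 := L1Zl (r%:R ^+ 2) L2.
    rewrite (RintD (L1Zl 2 L3) (L1_cst _ _)) (RintZ 2 L3) (RintZ _ L2).
    rewrite Rintegral_prob_cst lerD2r; apply: ler_wpM2l => //.
    by apply: ler_wpM2l; [exact: sqr_ge0|exact: MC].
  have r1 : 1 <= r%:R ^+ 2 + 1 :> R by rewrite lerDr sqr_ge0.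
  have nz k : nnmeas (fun o => (chi s o * (M k i' s o - Mp i' s o) ^+ 2)%:E).
    split=> [|o]; last by rewrite lee_fin mulr_ge0// sqr_ge0.
    apply/measurable_EFinP; apply: measurable_funM; first exact: jmeas1.
    by apply: measurable_funX; apply: measurable_funB => //; exact: mM.
  have := cvp0_scale r1 nz (mart_cvg i' st); apply: cvp0_le.
  - move=> k; split=> [|o]; last by rewrite lee_fin sqr_ge0.
    by apply/measurable_EFinP; exact: measurable_funX.
  - move=> k; split=> [|o]; first by apply: measurable_funeM; exact: (nz k).1.
    by apply: mule_ge0; [rewrite lee_fin addr_ge0// sqr_ge0|exact: (nz k).2].
  move=> k; apply: aeW => o; rewrite -EFinM lee_fin /D -mulrBr exprMn.
  rewrite [leRHS]mulrA; apply: ler_wpM2r; first exact: sqr_ge0.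
  have := br_le r i s o; have [c|c] := chi01 s o.
    by move=> _; rewrite /br /bt c mul0r mulr0 expr0n/= mulr0.
  move=> brl; rewrite c mulr1; apply: le_trans (_ : r%:R ^+ 2 <= _).
    by rewrite -(real_normK (num_real _)) lerXn2r ?nnegrE.
  by rewrite lerDl.
have -> : (fun k => \int[Pr]_o (br r i s o * M k i' s o)) =
    (fun k => \int[Pr]_o D k o + \int[Pr]_o (br r i s o * Mp i' s o)).
  by apply/funext => k; rewrite (RintB (LbM k) LbMp) subrK.
by rewrite -[X in _ --> X]add0r; apply: cvgD => //; exact: cvg_cst.
Qed.

Let Ar_t r i o : Ar r i t o = \int[lebT t]_u br r i u o.
Proof. by rewrite /Ar runint_lebT//; exact: (jmeas2 o (jbr r i)). Qed.

Let tt : 0 <= t <= t. Proof. by rewrite t0 lexx. Qed.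

Let Fbr r i s : 0 <= s <= t -> meas_wrt (F s) (br r i s).
Proof.
move=> st; have /andP[s0 _] := st; have sF := filtration_sigma uF s0.
have Fn (f : measurableTypeR R -> Omega -> R) : meas_wrt (F s) (f s) ->
    meas_wrt (F s) (fun o => `|f s o|).
  move=> Ff; exact: (meas_wrt_comp sF (h := fun x => `|x|) (@normr_measurable R setT) Ff).
apply: (meas_wrtM sF).
  apply: (meas_wrt_comp sF (X := fun o => \sum_i (`|b i s o| + `|X i s o|))
    (h := fun x => (x <= r%:R)%R%:R)).
    exact: measurable_le_cst.
  apply: (meas_wrt_sum sF) => i'; apply: (meas_wrtD sF).
    by apply: (Fn (b i')); exact: Fb.
  by apply: (Fn (X i')); exact: FX.
apply: (meas_wrtM sF); last exact: Fb.
have -> : chi s = \1_[set o | B s o] :> (Omega -> R).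
  by apply/funext => o; rewrite indicE mem_setE.
exact: (meas_wrt_indic sF (FB st)).
Qed.

Let LMt k i : L1 Pr (M k i t). Proof. exact: (L1_of_sqr (mM k i t0) (LM2 k i t0)). Qed.

Let LbrMp r i i' : L1prod (lebT t) Pr (fun u o => br r i u o * Mp i' u o).
Proof.
apply: (@L1prod_bounded _ _ _ _ _ _ _ _ (r%:R * (r%:R + N%:R))); first exact: jmeasM.
by move=> u o; exact: brMp_le.
Qed.

(** By the martingale property, the drift at time [s] may be integrated against the
    martingale at time [s] instead of [t]. It has a limit for each [s], and the
    integral over [s] converges by dominated convergence. *)
Lemma cut_drift_part_mart_cvg r i i' :
  (fun k => \int[Pr]_o (Ar r i t o * M k i' t o)) @ \oo -->
  Pint (lebT t) Pr (fun u o => br r i u o * Mp i' u o).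
Proof.
have [C C0 MC] := mart_energy.
have LbM k : L1prod (lebT t) Pr (fun u o => br r i u o * M k i' t o).
  have Lg : L1 Pr (fun o => r%:R * `|M k i' t o|) by apply: L1Zl; exact: L1_abs.
  apply: (L1prod_le _ _ (L1prod_snd (lebT t) Lg)).
    apply: measurable_funM; first exact: jbr.
    exact: (measurableT_comp (mM k i' t0) measurable_snd).
  by move=> u o; rewrite normrM ler_wpM2r.
have E k : \int[Pr]_o (Ar r i t o * M k i' t o) =
    \int[lebT t]_u \int[Pr]_o (br r i u o * M k i' t o).
  rewrite (RFubini (LbM k)); apply: eq_Rintegral => o _; rewrite Ar_t RintegralZr//.
  apply: (@L1_bounded _ _ _ _ _ r%:R); first exact: (jmeas2 o (jbr r i)).
  by move=> u; exact: br_le.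
under eq_fun do rewrite E.
rewrite -PintE1//.
apply: (@Rdominated_cvg _ _ _ _ _ _ (fun=> r%:R * (1 + C))).
- by move=> k; exact: L1_measurable (L1prod_inner1 (LbM k)).
- exact: L1_measurable (L1prod_inner1 (LbrMp r i i')).
- apply: ae_lebT_imp => s st; have /andP[s0 ts] := st.
  rewrite (_ : (fun k => _) = (fun k => \int[Pr]_o (br r i s o * M k i' s o))).
    exact: cut_drift_mart_cvg.
  apply/funext => k.
  have LZ s' j : 0 <= s' -> L1 Pr (fun o => br r i s o * spI w j (Hs i' j k) s' o).
    move=> s'0; apply: (L1M_bounded (mbr r i s) _ (br_le r i s)).
    by apply: L1_of_sqr; [exact: (spI_measurable uF W)|exact: (spI_L2 uF W)].
  rewrite /M; under eq_Rintegral do rewrite mulr_sumr.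
  under [RHS]eq_Rintegral do rewrite mulr_sumr.
  rewrite Rint_sum; last by move=> j; exact: LZ.
  rewrite Rint_sum; last by move=> j; exact: LZ.
  apply: eq_bigr => j _.
  exact: (sp_martingale uF W (Hs i' j k) j s0 ts (Fbr r i st) (br_le r i s)).
- move=> k s; have LbMs : L1 Pr (fun o => br r i s o * M k i' t o).
    exact: (L1M_bounded (mbr r i s) (LMt k i') (br_le r i s)).
  apply: le_trans (Rint_abs LbMs) _.
  have L2 := LM2 k i' t0.
  apply: (@le_trans _ _ (\int[Pr]_o (r%:R * (1 + M k i' t o ^+ 2)))).
    apply: Rint_le; first exact: L1_abs.
      by apply: L1Zl; apply: L1D => //; exact: L1_cst.
    move=> o; rewrite normrM; apply: ler_pM => //.
    have := sqr_ge0 (`|M k i' t o| - 1); rewrite -[in X in _ -> X](real_normK (num_real _)).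
    by have := normr_ge0 (M k i' t o); nra.
  rewrite (RintZ _ (L1D (L1_cst Pr 1) L2)); apply: ler_wpM2l => //.
  by rewrite (RintD (L1_cst Pr 1) L2) Rintegral_prob_cst lerD2l; exact: MC.
exact: L1_cst.
Qed.

Let jspv i j k : jmeas (sp_val (Hs i j k) : measurableTypeR R -> Omega -> R).
Proof. exact: (sp_val_measurable uF). Qed.

Let stopped_diffusion i j (u : measurableTypeR R) (o : Omega) : R := chi u o * h i j u o.

Let jch i j : jmeas (stopped_diffusion i j). Proof. exact: jmeasM. Qed.

Let Lch2 i j : L1prod (lebT t) Pr (fun u o => stopped_diffusion i j u o ^+ 2).
Proof.
apply: L1prod_ge0 => [|u o|]; [exact: jmeas_sqr|exact: sqr_ge0|].
apply: le_lt_trans (ltry N%:R); rewrite -(integral_prob_cst Pr N%:R%:E).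
apply: ge0_le_integral => //.
- by move=> o _; apply: integral_ge0 => u _; rewrite lee_fin sqr_ge0.
- exact: (nnmeas_timeint _ (jmeas_sqr (jch i j)) (fun _ _ => sqr_ge0 _)).1.
move=> o _; apply: le_trans (chih i j o).
by under eq_integral do rewrite /stopped_diffusion exprMn chiS.
Qed.

Let diffusion_cvg i j : (fun k => Pint (lebT t) Pr (fun u o =>
  (sp_val (Hs i j k) u o - stopped_diffusion i j u o) ^+ 2)) @ \oo --> (0 : R).
Proof.
have H : (fun k => fine (\int[Pr]_o spcost t B (h i j) (Hs i j k) o)%E) @ \oo --> (0 : R).
  exact: fine_cvg (Hcost i j).
rewrite (_ : (fun k => Pint _ _ _) =
  (fun k => fine (\int[Pr]_o spcost t B (h i j) (Hs i j k) o)%E))//.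
apply/funext => k; apply: Pint_tonelli => [|u o]; last exact: sqr_ge0.
by apply: jmeas_sqr; apply: jmeasB.
Qed.

(** The isometry and the convergence of the integrands in [L^2]. *)
Lemma mart_cov_cvg i i' :
  (fun k => \int[Pr]_o (M k i t o * M k i' t o)) @ \oo -->
  \sum_j \sum_j' K j j' *
    Pint (lebT t) Pr (fun u o => chi u o * (h i j u o * h i' j' u o)).
Proof.
have E k : \int[Pr]_o (M k i t o * M k i' t o) = \sum_j \sum_j' K j j' *
    Pint (lebT t) Pr (fun u o => sp_val (Hs i j k) u o * sp_val (Hs i' j' k) u o).
  have LI a j := spI_L2 uF W j (Hs a j k) t0.
  have mI a j := spI_measurable uF W j (Hs a j k) t0.
  have Lp j j' := L1_sqr_prod (mI i j) (mI i' j') (LI i j) (LI i' j').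
  under eq_Rintegral do rewrite /M mulr_suml.
  rewrite Rint_sum; last first.
    move=> j; under eq_fun do rewrite mulr_sumr.
    by apply: L1_sum => j'; exact: Lp.
  apply: eq_bigr => j _; under eq_Rintegral do rewrite mulr_sumr.
  rewrite Rint_sum; last by move=> j'; exact: Lp.
  apply: eq_bigr => j' _; rewrite (sp_cov uF W _ _ _ _ t0) PintE2//.
  exact: sp_val_prod_L1.
under eq_fun do rewrite E.
apply: real_cvg_sum => j; apply: real_cvg_sum => j'; apply: cvgMr.
have -> : Pint (lebT t) Pr (fun u o => chi u o * (h i j u o * h i' j' u o)) =
    Pint (lebT t) Pr (fun u o => stopped_diffusion i j u o * stopped_diffusion i' j' u o).
  by congr Pint; apply/funext => u; apply/funext => o;
    rewrite /stopped_diffusion -{1}chiS; ring.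
have L2 a a' k : L1 (lebT t \x Pr)%E (fun z => sp_val (Hs a a' k) z.1 z.2 ^+ 2).
  by have := sp_val_prod_L1 (Pr := Pr) uF (Hs a a' k) (Hs a a' k) t.
apply: (@L2_product_cvg _ _ _ (lebT t \x Pr)%E
  (fun k z => sp_val (Hs i j k) z.1 z.2) (fun k z => sp_val (Hs i' j' k) z.1 z.2)
  (fun z => stopped_diffusion i j z.1 z.2) (fun z => stopped_diffusion i' j' z.1 z.2)).
- by move=> k; exact: jspv.
- by move=> k; exact: jspv.
- exact: jch.
- exact: jch.
- by move=> k; exact: L2.
- by move=> k; exact: L2.
- exact: Lch2.
- exact: Lch2.
- exact: diffusion_cvg.
- exact: diffusion_cvg.
Qed.

Variable S : 'M[R]_n.
Hypothesis psdS : psd S.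

Let kap i i' : R := \sum_j \sum_j' K j j' *
  Pint (lebT t) Pr (fun u o => chi u o * (h i j u o * h i' j' u o)).

Let Lbb r i i' : L1prod (lebT t) Pr (fun u o => br r i u o * Ar r i' u o).
Proof.
apply: (@L1prod_bounded _ _ _ _ _ _ _ _ (r%:R * N%:R)); first exact: jmeasM.
by move=> u o; rewrite normrM ler_pM.
Qed.

(** The mean that Ito's formula predicts for the form of the drift part with the
    cut drift plus the stopped martingale part. *)
Definition cut_energy r : R := \sum_i \sum_i' S i i' *
  (Pint (lebT t) Pr (fun u o => br r i u o * (Ar r i' u o + Mp i' u o)) +
   Pint (lebT t) Pr (fun u o => br r i' u o * (Ar r i u o + Mp i u o)) + kap i i').

Let PD (f g : measurableTypeR R -> Omega -> R) : L1prod (lebT t) Pr f ->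
  L1prod (lebT t) Pr g ->
  Pint (lebT t) Pr (fun u o => f u o + g u o) = Pint (lebT t) Pr f + Pint (lebT t) Pr g.
Proof. by move=> Lf Lg; rewrite /Pint RintD. Qed.

(** The form is expanded into products of drift and martingale parts; the products of
    two drift parts are integrated by parts, and each of the others converges by the
    lemmas above. *)
Lemma cut_energy_cvg r :
  (fun k => \int[Pr]_o qform S (fun i => Ar r i t o + M k i t o)) @ \oo --> cut_energy r.
Proof.
have mA i : measurable_fun setT (Ar r i t) by exact: (jmeas1 t (jAr r i)).
have LAA i i' : L1 Pr (fun o => Ar r i t o * Ar r i' t o).
  apply: (@L1_bounded _ _ _ _ _ (N%:R * N%:R)); first exact: measurable_funM.
  by move=> o; rewrite normrM ler_pM.
have LAM k i i' : L1 Pr (fun o => Ar r i t o * M k i' t o).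
  exact: (L1M_bounded (mA i) (LMt k i') (Ar_le r i t)).
have LMM k i i' : L1 Pr (fun o => M k i t o * M k i' t o).
  exact: (L1_sqr_prod (mM k i t0) (mM k i' t0) (LM2 k i t0) (LM2 k i' t0)).
have EAA i i' : \int[Pr]_o (Ar r i t o * Ar r i' t o) =
    Pint (lebT t) Pr (fun u o => br r i u o * Ar r i' u o) +
    Pint (lebT t) Pr (fun u o => br r i' u o * Ar r i u o).
  rewrite -PD// -PintE2; last by apply: L1D; exact: Lbb.
  apply: eq_Rintegral => o _; rewrite !Ar_t (@runint_by_parts _ t r%:R).
  - by apply: eq_Rintegral => u _; rewrite /Ar; ring.
  - exact: (jmeas2 o (jbr r i)).
  - exact: (jmeas2 o (jbr r i')).
  - by move=> u; exact: br_le.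
  - by move=> u; exact: br_le.
have E k : \int[Pr]_o qform S (fun i => Ar r i t o + M k i t o) =
    \sum_i \sum_i' S i i' * (\int[Pr]_o (Ar r i t o * Ar r i' t o) +
      \int[Pr]_o (Ar r i t o * M k i' t o) + \int[Pr]_o (Ar r i' t o * M k i t o) +
      \int[Pr]_o (M k i t o * M k i' t o)).
  have L4 i i' : L1 Pr (fun o => Ar r i t o * Ar r i' t o + Ar r i t o * M k i' t o +
      Ar r i' t o * M k i t o + M k i t o * M k i' t o).
    by apply: L1D => //; apply: L1D => //; exact: L1D.
  have Eq o : qform S (fun i => Ar r i t o + M k i t o) = \sum_i \sum_i' S i i' *
      (Ar r i t o * Ar r i' t o + Ar r i t o * M k i' t o +
       Ar r i' t o * M k i t o + M k i t o * M k i' t o).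
    by apply: eq_bigr => i _; apply: eq_bigr => i' _; congr (_ * _); ring.
  under eq_Rintegral do rewrite Eq.
  rewrite Rint_sum; last by move=> i; apply: L1_sum => i'; exact: (L1Zl _ (L4 i i')).
  apply: eq_bigr => i _; rewrite Rint_sum; last by move=> i'; exact: (L1Zl _ (L4 i i')).
  apply: eq_bigr => i' _; rewrite (RintZ _ (L4 i i')); congr (_ * _).
  by rewrite RintD//; [rewrite RintD//; [rewrite RintD|exact: L1D]|apply: L1D => //; exact: L1D].
under eq_fun do rewrite E.
rewrite /cut_energy; apply: real_cvg_sum => i; apply: real_cvg_sum => i'; apply: cvgMr.
have -> : Pint (lebT t) Pr (fun u o => br r i u o * (Ar r i' u o + Mp i' u o)) +
    Pint (lebT t) Pr (fun u o => br r i' u o * (Ar r i u o + Mp i u o)) + kap i i' =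
  \int[Pr]_o (Ar r i t o * Ar r i' t o) +
  Pint (lebT t) Pr (fun u o => br r i u o * Mp i' u o) +
  Pint (lebT t) Pr (fun u o => br r i' u o * Mp i u o) + kap i i'.
  rewrite EAA; have P a a' : Pint (lebT t) Pr (fun u o => br r a u o * (Ar r a' u o + Mp a' u o)) =
      Pint (lebT t) Pr (fun u o => br r a u o * Ar r a' u o) +
      Pint (lebT t) Pr (fun u o => br r a u o * Mp a' u o).
    rewrite -PD//; congr Pint; apply/funext => u; apply/funext => o.
    by rewrite mulrDr.
  by rewrite !P addrACA !addrA.
apply: cvgD; last exact: mart_cov_cvg.
apply: cvgD; last exact: cut_drift_part_mart_cvg.
by apply: cvgD; [exact: cvg_cst|exact: cut_drift_part_mart_cvg].
Qed.

(** Fatou's lemma as the approximations of the stopped diffusion converge. *)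
Lemma cut_energy_bound r :
  (\int[Pr]_o (qform S (fun i => chi t o * (Ar r i t o + Mp i t o)))%:E <=
   (cut_energy r)%:E)%E.
Proof.
have mA i : measurable_fun setT (Ar r i t) by exact: (jmeas1 t (jAr r i)).
have mY k i : measurable_fun setT (fun o => Ar r i t o + M k i t o).
  by apply: measurable_funD => //; exact: mM.
apply: (@fatou_prob _ _ _ _ _ _ psdS _ (fun k i o => chi t o * (Ar r i t o + M k i t o))
  (fun k => \int[Pr]_o qform S (fun i => Ar r i t o + M k i t o))).
- move=> i; apply: measurable_funM; first exact: jmeas1.
  by apply: measurable_funD => //; exact: (jmeas1 t (jMp i)).
- by move=> k i; apply: measurable_funM; [exact: jmeas1|exact: mY].
- have nz i k : nnmeas (fun o => (chi t o * (M k i t o - Mp i t o) ^+ 2)%:E).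
    split=> [|o]; last by rewrite lee_fin mulr_ge0// sqr_ge0.
    apply/measurable_EFinP; apply: measurable_funM; first exact: jmeas1.
    by apply: measurable_funX; apply: measurable_funB; [exact: mM|exact: (jmeas1 t (jMp i))].
  have := cvp0_sum (index_enum _) nz (fun i => mart_cvg i tt).
  rewrite (_ : (fun k o => \sum_(i <- index_enum _) _)%E = (fun k o => (\sum_i
    (chi t o * (Ar r i t o + Mp i t o) - chi t o * (Ar r i t o + M k i t o)) ^+ 2)%:E))//.
  apply/funext => k; apply/funext => o; rewrite sumEFin; congr EFin.
  by apply: eq_bigr => i _; rewrite -mulrBr exprMn chiS; congr (_ * _); ring.
- move=> k.
  have V0 o : 0 <= qform S (fun i => Ar r i t o + M k i t o) by exact: qform_ge0.
  have mV := qform_measurable S (mY k).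
  have LV : L1 Pr (fun o => qform S (fun i => Ar r i t o + M k i t o)).
    have Lsq : L1 Pr (fun o => mxnorm1 S * \sum_i (Ar r i t o + M k i t o) ^+ 2).
      apply: L1Zl; apply: L1_sum => i; apply: L1_sqrD => //; [exact: mM| |exact: LM2].
      apply: (@L1_bounded _ _ _ _ _ (N%:R * N%:R)); first exact: measurable_funX.
      by move=> o; rewrite normrX expr2 ler_pM.
    by apply: (L1_le mV _ Lsq) => o; rewrite ger0_norm//; exact: qform_le.
  rewrite L1E//; apply: ge0_le_integral => //.
  + by move=> o _; rewrite lee_fin; exact: qform_ge0.
  + apply/measurable_EFinP; apply: qform_measurable => i.
    by apply: measurable_funM; [exact: jmeas1|exact: mY].
  + exact/measurable_EFinP.
  move=> o _; rewrite lee_fin.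
  have [c|c] := chi01 t o; last by rewrite /qform; under eq_bigr do
    under eq_bigr do rewrite c !mul1r.
  rewrite /qform big1 => [|i _]; first exact: V0.
  by rewrite big1// => i' _; rewrite c !mul0r mulr0.
- exact: cut_energy_cvg.
Qed.

End Approximants.

Let drift_weight i i' (u : measurableTypeR R) (o : Omega) : R :=
  chi u o * (`|b i u o| * (1 + `|X i' u o|)).

Let drift_weight_ge0 i i' u o : 0 <= drift_weight i i' u o.
Proof. by rewrite /drift_weight !mulr_ge0// addr_ge0. Qed.

Let Lweight i i' : L1prod (lebT t) Pr (drift_weight i i').
Proof.
have jw : jmeas (drift_weight i i').
  apply: jmeasM => //; apply: measurable_funM; first exact: measurableT_comp (jb i).
  by apply: measurable_funD => //; exact: measurableT_comp (jX i').
apply: L1prod_ge0 => //.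
apply: le_lt_trans (ltry N%:R); rewrite -(integral_prob_cst Pr N%:R%:E).
apply: ge0_le_integral => //.
- by move=> o _; apply: integral_ge0 => u _; rewrite lee_fin.
- exact: (nnmeas_timeint _ jw (drift_weight_ge0 i i')).1.
by move=> o _; exact: bX.
Qed.

Let cut_eventually u o : \forall r \near \oo, size_cut r u o = 1.
Proof.
near=> r; rewrite /size_cut; set x := \sum_i _.
have -> // : x <= r%:R = true.
apply: ltW; apply: lt_le_trans (truncnS_gt x) _.
by rewrite ler_nat; near: r; exists (Num.truncn x).+1.
Unshelve. all: by end_near. Qed.

Let br_cvg i u o : (fun r => br r i u o) @ \oo --> bt i u o.
Proof.
apply: cvg_near_cst; near=> r; rewrite /br.
suff -> : size_cut r u o = 1 by rewrite mul1r.
by near: r; exact: cut_eventually.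
Unshelve. all: by end_near. Qed.

Let Ar_cvg i s o : (fun r => Ar r i s o) @ \oo --> Ab i s o.
Proof.
apply: (@Rdominated_cvg _ _ _ (lebT t) (fun r u => (u <= s)%R%:R * br r i u o)
  (fun u => (u <= s)%R%:R * bt i u o) (fun u => `|bt i u o|)).
- move=> r; apply: measurable_funM; first exact: measurable_le_cst.
  exact: (jmeas2 o (jbr r i)).
- apply: measurable_funM; first exact: measurable_le_cst.
  exact: (jmeas2 o (jbt i)).
- by apply: aeW => u; apply: cvgMr; exact: br_cvg.
- by move=> r u; exact: le_trans (bool_mul_norm _ _) (br_bt r i u o).
- exact: (Lbt i o).1.
Qed.

Let chi_prod_L1 f g C : jmeas f -> jmeas g ->
  (forall o, (\int[lebT t]_u (chi u o * f u o ^+ 2)%:E <= C%:E)%E) ->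
  (forall o, (\int[lebT t]_u (chi u o * g u o ^+ 2)%:E <= C%:E)%E) ->
  L1prod (lebT t) Pr (fun u o => chi u o * (f u o * g u o)).
Proof.
move=> jf jg fC gC.
have L2 (f' : measurableTypeR R -> Omega -> R) : jmeas f' ->
    (forall o, (\int[lebT t]_u (chi u o * f' u o ^+ 2)%:E <= C%:E)%E) ->
    L1 (lebT t \x Pr)%E (fun z => (chi z.1 z.2 * f' z.1 z.2) ^+ 2).
  move=> jf' f'C.
  have j2 : jmeas (fun u o => (chi u o * f' u o) ^+ 2) by apply: jmeas_sqr; exact: jmeasM.
  apply: (L1prod_ge0 j2) => [u o|]; first exact: sqr_ge0.
  apply: le_lt_trans (ltry C); rewrite -(integral_prob_cst Pr C%:E).
  apply: ge0_le_integral => //.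
  - by move=> o _; apply: integral_ge0 => u _; rewrite lee_fin sqr_ge0.
  - exact: (nnmeas_timeint _ j2 (fun _ _ => sqr_ge0 _)).1.
  by move=> o _; apply: le_trans (f'C o); under eq_integral do rewrite exprMn chiS.
have := L1_sqr_prod (jmeasM jchi jf) (jmeasM jchi jg) (L2 f jf fC) (L2 g jg gC).
rewrite /L1prod /L1; apply: eq_integrable => // z _ /=; congr EFin.
by rewrite -[in RHS]chiS; ring.
Qed.

Variable S : 'M[R]_n.
Hypothesis psdS : psd S.

(** The drift which Ito's formula gives to the quadratic form of [X]. *)
Definition energy_rate (u : measurableTypeR R) (o : Omega) : R :=
  \sum_i \sum_i' S i i' * (b i u o * X i' u o + b i' u o * X i u o +
    \sum_j \sum_j' K j j' * (h i j u o * h i' j' u o)).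

(** Fatou's lemma once more, as the size of the cut-off tends to infinity: the cut
    drift part then converges to the drift part on every path, and dominated
    convergence applies to the right-hand side because the drift and its product
    with [X] have integrals at most [N] until the stopping. *)
Lemma energy_inequality :
  L1prod (lebT t) Pr (fun u o => chi u o * energy_rate u o) /\
  (\int[Pr]_o (chi t o * qform S (fun i => X i t o))%:E <=
   (Pint (lebT t) Pr (fun u o => chi u o * energy_rate u o))%:E)%E.
Proof.
have LbX i i' : L1prod (lebT t) Pr (fun u o => bt i u o * X i' u o).
  apply: (L1prod_le (jmeasM (jbt i) (jX i')) _ (Lweight i i')) => u o.
  rewrite normrM bt_le /drift_weight -mulrA; apply: ler_wpM2l => //.
  by apply: ler_wpM2l => //; rewrite lerDr.
have Lhh i i' j j' : L1prod (lebT t) Pr (fun u o => chi u o * (h i j u o * h i' j' u o)).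
  by apply: (@chi_prod_L1 _ _ N%:R) => // o; exact: chih.
pose rate2 i i' (u : measurableTypeR R) (o : Omega) : R :=
  \sum_j \sum_j' K j j' * (chi u o * (h i j u o * h i' j' u o)).
have Lrate2 i i' : L1 (lebT t \x Pr)%E (fun z => rate2 i i' z.1 z.2).
  by apply: L1_sum => j; apply: L1_sum => j'; apply: L1Zl; exact: Lhh.
have Lr i i' : L1 (lebT t \x Pr)%E (fun z => bt i z.1 z.2 * X i' z.1 z.2 +
    bt i' z.1 z.2 * X i z.1 z.2 + rate2 i i' z.1 z.2).
  by apply: L1D => //; apply: L1D; exact: LbX.
have Er (z : measurableTypeR R * Omega) : chi z.1 z.2 * energy_rate z.1 z.2 =
    \sum_i \sum_i' S i i' * (bt i z.1 z.2 * X i' z.1 z.2 +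
      bt i' z.1 z.2 * X i z.1 z.2 + rate2 i i' z.1 z.2).
  rewrite mulr_sumr; apply: eq_bigr => i _; rewrite mulr_sumr.
  apply: eq_bigr => i' _; rewrite mulrCA; congr (_ * _).
  rewrite mulrDr mulrDr; congr (_ + _); first by rewrite /bt !mulrA.
  rewrite mulr_sumr; apply: eq_bigr => j _; rewrite mulr_sumr.
  by apply: eq_bigr => j' _; rewrite mulrCA.
pose c := Pint (lebT t) Pr (fun u o => chi u o * energy_rate u o).
have cE : c = \sum_i \sum_i' S i i' *
  (Pint (lebT t) Pr (fun u o => bt i u o * X i' u o) +
   Pint (lebT t) Pr (fun u o => bt i' u o * X i u o) +
   \sum_j \sum_j' K j j' *
     Pint (lebT t) Pr (fun u o => chi u o * (h i j u o * h i' j' u o))).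
  rewrite /c /Pint; under eq_Rintegral do rewrite Er.
  rewrite Rint_sum; last by move=> i; apply: L1_sum => i'; exact: L1Zl (Lr i i').
  apply: eq_bigr => i _.
  rewrite Rint_sum; last by move=> i'; exact: L1Zl (Lr i i').
  apply: eq_bigr => i' _; rewrite (RintZ _ (Lr i i')); congr (_ * _).
  rewrite RintD//; last by apply: L1D; exact: LbX.
  rewrite RintD; [|exact: LbX|exact: LbX]; congr (_ + _).
  rewrite Rint_sum; last by move=> j; apply: L1_sum => j'; exact: L1Zl (Lhh i i' j j').
  apply: eq_bigr => j _; rewrite Rint_sum; last by move=> j'; exact: L1Zl (Lhh i i' j j').
  by apply: eq_bigr => j' _; rewrite (RintZ _ (Lhh i i' j j')).
split.
  have L : L1 (lebT t \x Pr)%E (fun z => \sum_i \sum_i' S i i' *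
      (bt i z.1 z.2 * X i' z.1 z.2 + bt i' z.1 z.2 * X i z.1 z.2 + rate2 i i' z.1 z.2)).
    by apply: L1_sum => i; apply: L1_sum => i'; exact: L1Zl (Lr i i').
  by move: L; rewrite /L1prod /L1; apply: eq_integrable => // z _ /=; rewrite Er.
have Pcvg i i' : (fun r => Pint (lebT t) Pr
    (fun u o => br r i u o * (Ar r i' u o + Mp i' u o))) @ \oo -->
    Pint (lebT t) Pr (fun u o => bt i u o * X i' u o).
  apply: (@Rdominated_cvg _ _ _ (lebT t \x Pr)%E
    (fun r z => br r i z.1 z.2 * (Ar r i' z.1 z.2 + Mp i' z.1 z.2))
    (fun z => bt i z.1 z.2 * X i' z.1 z.2)
    (fun z => (1 + 2 * N%:R) * drift_weight i i' z.1 z.2)).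
  - by move=> r; exact: jmeasM (jbr r i) (jmeasD (jAr r i') (jMp i')).
  - exact: jmeasM (jbt i) (jX i').
  - apply: aeW => -[u o] /=.
    (* The cut-off is only in the drift and in its running integral, not in Mp. *)
    have -> : X i' u o = Ab i' u o + Mp i' u o by rewrite /Mp addrCA subrr addr0.
    apply: cvgM; first exact: br_cvg.
    by apply: cvgD; [exact: Ar_cvg|exact: cvg_cst].
  - move=> r [u o] /=.
    rewrite normrM; apply: le_trans (ler_wpM2r (normr_ge0 _) (br_bt r i u o)) _.
    rewrite bt_le /drift_weight -mulrA [leRHS]mulrCA; apply: ler_wpM2l => //.
    rewrite [leRHS]mulrCA; apply: ler_wpM2l => //.
    have h1 := Ar_le r i' u o; have h2 := Ab_le i' u o.
    rewrite /Mp addrA; apply: le_trans (ler_normB _ _) _.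
    apply: le_trans (lerD (ler_normD _ _) (lexx _)) _.
    have n0 : 0 <= N%:R :> R by []; have x0 := normr_ge0 (X i' u o).
    by have := mulr_ge0 n0 x0; move: h1 h2; lra.
  - by apply: L1Zl; exact: Lweight.
have Ccvg : cut_energy S @ \oo --> c.
  rewrite cE /cut_energy; apply: real_cvg_sum => i; apply: real_cvg_sum => i'.
  apply: cvgMr; apply: cvgD; last exact: cvg_cst.
  by apply: cvgD; exact: Pcvg.
have [Hs HP] := approximants.
have bound r := cut_energy_bound (fun i j => (HP i j).1) (fun i j => (HP i j).2) psdS r.
have -> : (\int[Pr]_o (chi t o * qform S (fun i => X i t o))%:E)%E =
    (\int[Pr]_o (qform S (fun i => chi t o * X i t o)%R)%:E)%E.
  apply: eq_integral => o _; congr EFin; rewrite /qform mulr_sumr.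
  apply: eq_bigr => i _; rewrite mulr_sumr; apply: eq_bigr => i' _.
  by rewrite -[in LHS]chiS; ring.
have mchi : measurable_fun setT (chi t) by exact: jmeas1.
have mX i : measurable_fun setT (fun o => chi t o * X i t o).
  by apply: measurable_funM => //; exact: (jmeas1 t (jX i)).
have mY r i : measurable_fun setT (fun o => chi t o * (Ar r i t o + Mp i t o)).
  apply: measurable_funM => //; apply: measurable_funD.
    exact: (jmeas1 t (jAr r i)).
  exact: (jmeas1 t (jMp i)).
apply: (fatou_prob psdS mX mY _ bound Ccvg).
have E r o i : chi t o * X i t o - chi t o * (Ar r i t o + Mp i t o) =
    chi t o * (Ab i t o - Ar r i t o) by rewrite /Mp; ring.
apply: cvp0_ae.
  move=> r; split=> [|o]; last by rewrite lee_fin sumr_ge0// => i _; exact: sqr_ge0.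
  apply/measurable_EFinP; apply: measurable_sum => i; apply: measurable_funX.
  exact: measurable_funB.
apply: aeW => o.
suff cvR : (fun r => \sum_i (chi t o * X i t o - chi t o * (Ar r i t o + Mp i t o)) ^+ 2)
    @ \oo --> (0 : R) by exact: cvg_comp cvR _.
have cvi i : (fun r => (chi t o * X i t o - chi t o * (Ar r i t o + Mp i t o)) ^+ 2)
    @ \oo --> (0 : R).
  under eq_fun do rewrite E.
  have cv : (fun r => chi t o * (Ab i t o - Ar r i t o)) @ \oo -->
      chi t o * (Ab i t o - Ab i t o).
    by apply: cvgMr; apply: cvgB; [exact: cvg_cst|exact: Ar_cvg].
  rewrite subrr mulr0 in cv.
  have c2 := cvgM cv cv; rewrite mulr0 in c2.
  by under eq_fun do rewrite expr2; exact: c2.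
have := real_cvg_sum (r := index_enum 'I_n) cvi.
by rewrite big1.
Qed.

End Energy.

(** * Borel coefficients *)
Section BorelComposition.
Context (R : realType) d (T : measurableType d).

(** An open set is the union of the cells with rational centre that it contains,
    and these are countably many finite intersections of strips. *)
Lemma preimage_open_measurable n (Y : T -> 'cV[R]_n) (O : set 'cV[R]_n) : open O ->
  (forall i, measurable_fun setT (fun z => Y z i 0)) -> measurable (Y @^-1` O).
Proof.
move=> oO mY.
pose cell (cr : 'cV[rat]_n * nat) : set 'cV[R]_n :=
  [set y | forall i, `|y i 0 - ratr (cr.1 i 0)| < cr.2.+1%:R^-1].
have -> : Y @^-1` O = \bigcup_(cr in setT)
    (if `[< cell cr `<=` O >] then Y @^-1` cell cr else set0).
  apply/seteqP; split => z /=; last first.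
    by move=> [cr _]; case: asboolP => // sub; exact: sub.
  move=> Oz; have /nbhs_ballP[e /= e0 eO] := open_nbhs_nbhs (conj oO Oz).
  pose r := Num.truncn (2 / e).
  have r0 : 0 < r.+1%:R^-1 :> R by rewrite invr_gt0.
  have re : r.+1%:R^-1 + r.+1%:R^-1 < e.
    have : 2 / e < r.+1%:R by exact: truncnS_gt.
    rewrite ltr_pdivrMr// => h; rewrite -mulr2n -[_ *+ 2]mulr_natl.
    by rewrite ltr_pdivrMr// mulrC.
  have ex (i : 'I_n) : exists c : rat, `|Y z i 0 - ratr c| < r.+1%:R^-1.
    have lt : Y z i 0 - r.+1%:R^-1 < Y z i 0 + r.+1%:R^-1 by rewrite ltrD2l gtrN.
    have [c] := rat_in_itvoo lt; rewrite in_itv/= => /andP[c1 c2].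
    exists c; rewrite ltr_norml; move: c1 c2.
    move: (ratr c : R) (r.+1%:R^-1 : R) => a e1 c1 c2; by apply/andP; split; lra.
  have [c cP] := choice ex.
  exists (\col_i c i, r) => //; case: asboolP => /= [_|].
    by move=> i; rewrite mxE.
  case=> y /= yc; apply: eO; split => // i j; rewrite ord1 /ball/=.
  have h1 := yc i; have h2 := cP i; rewrite mxE in h1.
  have -> : Y z i 0 - y i 0 = (Y z i 0 - ratr (c i)) - (y i 0 - ratr (c i)) by ring.
  by apply: le_lt_trans (ler_normB _ _) _; apply: lt_trans re; exact: ltrD.
apply: countable_bigcupT_measurable; first exact: countableP.
move=> cr; case: asboolP => // _.
have -> : Y @^-1` cell cr = \bigcap_(i in [set: 'I_n])
    [set z | `|Y z i 0 - ratr (cr.1 i 0)| < cr.2.+1%:R^-1].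
  by apply/seteqP; split => z /= h i; [move=> _|]; exact: h.
apply: fin_bigcap_measurable => // i _.
rewrite -[X in measurable X]setTI.
have -> : [set z | `|Y z i 0 - ratr (cr.1 i 0)| < cr.2.+1%:R^-1] =
  (fun z => `|Y z i 0 - ratr (cr.1 i 0)|) @^-1` [set` `]-oo, (cr.2.+1%:R^-1 : R)[].
  by apply/seteqP; split => z /=; rewrite in_itv.
have mf : measurable_fun setT (fun z => `|Y z i 0 - ratr (cr.1 i 0)|).
  by apply: measurableT_comp => //; exact: measurable_funB.
by apply: mf => //; exact: measurable_itv.
Qed.

Lemma borel_comp n k (f : 'cV[R]_n -> 'cV[R]_k) (Y : T -> 'cV[R]_n) : borel_map f ->
  (forall i, measurable_fun setT (fun z => Y z i 0)) ->
  forall i, measurable_fun setT (fun z => f (Y z) i 0).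
Proof.
move=> bf mY i _ C mC; rewrite setTI.
have sub : <<s [set O : set 'cV[R]_n | open O] >> `<=`
    [set A | measurable (Y @^-1` A)].
  apply: smallest_sub => [|O oO]; last exact: preimage_open_measurable.
  split => /=.
  - by rewrite preimage_set0.
  - by move=> A mA; rewrite setTD preimage_setC; exact: measurableC.
  - by move=> A mA; rewrite preimage_bigcup; exact: bigcupT_measurable.
exact: sub (bf i C mC).
Qed.

End BorelComposition.

(** * The inequality of Gronwall *)
Section Gronwall.
Context (R : realType).
Variables (T a C : R) (kappa y : R -> R).
Hypothesis T0 : 0 <= T.
Hypothesis mk : measurable_fun setT kappa.
Hypothesis my : measurable_fun setT y.
Hypothesis k0 : forall s, 0 <= kappa s.
Hypothesis y0 : forall s, 0 <= y s.
Hypothesis yC : forall s, y s <= C.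
Hypothesis Lk : L1 (lebT T) kappa.

Let Phi s := a + runint T (fun u => kappa u * y u) s.
Let I s := runint T kappa s.

Hypothesis yPhi : forall s, 0 <= s <= T -> y s <= a + runint T (fun u => kappa u * y u) s.

Let Lky : L1 (lebT T) (fun u => kappa u * y u).
Proof.
apply: (L1_le _ _ (L1Zl C Lk)); first exact: measurable_funM.
by move=> s; rewrite normrM !ger0_norm// mulrC; exact: ler_wpM2r.
Qed.

Let Lrun (f : R -> R) s : L1 (lebT T) f -> L1 (lebT T) (fun u => (u <= s)%R%:R * f u).
Proof.
move=> Lf; apply: (L1_le _ _ (L1_abs Lf)).
  by apply: measurable_funM; [exact: measurable_le_cst|exact: L1_measurable Lf].
by move=> u; exact: bool_mul_norm.
Qed.

Let run_diff (f : R -> R) s s' : L1 (lebT T) f ->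
  runint T f s' - runint T f s =
  \int[lebT T]_u ((u <= s')%R%:R * f u - (u <= s)%R%:R * f u).
Proof. by move=> Lf; rewrite /runint RintB//; exact: Lrun. Qed.

Let Phi_mono s s' : s <= s' -> Phi s <= Phi s'.
Proof.
move=> ss; rewrite lerD2l; apply: Rint_le => [||u]; [exact: Lrun|exact: Lrun|].
apply: ler_wpM2r; first by rewrite mulr_ge0.
by rewrite ler_nat; case: leP => // us; rewrite (le_trans us ss).
Qed.

Let Phi_step s s' : 0 <= s -> s <= s' -> s' <= T ->
  Phi s' - Phi s <= (I s' - I s) * Phi s'.
Proof.
move=> s0 ss sT; rewrite /Phi opprD addrACA subrr add0r -/(Phi s') !run_diff//.
have LI : L1 (lebT T) (fun u => (u <= s')%R%:R * kappa u - (u <= s)%R%:R * kappa u).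
  by apply: L1B; exact: Lrun.
rewrite mulrC -(RintZ _ LI).
have LP : L1 (lebT T) (fun u => (u <= s')%R%:R * (kappa u * y u) -
    (u <= s)%R%:R * (kappa u * y u)) by apply: L1B; exact: Lrun.
have -> : \int[lebT T]_u ((u <= s')%R%:R * (kappa u * y u) -
    (u <= s)%R%:R * (kappa u * y u)) =
  \int[lebT T]_u (((u <= s')%R%:R * kappa u - (u <= s)%R%:R * kappa u) *
    Num.min (y u) (Phi s')).
  have mm : measurable_fun setT (fun u => Num.min (y u) (Phi s')) by exact: measurable_minr.
  apply: Rint_ae; first exact: L1_measurable LP.
    by apply: measurable_funM => //; exact: L1_measurable LI.
  apply: ae_lebT_imp => u /andP[u0 uT].
  have [us|us] := leP u s; first by rewrite (le_trans us ss) /=; ring.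
  have [us'|us'] := leP u s'; last by rewrite /=; ring.
  rewrite min_l /=; first by ring.
  by apply: le_trans (Phi_mono us'); apply: yPhi; rewrite u0 uT.
have mm : measurable_fun setT (fun u => Num.min (y u) (Phi s')) by exact: measurable_minr.
have P0 : 0 <= Phi s'.
  apply: le_trans (y0 s') _; apply: yPhi; rewrite sT (le_trans s0 ss)//.
have LM : L1 (lebT T) (fun u => ((u <= s')%R%:R * kappa u - (u <= s)%R%:R * kappa u) *
    Num.min (y u) (Phi s')).
  apply: (L1_le _ _ (L1Zl (Phi s') (L1_abs LI))).
    by apply: measurable_funM => //; exact: L1_measurable LI.
  move=> u; rewrite normrM [leLHS]mulrC; apply: ler_wpM2r => //.
  have : 0 <= Num.min (y u) (Phi s') by rewrite le_min y0 P0.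
  by move=> m0; rewrite (ger0_norm m0) ge_min lexx orbT.
apply: Rint_le => //; first exact: L1Zl.
move=> u; rewrite mulrC; apply: ler_wpM2r; last by rewrite ge_min lexx orbT.
rewrite -mulrBl mulr_ge0// subr_ge0 ler_nat.
by case: leP => // us; rewrite (le_trans us ss).
Qed.

Let I_small (e : R) : 0 < e -> exists m : nat, forall s s', 0 <= s -> s <= s' ->
  s' <= T -> (s' - s) * m%:R <= e -> I s' - I s <= e + e.
Proof.
move=> e0.
have mmin (m : nat) : measurable_fun setT (fun u => Num.min (kappa u) m%:R).
  exact: measurable_minr.
have min0 (m : nat) u : 0 <= Num.min (kappa u) m%:R by rewrite le_min k0/=.
have Lmin (m : nat) : L1 (lebT T) (fun u => Num.min (kappa u) m%:R).
  apply: (L1_le _ _ Lk); first exact: mmin.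
  by move=> u; rewrite ger0_norm// ge_min lexx.
have cv : (fun m : nat => \int[lebT T]_u Num.min (kappa u) m%:R) @ \oo -->
    \int[lebT T]_u kappa u.
  apply: (@Rdominated_cvg _ _ (measurableTypeR R) (lebT T)
    (fun m u => Num.min (kappa u) m%:R) kappa kappa).
  - by move=> m; exact: mmin.
  - exact: mk.
  - apply: aeW => u; apply: cvg_near_cst; near=> m.
    rewrite min_l//; apply: ltW; apply: lt_le_trans (truncnS_gt _) _.
    by rewrite ler_nat; near: m; exists (Num.truncn (kappa u)).+1.
  - by move=> m u; rewrite ger0_norm// ge_min lexx.
  - exact: Lk.
(* At a high level m, truncating kappa costs at most e; the truncation contributes at
   most m (s' - s). *)
have /cvgrPdist_le /(_ e e0) [m _ /(_ m (leqnn m))] := cv.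
rewrite /= ger0_norm ?subr_ge0; last first.
  by apply: Rint_le => // u; rewrite ge_min lexx.
move=> hm; exists m => s s' s0 ss sT ssm.
rewrite run_diff//.
have Lind : L1 (lebT T) (fun u => \1_(`]s, s']%classic) u : R).
  apply: (@L1_bounded _ _ _ _ _ 1).
    by apply: measurable_indic; exact: measurable_itv.
  by move=> u; rewrite indicE; case: (_ \in _); rewrite ?normr1 ?normr0.
have Ld := L1B Lk (Lmin m).
apply: (@le_trans _ _ (\int[lebT T]_u (m%:R * \1_(`]s, s']%classic) u +
    (kappa u - Num.min (kappa u) m%:R)))).
  apply: Rint_le; [by apply: L1B; exact: Lrun|by apply: L1D => //; exact: L1Zl|].
  move=> u; have d0 : 0 <= kappa u - Num.min (kappa u) m%:R.
    by rewrite subr_ge0 ge_min lexx.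
  rewrite indicE mem_setE in_itv/=.
  have [us|us] := leP u s; first by rewrite (le_trans us ss)/= !mul1r subrr mulr0 add0r.
  have [us'|us'] := leP u s'; last by rewrite /= !mul0r subrr mulr0 add0r.
  by rewrite /= mul1r mul0r subr0 mulr1 addrCA lerDl subr_ge0 ge_min lexx orbT.
rewrite (RintD (L1Zl _ Lind) Ld) (RintZ _ Lind) lebT_itv// (min_l sT) (min_l (le_trans ss sT)).
by rewrite (RintB Lk (Lmin m)); apply: lerD => //; rewrite mulrC.
Unshelve. all: by end_near. Qed.

Let gronwall_delta (dl : R) : 0 < dl ->
  forall s, 0 <= s <= T -> y s <= a * expR ((1 + dl) * I T).
Proof.
move=> dl0; pose e := dl / (1 + dl) / 2.
have dl1 : 0 < 1 + dl by rewrite addr_gt0.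
have e0 : 0 < e by rewrite !divr_gt0.
have ee : e + e = dl / (1 + dl) by rewrite -splitr.
have [m mP] := I_small e0.
pose L := (Num.truncn (T * m%:R / e)).+1.
have L0 : 0 < L%:R :> R by rewrite ltr0n.
have LP : T * m%:R <= e * L%:R.
  by rewrite [leRHS]mulrC -ler_pdivrMr//; apply: ltW; exact: truncnS_gt.
pose r (l : nat) : R := T * (l%:R / L%:R).
have r0 l : 0 <= r l by rewrite !mulr_ge0// invr_ge0 ltW.
have rS l : r l.+1 - r l = T / L%:R.
  by rewrite /r -mulrBr -mulrBl -natrB// subSnn mul1r.
have rle l : r l <= r l.+1 by rewrite -subr_ge0 rS divr_ge0// ltW.
have rT l : (l <= L)%N -> r l <= T.
  by move=> lL; rewrite /r ler_piMr// ler_pdivrMr// mul1r ler_nat.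
have I0 l : 0 <= I (r l.+1) - I (r l).
  rewrite run_diff//; apply: Rintegral_ge0 => u _; rewrite -mulrBl mulr_ge0// subr_ge0 ler_nat.
  by case: (leP u (r l)) => // us; rewrite (le_trans us (rle l)).
have bnd l : (l <= L)%N -> Phi (r l) <= a * expR ((1 + dl) * I (r l)).
  elim: l => [_|l IH lL].
    have z (f : R -> R) : measurable_fun setT f -> runint T f (r 0%N) = 0.
      move=> mf; rewrite runint_lebT ?rT// /r mul0r mulr0.
      by rewrite lebT_Rintegral// set_itv1 Rintegral_set1.
    by rewrite /Phi /I !z//; [rewrite addr0 mulr0 expR0 mulr1|exact: measurable_funM].
  have := Phi_step (r0 l) (rle l) (rT _ lL).
  have := mP _ _ (r0 l) (rle l) (rT _ lL).
  rewrite rS ee.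
  have h : T / L%:R * m%:R <= e by rewrite mulrAC ler_pdivrMr.
  move=> /(_ h); set dI := I _ - I _ => dIe dP.
  have dI0 : 0 <= dI by exact: I0.
  have P0 : 0 <= Phi (r l.+1).
    by apply: le_trans (y0 (r l.+1)) _; apply: yPhi; rewrite r0 rT.
  (* By the choice of the grid, 1 / (1 - dI) is at most 1 + (1 + dl) dI, and so at
     most expR ((1 + dl) dI). *)
  have x1 : (1 + dl) * dI <= dl by rewrite mulrC -ler_pdivlMr.
  have x2 : 1 <= (1 - dI) * (1 + (1 + dl) * dI).
    rewrite -subr_ge0; have -> : (1 - dI) * (1 + (1 + dl) * dI) - 1 =
      dI * (dl - (1 + dl) * dI) by ring.
    by rewrite mulr_ge0// subr_ge0.
  have IE : I (r l.+1) = I (r l) + dI by rewrite /dI addrC subrK.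
  rewrite IE mulrDr expRD mulrA.
  have x0 : 0 <= 1 + (1 + dl) * dI by rewrite addr_ge0// mulr_ge0// ltW.
  apply: (@le_trans _ _ (Phi (r l) * (1 + (1 + dl) * dI))).
    apply: (@le_trans _ _ (Phi (r l.+1) * ((1 - dI) * (1 + (1 + dl) * dI)))).
      by rewrite ler_peMr.
    rewrite mulrA; apply: ler_wpM2r => //; rewrite mulrBr mulr1 mulrC.
    by move: dP; rewrite lerBlDr lerBlDl addrC.
  apply: ler_pM => //; last exact: expR_ge1Dx.
    apply: le_trans (y0 (r l)) _; apply: yPhi; rewrite r0 rT//; exact: ltnW.
  by apply: IH; exact: ltnW.
move=> s /andP[s0 sT].
apply: le_trans (yPhi _) _; first by rewrite s0.
apply: le_trans (Phi_mono sT) _.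
have -> : T = r L by rewrite /r divff ?mulr1// gt_eqF.
exact: bnd.
Qed.

(** The function [y] is only bounded and measurable, so nothing is differentiated: with
    [Phi s = a + int_0^s kappa y] and [I s = int_0^s kappa], the increments satisfy
    [Phi s' (1 - (I s' - I s)) <= Phi s], which is iterated along a grid on which
    the increments of [I] are small. *)
Lemma gronwall s : 0 <= s <= T -> y s <= a * expR (\int[lebT T]_u kappa u).
Proof.
move=> sT.
have -> : \int[lebT T]_u kappa u = I T by rewrite /I runint_lebT.
have cv : (fun k => a * expR ((1 + harmonic k) * I T)) @ \oo --> a * expR ((1 + 0) * I T).
  apply: cvgMr; apply: (cvg_comp (fun k => (1 + harmonic k) * I T) expR);
    last exact: continuous_expR.
  by apply: cvgMl; apply: cvgD; [exact: cvg_cst|exact: cvg_harmonic].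
rewrite addr0 mul1r in cv.
by apply: (cvgr_to_ge cv); apply: nearW => k; apply: gronwall_delta => //; exact: harmonic_gt0.
Qed.

End Gronwall.

(** * The quadratic forms of the covariance and of the Gramian *)
Section Covariance.
Context (R : realType) (d : measure_display) (Omega : measurableType d).
Variables (Pr : probability Omega R) (F : R -> set (set Omega)).
Variables (q : nat) (K : 'M[R]_q) (w : R -> Omega -> 'cV[R]_q).
Hypothesis uF : usual_filtration Pr F.
Hypothesis W : wiener_process Pr F K w.

(** The form of [K] at [v] is the second moment of [<v, w 1 - w 0>]. *)
Lemma covariance_psd : psd K.
Proof.
have KE i j : K i j = \int[Pr]_o (incr w i 0 1 o * incr w j 0 1 o).
  by rewrite (incr_prod_mean uF W i j (lexx 0) ler01) subr0 mulr1.
have L i j := incr_prod_L1 uF W i j (lexx 0) (ler01 : 0 <= 1 :> R).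
split; first by apply/matrixP => i j; rewrite mxE !KE; apply: eq_Rintegral => o _; ring.
move=> v; have -> : dotv v (K *m v) =
    \int[Pr]_o (\sum_i \sum_j (v i 0 * v j 0) * (incr w i 0 1 o * incr w j 0 1 o)).
  rewrite Rint_sum; last by move=> i; apply: L1_sum => j; exact: L1Zl (L i j).
  apply: eq_bigr => i _; rewrite mxE mulr_sumr.
  rewrite Rint_sum; last by move=> j; exact: L1Zl (L i j).
  by apply: eq_bigr => j _; rewrite (RintZ _ (L i j)) -KE; ring.
apply: Rintegral_ge0 => o _.
have -> : \sum_i \sum_j (v i 0 * v j 0) * (incr w i 0 1 o * incr w j 0 1 o) =
    (\sum_i v i 0 * incr w i 0 1 o) ^+ 2.
  rewrite expr2 mulr_suml; apply: eq_bigr => i _; rewrite mulr_sumr.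
  by apply: eq_bigr => j _; ring.
exact: sqr_ge0.
Qed.

End Covariance.

Section GramianEnergy.
Context (R : realType) (n : nat).

(** The form of [P^-1] at [x - <x, p> p] is nonnegative and equals
    [x^T P^-1 x - <x, p>^2 / lambda]. *)
Lemma eigenvector_bound (P : 'M[R]_n) (x p : 'cV[R]_n) (lambda : R) :
  posdef P -> dotv p p = 1 -> P *m p = lambda *: p -> 0 < lambda ->
  dotv x p ^+ 2 <= lambda * quadf (invmx P) x.
Proof.
move=> pP pp Pp l0; have [sX X0] := psd_invmx pP.
have uP := posdef_unitmx pP.
have Xp : invmx P *m p = lambda^-1 *: p.
  have {2}-> : p = invmx P *m (P *m p) by rewrite mulKmx.
  by rewrite Pp -scalemxAr scalerA mulVf ?scale1r// gt_eqF.
have := X0 (x - dotv x p *: p); set s := dotv x p.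
have -> : dotv (x - s *: p) (invmx P *m (x - s *: p)) =
    quadf (invmx P) x - lambda^-1 * s ^+ 2.
  rewrite mulmxBr -scalemxAr Xp -scaleNr -scaleNr dotvDl !dotvDr !dotvZl !dotvZr pp.
  rewrite -[dotv p (invmx P *m x)](dotv_psd_sym _ _ sX) Xp dotvZr -/s /quadf.
  by ring.
by rewrite subr_ge0 => h; rewrite mulrC -ler_pdivrMr// mulrC.
Qed.

End GramianEnergy.

(** * Stopping when an accumulated cost reaches a level *)
Section StoppingLevel.
Context (R : realType) (d : measure_display) (Omega : measurableType d).
Variables (Pr : probability Omega R) (F : R -> set (set Omega)).
Hypothesis uF : usual_filtration Pr F.
Variables (T : R) (g : measurableTypeR R -> Omega -> R).
Hypothesis T0 : 0 <= T.
Hypothesis jg : jmeas g.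
Hypothesis g_ge0 : forall u o, 0 <= g u o.
Hypothesis g_out : forall u o, ~~ (0 <= u <= T) -> g u o = 0.
Hypothesis Fg : forall u, 0 <= u <= T -> meas_wrt (F u) (g u).

(** Like [runint], an integral against a fixed measure, hence jointly measurable. *)
Definition running_cost (s : R) (o : Omega) : \bar R :=
  (\int[lebT T]_u ((u <= s)%R%:R * g u o)%R%:E)%E.

Definition below (N : nat) (s : R) (o : Omega) : bool :=
  (running_cost s o <= N%:R%:E)%E.

Let mrun (s : R) o : measurable_fun setT (fun u : measurableTypeR R => (u <= s)%R%:R * g u o).
Proof. by apply: measurable_funM; [exact: measurable_le_cst|exact: (jmeas2 o jg)]. Qed.

Lemma running_cost_mono s s' o : s <= s' -> (running_cost s o <= running_cost s' o)%E.
Proof.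
move=> ss; apply: ge0_le_integral => //; try (apply/measurable_EFinP; exact: mrun).
  by move=> u _; rewrite lee_fin mulr_ge0.
move=> u _; rewrite lee_fin; apply: ler_wpM2r => //; rewrite ler_nat.
by case: (leP u s) => // us; rewrite (le_trans us ss).
Qed.

Lemma running_cost0 o : running_cost 0 o = 0%E.
Proof.
rewrite /running_cost -(integral0 (lebT T) setT); apply: ae_eq_integral => //.
  exact/measurable_EFinP.
exists ([set 0] : set (measurableTypeR R)); split => //; first exact: lebT_set1.
move=> u /= h; apply: contrapT => u0; apply: h => _; congr EFin.
have [u0'|u0'] := leP u 0; last by rewrite mul0r.
by rewrite g_out ?mulr0// negb_and -ltNge lt_neqAle u0' andbT; apply/orP; left; apply/eqP.
Qed.

Lemma below_mono N s s' o : s <= s' -> below N s' o -> below N s o.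
Proof. by move=> ss; apply: le_trans; exact: running_cost_mono. Qed.

(** The cost is continuous from the left in time, so that the set of times where it
    is at most [N] is closed. *)
Lemma below_left N s o : 0 < s -> ~~ below N s o ->
  exists2 s', 0 <= s' < s & ~~ below N s' o.
Proof.
move=> s0 nb; apply: contrapT => h.
have hb s' : 0 <= s' < s -> below N s' o.
  by move=> ss; apply: contrapT => /negP nb'; apply: h; exists s'.
move/negP: nb; apply.
pose r (k : nat) : R := s * (1 - k.+1%:R^-1).
have k1 (k : nat) : 0 < k.+1%:R^-1 :> R by rewrite invr_gt0.
have kle (k : nat) : k.+1%:R^-1 <= 1 :> R by rewrite invf_le1// ler1n.
have rs k : 0 <= r k < s.
  by rewrite /r mulr_ge0 ?subr_ge0 ?(ltW s0)//= gtr_pMr// gtrBl.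
have mlt : measurable_fun setT (fun u : measurableTypeR R => (u < s)%R%:R * g u o).
  by apply: measurable_funM; [exact: measurable_lt_cst|exact: (jmeas2 o jg)].
have -> : below N s o = (\int[lebT T]_u ((u < s)%R%:R * g u o)%R%:E <= N%:R%:E)%E.
  rewrite /below /running_cost; congr (_ <= _)%E; apply: ae_eq_integral => //.
  - exact/measurable_EFinP.
  - exact/measurable_EFinP.
  exists ([set s] : set (measurableTypeR R)); split => //; first exact: lebT_set1.
  move=> u /= h'; apply: contrapT => us; apply: h' => _.
  by rewrite lt_neqAle (_ : u != s)//; apply/eqP.
have := @cvg_monotone_convergence _ _ _ (lebT T) setT measurableT
  (fun k u => ((u <= r k)%R%:R * g u o)%R%:E).
have lim u : limn (fun k => ((u <= r k)%R%:R * g u o)%R%:E) = ((u < s)%R%:R * g u o)%R%:E.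
  apply/cvg_lim => //; apply: cvg_near_cst; near=> k; congr (_%:R * _)%:E; congr nat_of_bool.
  have [us|us] := ltP u s; last first.
    by apply/negbTE; rewrite -ltNge; apply: lt_le_trans us; have /andP[] := rs k.
  rewrite /r mulrBr mulr1 lerBrDr -lerBrDl ler_pdivrMr// mulrC -ler_pdivrMr ?subr_gt0//.
  apply: ltW; apply: lt_le_trans (truncnS_gt _) _; rewrite ler_nat.
  by near: k; exists (Num.truncn (s / (s - u))).+1 => // k /= kk; apply: leq_trans kk _.
move=> H'.
have H : (fun k => \int[lebT T]_u ((u <= r k)%R%:R * g u o)%R%:E)%E @ \oo -->
    (\int[lebT T]_u ((u < s)%R%:R * g u o)%R%:E)%E.
  under eq_integral do rewrite -lim.
  apply: H' => //.
  - by move=> k; exact/measurable_EFinP.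
  - by move=> k u _; rewrite lee_fin mulr_ge0.
  - move=> u _ k l kl; rewrite lee_fin; apply: ler_wpM2r => //; rewrite ler_nat.
    have rkl : r k <= r l.
      rewrite /r ler_pM2l// lerD2l lerN2 lef_pV2 ?posrE// ler_nat ltnS; exact: kl.
    by case: (leP u (r k)) => // us; rewrite (le_trans us rkl).
by apply: (cvge_to_le H); apply: nearW => k; exact: hb.
Unshelve. all: by end_near. Qed.

(** Up to time [s] the cost depends on [g] up to time [s] only, and [F s] contains
    the null sets, as required by [prog_integral]. *)
Lemma below_adapted N s : 0 <= s <= T -> F s [set o | below N s o].
Proof.
move=> /andP[s0 sT].
have sF := filtration_sigma uF s0.
apply: (@prog_integral _ _ _ Pr _ sF (filtration_sub uF s0) _ _ _ (lebT T)
  (fun u o => (u <= s)%R%:R * g u o)).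
- by move=> A nA; apply: (filtration_nd uF (lexx 0) s0); exact: (filtration_complete uF).
- apply: jmeasM => //.
  exact: (measurableT_comp (measurable_le_cst s) measurable_fst).
- by move=> u o; rewrite mulr_ge0.
move=> u; have [us|us] := leP u s; last first.
  by under eq_fun do rewrite mul0r; exact: (meas_wrt_cst sF).
under eq_fun do rewrite mul1r.
have [u0|u0] := leP 0 u; last first.
  have -> : g u = (fun=> 0); last exact: (meas_wrt_cst sF).
  by apply/funext => o; rewrite g_out// negb_and -ltNge u0.
by apply: (meas_wrt_sub (filtration_nd uF u0 us)); apply: Fg; rewrite u0 (le_trans us sT).
Qed.

Lemma below_jmeas N : jmeas (survival (below N)).
Proof.
apply: measurable_bool_natr.
apply: (@measurable_fun_lee _ _ _ _ (fun z => running_cost z.1 z.2)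
  (fun=> N%:R%:E)) => //; last first.
pose TT := ((measurableTypeR R * Omega) * measurableTypeR R)%type.
have m2 : measurable_fun setT (fun z : TT => z.2) by exact: measurable_snd.
have m11 : measurable_fun setT (fun z : TT => z.1.1).
  exact: measurableT_comp measurable_fst measurable_fst.
have m12 : measurable_fun setT (fun z : TT => z.1.2).
  exact: measurableT_comp measurable_snd measurable_fst.
apply: (@measurable_fun_fubini_tonelli_F _ _ (measurableTypeR R * Omega)%type _ _ (lebT T)
  (fun z : TT => ((z.2 <= z.1.1)%R%:R * g z.2 z.1.2)%R%:E)).
- apply/measurable_EFinP; apply: measurable_funM.
    exact: (measurableT_comp (@measurable_le2 R) (measurable_fun_pair m2 m11)).
  exact: (measurableT_comp jg (measurable_fun_pair m2 m12)).
- by move=> z; rewrite lee_fin mulr_ge0.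
Qed.

(** The times where the cost is at most [N] form an interval with a last point
    [tau], and the integral is at most the cost at [tau]. *)
Lemma below_integral N t f o : 0 <= t <= T -> jmeas f ->
  (forall u, 0 <= f u o <= g u o) ->
  (\int[lebT t]_u (survival (below N) u o * f u o)%R%:E <= N%:R%:E)%E.
Proof.
move=> /andP[t0 tT] jf fg.
have f0 u : 0 <= f u o by have /andP[] := fg u.
have fle u : f u o <= g u o by have /andP[] := fg u.
have chi0 u : 0 <= survival (below N) u o by rewrite /survival ler0n.
have mcf : measurable_fun setT (fun u => survival (below N) u o * f u o).
  by apply: measurable_funM; [exact: (jmeas2 o (below_jmeas N))|exact: (jmeas2 o jf)].
have cf0 u : 0 <= survival (below N) u o * f u o by rewrite mulr_ge0.
apply: le_trans (lebT_mono tT mcf cf0) _.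
pose A := [set u : R | 0 <= u <= T /\ below N u o].
have A0 : A 0 by split; [rewrite lexx T0|rewrite /below running_cost0 lee_fin].
have supA : has_sup A by split; [exists 0|exists T => u [/andP[]]].
pose tau := sup A.
have tau0 : 0 <= tau by apply: sup_upper_bound.
have tauT : tau <= T by apply: ge_sup; [exists 0|move=> u [/andP[]]].
have Btau : below N tau o.
  apply: contrapT => /negP nb.
  have tp : 0 < tau.
    rewrite lt_neqAle tau0 andbT; apply/eqP => t00; move/negP: nb; apply.
    by rewrite -t00; exact: A0.2.
  have [s' /andP[s0 st] nb'] := below_left tp nb.
  have [u Au us] : exists2 u, A u & s' < u.
    have := @sup_adherent _ A (tau - s'); rewrite subr_gt0 => /(_ st supA)[u Au].
    by rewrite -/tau opprB addrCA subrr addr0 => ?; exists u.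
  by move/negP: nb'; apply; exact: (below_mono (ltW us) Au.2).
apply: le_trans Btau; apply: ae_ge0_le_integral => //.
- by move=> u _; rewrite lee_fin.
- exact/measurable_EFinP.
- by move=> u _; rewrite lee_fin mulr_ge0.
- exact/measurable_EFinP.
apply: ae_lebT_imp => u uT _; rewrite lee_fin.
case bu : (below N u o); last by rewrite /survival bu mul0r mulr_ge0.
rewrite /survival bu mul1r; have -> : (u <= tau)%R.
  by apply: sup_upper_bound.
by rewrite mul1r.
Qed.

Lemma below_eventually s o : s <= T -> (\int[lebT T]_u (g u o)%:E < +oo)%E ->
  \forall N \near \oo, below N s o.
Proof.
move=> sT goo.
have rc : (running_cost s o <= \int[lebT T]_u (g u o)%:E)%E.
  apply: ge0_le_integral => //.
  - by move=> u _; rewrite lee_fin mulr_ge0.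
  - exact/measurable_EFinP.
  - by apply/measurable_EFinP; exact: (jmeas2 o jg).
  - by move=> u _; rewrite lee_fin ler_piMl// lern1 leq_b1.
have g0 : (0 <= \int[lebT T]_u (g u o)%:E)%E.
  by apply: integral_ge0 => u _; rewrite lee_fin.
have gf : (\int[lebT T]_u (g u o)%:E)%E \is a fin_num by rewrite ge0_fin_numE.
near=> N; apply: le_trans rc _; rewrite -(fineK gf) lee_fin.
apply: ltW; apply: lt_le_trans (truncnS_gt _) _; rewrite ler_nat.
by near: N; exists (Num.truncn (fine (\int[lebT T]_u (g u o)%:E)%E)).+1.
Unshelve. all: by end_near. Qed.

End StoppingLevel.

(** * The coefficients along measurable and adapted processes *)
Section CoefficientMeasurability.
Context (R : realType) (n m q : nat) (sys : sde_coeffs R n m q).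
Hypothesis bf : borel_map (sde_f sys).
Hypothesis bg : forall k, borel_map (sde_g sys k).
Hypothesis bgamma : forall j, borel_map (sde_gamma sys j).
Context d (T : measurableType d).
Variables (Y : T -> 'cV[R]_n) (V : T -> 'cV[R]_m).
Hypothesis mY : forall i, measurable_fun setT (fun z => Y z i 0).
Hypothesis mV : forall k, measurable_fun setT (fun z => V z k 0).

Lemma mulmx_measurable k (A : 'M[R]_(k, m)) i :
  measurable_fun setT (fun z => (A *m V z) i 0).
Proof.
under eq_fun do rewrite mxE.
by apply: measurable_sum => l; exact: measurable_funM.
Qed.

Lemma quadf_measurable (S : 'M[R]_n) : measurable_fun setT (fun z => quadf S (Y z)).
Proof.
rewrite /quadf /dotv; apply: measurable_sum => i; apply: measurable_funM => //.
under eq_fun do rewrite mxE.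
by apply: measurable_sum => l; exact: measurable_funM.
Qed.

Lemma sqnorm_measurable k (f : T -> 'cV[R]_k) :
  (forall i, measurable_fun setT (fun z => f z i 0)) ->
  measurable_fun setT (fun z => sqnorm (f z)).
Proof. by move=> mf; apply: measurable_sum => i; exact: measurable_funM. Qed.

Lemma drift_measurable i : measurable_fun setT (fun z => sde_drift sys (Y z) (V z) i 0).
Proof.
under eq_fun do rewrite /sde_drift !mxE.
apply: measurable_funD; last first.
  apply: measurable_sum => k; apply: measurable_funM => //.
  by under eq_fun do rewrite mxE; exact: (borel_comp (bg k)).
apply: measurable_funD; first exact: (borel_comp bf).
by apply: measurable_sum => k; exact: measurable_funM.
Qed.

Lemma diffusion_measurable i j :
  measurable_fun setT (fun z => sde_diffusion sys (Y z) (V z) i j).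
Proof.
under eq_fun do rewrite /sde_diffusion !mxE.
apply: measurable_funD; first exact: (borel_comp (bgamma j)).
by apply: measurable_sum => k; exact: measurable_funM.
Qed.

End CoefficientMeasurability.

Section Patching.
Context (R : realType) (d : measure_display) (Omega : measurableType d).
Variables (Pr : probability Omega R) (F : R -> set (set Omega)).
Hypothesis uF : usual_filtration Pr F.

Lemma ito_integral_ext (w : R -> Omega -> R) (s : R) (H H' : R -> Omega -> R) Y :
  (forall u o, 0 <= u <= s -> H u o = H' u o) ->
  ito_integral Pr F w s H Y -> ito_integral Pr F w s H' Y.
Proof.
move=> HH [[mH FH] fin FY [Hk [c1 c2]]].
have in0 u : `[0, s]%classic u -> 0 <= u <= s by rewrite /= in_itv.
split => //.
- split.
    apply: eq_measurable_fun mH => -[u o]; rewrite inE => -[/= /in0 us _].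
    exact: HH.
  move=> t ts; have -> : H' t = H t by apply/funext => o; rewrite HH.
  exact: FH.
- apply: filterS fin => o; congr (_ < +oo)%E; apply: eq_integral => u.
  by rewrite inE => /in0 us; rewrite HH.
exists Hk; split => //.
have <- : (fun k o => \int[lebesgue_measure]_(u in `[0%R, s])
      ((sp_val (Hk k) u o - H u o) ^+ 2)%:E)%E = (fun k o =>
    \int[lebesgue_measure]_(u in `[0%R, s]) ((sp_val (Hk k) u o - H' u o) ^+ 2)%:E)%E;
  last exact: c1.
apply/funext => k; apply/funext => o; apply: eq_integral => u.
by rewrite inE => /in0 us; rewrite HH.
Qed.

(** A process is arbitrary outside of [0, T]. Setting it to 0 there makes it
    jointly measurable on the whole line, and the coefficients of the equation
    vanish with the state and the control. *)
Definition patched k (T : R) (X : R -> Omega -> 'cV[R]_k) (s : measurableTypeR R)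
  (o : Omega) : 'cV[R]_k := if 0 <= s <= T then X s o else 0.

Lemma patched_jmeas k T (X : R -> Omega -> 'cV[R]_k) : measurable_adapted_vec F T X ->
  forall i, jmeas (fun s o => patched T X s o i 0).
Proof.
move=> mX i; have [mXi _] := mX i.
have mD : measurable (`[0, T]%classic `*` [set: Omega] : set (measurableTypeR R * Omega)).
  by apply: measurableX => //; exact: measurable_itv.
have := (measurable_restrictT _ mD).1 mXi.
apply: eq_measurable_fun => -[s o] _; rewrite /patched /patch /=.
case: ifPn => [|]; first by rewrite inE => -[/=]; rewrite in_itv/= => -> _.
move=> h; case: ifPn => sT; last by rewrite mxE.
by exfalso; move/negP: h; apply; rewrite inE; split => //=; rewrite in_itv.
Qed.

Lemma patched_adapted k T (X : R -> Omega -> 'cV[R]_k) s : measurable_adapted_vec F T X ->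
  0 <= s <= T -> forall i, meas_wrt (F s) (fun o => patched T X s o i 0).
Proof. by move=> mX sT i; rewrite /patched sT; exact: (mX i).2. Qed.

End Patching.

(** * The energy of the reachable states *)
Section ReachabilityEnergy.
Context (R : realType) (d : measure_display) (Omega : measurableType d).
Variables (Pr : probability Omega R) (F : R -> set (set Omega)).
Variables (n m q : nat) (K : 'M[R]_q) (w : R -> Omega -> 'cV[R]_q).
Variables (sys : sde_coeffs R n m q) (T delta : R) (calU : 'M[R]_m) (P : 'M[R]_n).
Variables (u : R -> Omega -> 'cV[R]_m) (x : R -> Omega -> 'cV[R]_n).
Hypothesis uF : usual_filtration Pr F.
Hypothesis W : wiener_process Pr F K w.
Hypothesis A : sde_standing_assumptions Pr F sys w.
Hypothesis T_gt0 : 0 < T.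
Hypothesis GR : simplified_reachability_gramian sys K calU delta P.
Hypothesis adm : admissible_control Pr F T u.
Hypothesis sol : sde_solution Pr F sys w T 0 u x.
Hypothesis det : deterministic_on Pr T (multiplicative_controls sys u).

Let T0 : 0 <= T. Proof. exact: ltW. Qed.
Let psdK : psd K := covariance_psd uF W.
Let S := invmx P.
Let psdS : psd S := psd_invmx (gramian_posdef GR).
Let delta2 : 0 <= delta ^- 2.
Proof. by rewrite invr_ge0 sqr_ge0. Qed.

Local Notation xs := (patched T x).
Local Notation us := (patched T u).
Local Notation mc := (multiplicative_controls sys us).

Definition drift_proc i (s : measurableTypeR R) (o : Omega) : R :=
  sde_drift sys (xs s o) (us s o) i 0.
Definition diffusion_proc i j (s : measurableTypeR R) (o : Omega) : R :=
  sde_diffusion sys (xs s o) (us s o) i j.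
(** The factor of the storage in the dissipation inequality. *)
Definition gain_proc (s : measurableTypeR R) (o : Omega) : R :=
  sqnorm (mc s o) * delta ^- 2.
Definition storage_proc (s : measurableTypeR R) (o : Omega) : R := quadf S (xs s o).
(** All that has to be integrable until the stopping: the drift, its products with the
    components of the state, the squared diffusion, and the gain times the
    storage. *)
Definition cost_proc (s : measurableTypeR R) (o : Omega) : R :=
  \sum_i \sum_i' `|drift_proc i s o| * (1 + `|xs s o i' 0|) +
  \sum_i \sum_j diffusion_proc i j s o ^+ 2 + gain_proc s o * storage_proc s o.

Local Notation b := drift_proc.
Local Notation h := diffusion_proc.
Local Notation kap := gain_proc.
Local Notation V := storage_proc.
Local Notation gg := cost_proc.

Let jx i : jmeas (fun s o => xs s o i 0).
Proof. exact: (patched_jmeas (sol_adapted sol)). Qed.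
Let ju i : jmeas (fun s o => us s o i 0).
Proof. exact: (patched_jmeas adm.1). Qed.
Let jb i : jmeas (b i).
Proof. exact: (drift_measurable (sde_f_borel A) (sde_g_borel A) jx ju). Qed.
Let jh i j : jmeas (h i j).
Proof. exact: (diffusion_measurable (sde_gamma_borel A) jx ju). Qed.

Lemma multiplicative_measurable d' (T' : measurableType d') (f : T' -> 'cV[R]_m) :
  (forall i, measurable_fun setT (fun z => f z i 0)) -> forall i,
  measurable_fun setT (fun z => (\col_i (if `[< forall z, sde_g sys i z = 0 >]
    then 0 else f z i 0) : 'cV[R]_m) i 0).
Proof.
move=> mf i; under eq_fun do rewrite mxE.
by case: (asboolP (forall z, sde_g sys i z = 0)) => _; [exact: measurable_cst|exact: mf].
Qed.

Let jmc i : jmeas (fun (s : measurableTypeR R) o => mc s o i 0).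
Proof.
exact: (@multiplicative_measurable _ (measurableTypeR R * Omega)%type
  (fun z : measurableTypeR R * Omega => us z.1 z.2) ju i).
Qed.
Let jsq : jmeas (fun (s : measurableTypeR R) o => sqnorm (mc s o)).
Proof. by apply: (sqnorm_measurable (f := fun z : measurableTypeR R * Omega => mc z.1 z.2)) => i; exact: jmc. Qed.
Let jkap : jmeas kap.
Proof. by apply: measurable_funM. Qed.
Let jV : jmeas V.
Proof. exact: (quadf_measurable jx). Qed.

Let V0 s o : 0 <= V s o. Proof. exact: psdS.2. Qed.
Let kap0 s o : 0 <= kap s o. Proof. by rewrite mulr_ge0// sqnorm_ge0. Qed.
Let kV0 s o : 0 <= kap s o * V s o. Proof. by rewrite mulr_ge0. Qed.
Let bx0 i i' s o : 0 <= `|b i s o| * (1 + `|xs s o i' 0|).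
Proof. by rewrite mulr_ge0// addr_ge0. Qed.
Let sbx0 s o : 0 <= \sum_i \sum_i' `|b i s o| * (1 + `|xs s o i' 0|).
Proof. by apply: sumr_ge0 => i _; apply: sumr_ge0 => i' _. Qed.
Let sh0 s o : 0 <= \sum_i \sum_j h i j s o ^+ 2.
Proof. by apply: sumr_ge0 => i _; apply: sumr_ge0 => j _; exact: sqr_ge0. Qed.

Let gg_ge0 s o : 0 <= gg s o.
Proof. by rewrite /gg !addr_ge0. Qed.
Let bx_gg i i' s o : `|b i s o| * (1 + `|xs s o i' 0|) <= gg s o.
Proof.
rewrite /gg -addrA; apply: le_trans (_ : \sum_i \sum_i' `|b i s o| * (1 + `|xs s o i' 0|) <= _).
  rewrite (bigD1 i)//= (bigD1 i')//= -addrA lerDl addr_ge0//; first exact: sumr_ge0.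
  by apply: sumr_ge0 => k _; exact: sumr_ge0.
by rewrite lerDl addr_ge0.
Qed.
Let h_gg i j s o : h i j s o ^+ 2 <= gg s o.
Proof.
apply: le_trans (_ : \sum_i \sum_j h i j s o ^+ 2 <= _).
  rewrite (bigD1 i)//= (bigD1 j)//= -addrA lerDl addr_ge0//.
    by apply: sumr_ge0 => k _; exact: sqr_ge0.
  by apply: sumr_ge0 => k _; apply: sumr_ge0 => l _; exact: sqr_ge0.
by rewrite /gg -addrA addrCA lerDl addr_ge0.
Qed.
Let kV_gg s o : kap s o * V s o <= gg s o.
Proof. by rewrite /gg addrC lerDl addr_ge0. Qed.

Let gg_out s o : ~~ (0 <= s <= T) -> gg s o = 0.
Proof.
move=> /negbTE sT; have xE : xs s o = 0 by rewrite /patched sT.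
have uE : us s o = 0 by rewrite /patched sT.
have bE i : b i s o = 0.
  by rewrite /b /sde_drift xE uE (sde_f0 A) !mulmx0 !addr0 mxE.
have hE i j : h i j s o = 0.
  rewrite /h /sde_diffusion xE uE mxE [X in X + _]mxE [X in _ + X]mxE.
  by rewrite (sde_gamma0 A) mulmx0 !mxE addr0.
have VE : V s o = 0.
  by rewrite /V /quadf xE mulmx0 /dotv big1// => i _; rewrite mxE mul0r.
rewrite /gg VE mulr0 addr0 big1 ?add0r.
  by rewrite big1// => i _; rewrite big1// => j _; rewrite hE expr0n.
by move=> i _; rewrite big1// => i' _; rewrite bE normr0 mul0r.
Qed.

Let jgg : jmeas gg.
Proof.
apply: measurable_funD; last exact: measurable_funM jkap jV.
apply: measurable_funD.
  apply: measurable_sum => i; apply: measurable_sum => i'; apply: measurable_funM.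
    exact: measurableT_comp (jb i).
  by apply: measurable_funD; [exact: measurable_cst|exact: measurableT_comp (jx i')].
by apply: measurable_sum => i; apply: measurable_sum => j; exact: jmeas_sqr (jh i j).
Qed.

Section Adapted.
Variable s : R.
Hypothesis sT : 0 <= s <= T.
Let s0 : 0 <= s. Proof. by have /andP[] := sT. Qed.
Let sF := filtration_sigma uF s0.
Local Notation G := (g_sigma_algebraType (F s)).

Let Gx i : measurable_fun (setT : set G) (fun o => xs s o i 0).
Proof. by apply/(meas_wrtP sF); exact: (patched_adapted (sol_adapted sol) sT). Qed.
Let Gu i : measurable_fun (setT : set G) (fun o => us s o i 0).
Proof. by apply/(meas_wrtP sF); exact: (patched_adapted adm.1 sT). Qed.

Let Gb i : measurable_fun (setT : set G) (b i s).
Proof. exact: (drift_measurable (sde_f_borel A) (sde_g_borel A) Gx Gu). Qed.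

Lemma drift_adapted i : meas_wrt (F s) (b i s).
Proof. by apply/(meas_wrtP sF); exact: Gb. Qed.

Lemma cost_adapted : meas_wrt (F s) (gg s).
Proof.
apply/(meas_wrtP sF).
apply: measurable_funD; last first.
  apply: measurable_funM; last exact: (quadf_measurable Gx).
  apply: measurable_funM => //.
  apply: (sqnorm_measurable (T := G) (f := fun o => mc s o)) => i.
  exact: (@multiplicative_measurable _ G (fun o => us s o) Gu i).
apply: measurable_funD.
  apply: measurable_sum => i; apply: measurable_sum => i'; apply: measurable_funM.
    exact: measurableT_comp (Gb i).
  by apply: measurable_funD; [exact: measurable_cst|exact: measurableT_comp (Gx i')].
apply: measurable_sum => i; apply: measurable_sum => j; apply: measurable_funX.
exact: (diffusion_measurable (sde_gamma_borel A) Gx Gu).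
Qed.

End Adapted.

Let xs_in s o : 0 <= s <= T -> xs s o = x s o.
Proof. by rewrite /patched => ->. Qed.
Let us_in s o : 0 <= s <= T -> us s o = u s o.
Proof. by rewrite /patched => ->. Qed.

Lemma L2T_patched k (f : 'cV[R]_m -> 'cV[R]_k) :
  jmeas (fun s o => sqnorm (f (us s o))) ->
  (\int[Pr]_o \int[lebT T]_s (sqnorm (f (us s o)))%:E)%E =
  L2T_sqnorm Pr T (fun t o => f (u t o)).
Proof.
move=> jf; apply: eq_integral => o _; rewrite ge0_lebT_integral.
- apply: eq_integral => s; rewrite inE/= in_itv/= => sT.
  by rewrite us_in.
- by apply/measurable_EFinP; exact: (jmeas2 o jf).
- by move=> s; rewrite lee_fin sqnorm_ge0.
Qed.

Let jsu : jmeas (fun s o => sqnorm (us s o)).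
Proof.
by apply: (sqnorm_measurable (f := fun z : measurableTypeR R * Omega => us z.1 z.2)) => i; exact: ju.
Qed.

Let Lsu : L1prod (lebT T) Pr (fun s o => sqnorm (us s o)).
Proof.
apply: L1prod_ge0 => // [s o|]; first exact: sqnorm_ge0.
by rewrite (@L2T_patched _ id jsu); exact: adm.2.
Qed.

Let mc_le s o : sqnorm (mc s o) <= sqnorm (us s o).
Proof.
apply: ler_sum => i _; rewrite !mxE.
by case: (asboolP _) => _; rewrite ?mulr0 -?expr2 ?sqr_ge0.
Qed.

Let Lsq : L1prod (lebT T) Pr (fun s o => sqnorm (mc s o)).
Proof.
have H (s : measurableTypeR R) (o : Omega) : `|sqnorm (mc s o)| <= sqnorm (us s o) by rewrite ger0_norm ?sqnorm_ge0.
exact: (L1prod_le jsq H Lsu).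
Qed.

Let path_bounded : {ae Pr, forall o, exists2 C, 0 <= C & forall s i, `|xs s o i 0| <= C}.
Proof.
apply: filterS (sol_continuous sol) => o cx.
have bnd i : exists2 C, 0 <= C & forall s, 0 <= s <= T -> `|x s o i 0| <= C.
  have ci : {within `[0, T], continuous (fun s => x s o i 0)}.
    apply: (@within_continuous_comp _ _ _ _ (fun s => x s o) (fun M : 'cV[R]_n => M i 0)).
      by move=> y _; exact: coord_continuous.
    exact: cx.
  have [c1 _ h1] := EVT_max T0 ci; have [c2 _ h2] := EVT_min T0 ci.
  exists (`|x c1 o i 0| + `|x c2 o i 0|); first by rewrite addr_ge0.
  move=> s sT; have l1 := h1 s; have l2 := h2 s.
  rewrite in_itv/= in l1 l2; move: (l1 sT) (l2 sT) => {}l1 {}l2.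
  have n1 := ler_norm (x c1 o i 0); have n2 := ler_norm (- x c2 o i 0).
  have n3 := normr_ge0 (x c1 o i 0); have n4 := normr_ge0 (x c2 o i 0).
  by rewrite normrN in n2; rewrite ler_norml; apply/andP; split; lra.
have [C CP] := choice (fun i => let: ex_intro2 C c0 cb := bnd i in
  ex_intro (fun C => 0 <= C /\ forall s, 0 <= s <= T -> `|x s o i 0| <= C) C (conj c0 cb)).
exists (\sum_i C i); first by apply: sumr_ge0 => i _; have [] := CP i.
have Cle i : C i <= \sum_i C i.
  by rewrite (bigD1 i)//= lerDl; apply: sumr_ge0 => k _; have [] := CP k.
move=> s i; rewrite /patched; case: ifPn => sT.
  by apply: le_trans (Cle i); exact: (CP i).2.
by rewrite mxE normr0; apply: le_trans (Cle i); exact: (CP i).1.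
Qed.

Lemma stochastic_parts t : 0 <= t <= T -> exists J : 'I_n -> 'I_q -> Omega -> R,
  (forall i j, ito_integral Pr F (fun s o => w s o j 0) t (h i j) (J i j)) /\
  {ae Pr, forall o, forall i, xs t o i 0 =
     \int[lebesgue_measure]_(s in `[0, t]) b i s o + \sum_j J i j o}.
Proof.
move=> tT; have [J [JI JE]] := sol_equation sol tT.
have inT s : 0 <= s <= t -> 0 <= s <= T.
  by move=> /andP[-> st]; have /andP[_ tT'] := tT; rewrite (le_trans st tT').
exists J; split.
  move=> i j; apply: ito_integral_ext (JI i j) => s o /inT sT.
  by rewrite /h xs_in// us_in.
apply: filterS JE => o E i; rewrite (xs_in _ tT) E mxE add0r; congr (_ + _).
apply: eq_Rintegral => s; rewrite inE/= in_itv/= => /inT sT.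
by rewrite /b xs_in// us_in.
Qed.

(** The paths of the state are continuous, hence bounded on [0, T], while the
    drift, the squared diffusion and the gain are almost surely integrable in
    time. *)
Lemma cost_finite : {ae Pr, forall o, (\int[lebT T]_s (gg s o)%:E < +oo)%E}.
Proof.
have [J [JI _]] := @stochastic_parts T (introT andP (conj T0 (lexx T))).
have hfin : {ae Pr, forall o, forall ij : 'I_n * 'I_q,
    (\int[lebesgue_measure]_(s in `[0%R, T]) (h ij.1 ij.2 s o ^+ 2)%:E < +oo)%E}.
  by apply: filter_forall => ij; have [] := JI ij.1 ij.2.
have kfin : {ae Pr, forall o, L1 (lebT T) (fun s => sqnorm (mc s o))}.
  have := @ae_integrable2 _ _ _ _ _ (lebT T) Pr _ Lsq.
  exact.
have mx i o : measurable_fun setT (fun s => xs s o i 0) by exact: (jmeas2 o (jx i)).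
have mb i o : measurable_fun setT (fun s => b i s o) by exact: (jmeas2 o (jb i)).
have good : {ae Pr, forall o, L1 (lebT T) (fun s => gg s o)}.
  apply: filterS2 (filterI path_bounded hfin) (filterI (sol_drift_integrable sol) kfin).
  move=> o [[C C0 xC] ho] [bI ko]; apply: L1D; first apply: L1D.
  - apply: L1_sum => i; apply: L1_sum => i'.
    have Lb : L1 (lebT T) (fun s => b i s o).
      apply: L1_lebT; first exact: mb.
      have := bI i; apply: eq_integrable => //.
      by move=> s; rewrite inE/= in_itv/= => sT; rewrite /= /b xs_in// us_in.
    apply: (L1_le _ _ (L1Zl (1 + C) (L1_abs Lb))).
      apply: measurable_funM; first exact: measurableT_comp (mb i o).
      by apply: measurable_funD; [exact: measurable_cst|exact: measurableT_comp (mx i' o)].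
    move=> s; rewrite ger0_norm// [leRHS]mulrC; apply: ler_wpM2l => //.
    by rewrite lerD2l; exact: xC.
  - apply: L1_sum => i; apply: L1_sum => j.
    have mh : measurable_fun setT (fun s => h i j s o) by exact: (jmeas2 o (jh i j)).
    apply: L1_ge0 => [|s|]; [exact: measurable_funX|exact: sqr_ge0|].
    rewrite ge0_lebT_integral; first exact: (ho (i, j)).
      by apply/measurable_EFinP; exact: measurable_funX.
    by move=> s; rewrite lee_fin sqr_ge0.
  - have Vb s : `|V s o| <= mxnorm1 S * \sum_(i < n) C ^+ 2.
      rewrite ger0_norm//; have := qform_le S (fun i => xs s o i 0).
      rewrite qformE (_ : \col_i xs s o i 0 = xs s o); last first.
        by apply/matrixP => i j; rewrite mxE ord1.
      move=> /le_trans; apply; apply: ler_wpM2l; first exact: mxnorm1_ge0.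
      apply: ler_sum => i _; rewrite -(real_normK (num_real _)).
      by rewrite lerXn2r ?nnegrE.
    apply: (L1_le _ _ (L1Zl (mxnorm1 S * \sum_(i < n) C ^+ 2)
      (L1Zl (delta ^- 2) ko))).
      by apply: measurable_funM; [exact: (jmeas2 o jkap)|exact: (jmeas2 o jV)].
    move=> s; rewrite normrM ger0_norm// mulrC [delta ^- 2 * _]mulrC.
    exact: ler_wpM2r.
by apply: filterS good => o; apply: L1_ge0P.
Qed.

Lemma ereal_fine_le (r r' : \bar R) :
  (0 <= r)%E -> (r <= r')%E -> (r' < +oo)%E -> fine r <= fine r'.
Proof.
move=> r0 rr roo.
by apply: fine_le => //; rewrite ge0_fin_numE// ?(le_trans r0 rr)// (le_lt_trans rr roo).
Qed.

Lemma Pint_lebT_mono t (f : measurableTypeR R -> Omega -> R) : t <= T -> jmeas f ->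
  (forall s o, 0 <= f s o) -> L1prod (lebT T) Pr f ->
  L1prod (lebT t) Pr f /\ Pint (lebT t) Pr f <= Pint (lebT T) Pr f.
Proof.
move=> tT jf f0 Lf.
have LfT : (\int[Pr]_o \int[lebT T]_s (f s o)%:E < +oo)%E.
  have /integrable21ltyP : (lebT T \x Pr)%E.-integrable setT (fun z => (f z.1 z.2)%:E) by exact: Lf.
  move=> /(_ _); under eq_integral do under eq_integral do rewrite /= ger0_norm//.
  by apply; exact/measurable_EFinP.
have le : (\int[Pr]_o \int[lebT t]_s (f s o)%:E <= \int[Pr]_o \int[lebT T]_s (f s o)%:E)%E.
  apply: ge0_le_integral => //.
  - by move=> o _; apply: integral_ge0 => s _; rewrite lee_fin.
  - exact: (nnmeas_timeint _ jf f0).1.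
  - exact: (nnmeas_timeint _ jf f0).1.
  by move=> o _; apply: lebT_mono => //; exact: (jmeas2 o jf).
have ge0 t' : (0 <= \int[Pr]_o \int[lebT t']_s (f s o)%:E)%E.
  by apply: integral_ge0 => o _; apply: integral_ge0 => s _; rewrite lee_fin.
have lt : (\int[Pr]_o \int[lebT t]_s (f s o)%:E < +oo)%E by exact: le_lt_trans le LfT.
split; first exact: L1prod_ge0.
have -> := Pint_tonelli (lebT t) Pr jf f0; have -> := Pint_tonelli (lebT T) Pr jf f0.
exact: ereal_fine_le (ge0 t) le LfT.
Qed.

Definition control_energy (s : measurableTypeR R) (o : Omega) : R :=
  sqnorm (sqrtmx calU *m us s o).
Local Notation Uc := control_energy.

Let UcE s o : Uc s o = quadf calU (us s o).
Proof. exact: dotv_sqrtmx (posdef_psd (gramian_calU_posdef GR)). Qed.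
Let Uc0 s o : 0 <= Uc s o. Proof. exact: sqnorm_ge0. Qed.

Let jUc : jmeas Uc.
Proof.
have mv := @mulmx_measurable R m _ (measurableTypeR R * Omega)%type
  (fun z => us z.1 z.2) ju m (sqrtmx calU).
exact: (sqnorm_measurable (f := fun z : measurableTypeR R * Omega =>
  sqrtmx calU *m us z.1 z.2) mv).
Qed.

Let LUc : L1prod (lebT T) Pr Uc.
Proof.
have Lm : L1prod (lebT T) Pr (fun s o => mxnorm1 calU * sqnorm (us s o)).
  exact: (L1Zl _ Lsu).
apply: (L1prod_le jUc _ Lm) => s o; rewrite ger0_norm// UcE.
have := qform_le calU (fun i => us s o i 0).
rewrite qformE (_ : \col_i us s o i 0 = us s o); last first.
  by apply/matrixP => i j; rewrite mxE ord1.
by move=> /le_trans; apply; rewrite /sqnorm /dotv; under eq_bigr do rewrite expr2.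
Qed.

Section Level.
Variable N : nat.
Local Notation B := (below T gg N).
Local Notation chi := (survival B).

Let jchi : jmeas chi. Proof. exact: below_jmeas. Qed.
Let chi0 s o : 0 <= chi s o. Proof. by rewrite /survival ler0n. Qed.
Let chi1 s o : chi s o <= 1. Proof. by rewrite /survival lern1 leq_b1. Qed.

Let rateE s o :
  energy_rate K (fun i s o => xs s o i 0) b h S s o =
  2 * dotv (xs s o) (S *m sde_drift sys (xs s o) (us s o)) +
  itoq S K (sde_diffusion sys (xs s o) (us s o)).
Proof.
have sS : S^T = S by exact: psdS.1.
have E2 (z y : 'cV[R]_n) : dotv z (S *m y) = \sum_i \sum_i' S i i' * (y i' 0 * z i 0).
  rewrite /dotv; apply: eq_bigr => i _; rewrite mxE mulr_sumr.
  by apply: eq_bigr => i' _; ring.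
have E1 (z y : 'cV[R]_n) : dotv z (S *m y) = \sum_i \sum_i' S i i' * (y i 0 * z i' 0).
  rewrite (dotv_psd_sym _ _ sS) /dotv; apply: eq_bigr => i _; rewrite mxE mulr_sumr.
  by apply: eq_bigr => i' _; ring.
rewrite mulr_natl mulr2n {1}E1 E2 /itoq -!big_split/=; apply: eq_bigr => i _.
by rewrite -!big_split/=; apply: eq_bigr => i' _; rewrite -!mulrDr.
Qed.

Let rate_le s o : energy_rate K (fun i s o => xs s o i 0) b h S s o <=
  Uc s o + kap s o * V s o.
Proof.
rewrite rateE UcE.
apply: (gramian_dissipation (xs s o) psdK (sde_g0 A) (sde_gamma0 A) (sde_f0 A) GR).
by [].
Qed.

(** The part of the dissipation bound which is controlled by Gronwall's
    inequality. *)
Definition stopped_gain (s : measurableTypeR R) (o : Omega) : R :=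
  chi s o * (kap s o * V s o).

Let jsg : jmeas stopped_gain.
Proof. by apply: jmeasM => //; exact: jmeasM. Qed.
Let sg0 s o : 0 <= stopped_gain s o. Proof. by rewrite mulr_ge0. Qed.

Let stopped_gain_path t o : 0 <= t <= T ->
  (\int[lebT t]_s (stopped_gain s o)%:E <= N%:R%:E)%E.
Proof.
move=> tT; apply: (below_integral T0 jgg gg_ge0 gg_out N (f := fun s o => kap s o * V s o) tT).
  exact: jmeasM.
by move=> s; rewrite kV0 kV_gg.
Qed.

Let Lsg t : 0 <= t <= T -> L1prod (lebT t) Pr stopped_gain /\
  Pint (lebT t) Pr stopped_gain <= N%:R.
Proof.
move=> tT.
have le : (\int[Pr]_o \int[lebT t]_s (stopped_gain s o)%:E <= N%:R%:E)%E.
  rewrite -[leRHS](integral_prob_cst Pr); apply: ge0_le_integral => //.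
  - by move=> o _; apply: integral_ge0 => s _; rewrite lee_fin.
  - exact: (nnmeas_timeint _ jsg sg0).1.
  by move=> o _; exact: stopped_gain_path.
split; first by apply: L1prod_ge0 => //; apply: le_lt_trans le _; exact: ltry.
rewrite (Pint_tonelli (lebT t) Pr jsg sg0) -lee_fin fineK// ge0_fin_numE; first exact: le_lt_trans le (ltry _).
by apply: integral_ge0 => o _; apply: integral_ge0 => s _; rewrite lee_fin.
Qed.

(** The energy inequality combined with the dissipation inequality, which holds
    pointwise. *)
Lemma stopped_storage_le t : 0 <= t <= T ->
  (\int[Pr]_o (chi t o * V t o)%:E <=
   (Pint (lebT T) Pr Uc + Pint (lebT t) Pr stopped_gain)%:E)%E.
Proof.
move=> tT; have /andP[t0 t1] := tT.
have inT s : 0 <= s <= t -> 0 <= s <= T.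
  by move=> /andP[-> st]; rewrite (le_trans st t1).
have FB s : 0 <= s <= t -> F s [set o | B s o].
  by move=> /inT; exact: (below_adapted uF jgg gg_ge0 gg_out cost_adapted).
have Bmono s s' o : 0 <= s -> s <= s' -> s' <= t -> B s' o -> B s o.
  by move=> _ ss _; exact: below_mono.
have Bleft s o : 0 < s -> s <= t -> ~~ B s o -> exists2 s', 0 <= s' < s & ~~ B s' o.
  by move=> s0 _; exact: below_left.
have FX i s : 0 <= s <= t -> meas_wrt (F s) (fun o => xs s o i 0).
  by move=> /inT sT; exact: (patched_adapted (sol_adapted sol) sT).
have Fb i s : 0 <= s <= t -> meas_wrt (F s) (b i s).
  by move=> /inT sT; exact: drift_adapted.
have bX i i' o : (\int[lebT t]_s (chi s o * (`|b i s o| * (1 + `|xs s o i' 0|)))%:E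
    <= N%:R%:E)%E.
  apply: (below_integral T0 jgg gg_ge0 gg_out N
    (f := fun s o => `|b i s o| * (1 + `|xs s o i' 0|)) tT).
    apply: measurable_funM; first exact: measurableT_comp (jb i).
    by apply: measurable_funD; [exact: measurable_cst|exact: measurableT_comp (jx i')].
  by move=> s; rewrite bx0 bx_gg.
have chih i j o : (\int[lebT t]_s (chi s o * h i j s o ^+ 2)%:E <= N%:R%:E)%E.
  apply: (below_integral T0 jgg gg_ge0 gg_out N (f := fun s o => h i j s o ^+ 2) tT).
    exact: jmeas_sqr.
  by move=> s; rewrite sqr_ge0 h_gg.
have Xeq s : 0 <= s <= t -> exists J : 'I_n -> 'I_q -> Omega -> R,
    (forall i j, ito_integral Pr F (fun s o => w s o j 0) s (h i j) (J i j)) /\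
    {ae Pr, forall o, forall i, xs s o i 0 =
       \int[lebesgue_measure]_(u in `[0, s]) b i u o + \sum_j J i j o}.
  by move=> /inT sT; exact: stochastic_parts.
have [LE EI] := energy_inequality uF W t0 jchi FB Bmono Bleft jx jb jh FX Fb bX chih Xeq psdS.
have -> : (\int[Pr]_o (chi t o * V t o)%:E)%E =
    (\int[Pr]_o (chi t o * qform S (fun i => xs t o i 0))%:E)%E.
  apply: eq_integral => o _; rewrite qformE (_ : \col_i xs t o i 0 = xs t o)//.
  by apply/matrixP => i j; rewrite mxE ord1.
apply: le_trans EI _; rewrite lee_fin.
have [LUt Ule] := Pint_lebT_mono t1 jUc Uc0 LUc.
have [Lst _] := Lsg tT.
apply: (@le_trans _ _ (Pint (lebT t) Pr Uc + Pint (lebT t) Pr stopped_gain)); last first.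
  by rewrite lerD2r.
rewrite /Pint -(RintD LUt Lst); apply: Rint_le => //; first exact: L1D.
move=> [s o] /=.
apply: le_trans (ler_wpM2l (chi0 s o) (rate_le s o)) _.
by rewrite mulrDr lerD2r; exact: ler_piMl.
Qed.

Definition mean_gain (s : R) : R := (\int[Pr]_o sqnorm (mc s o)) * delta ^- 2.
Definition mean_storage (s : R) : R := \int[Pr]_o (chi s o * V s o).
Local Notation a := (Pint (lebT T) Pr Uc).

Let a0 : 0 <= a. Proof. by apply: Rintegral_ge0 => z _. Qed.

Let LV s : 0 <= s <= T -> L1 Pr (fun o => chi s o * V s o).
Proof.
move=> sT; apply: L1_ge0.
- exact: (jmeas1 s (jmeasM jchi jV)).
- by move=> o; rewrite mulr_ge0.
- by apply: le_lt_trans (stopped_storage_le sT) _; exact: ltry.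
Qed.

Let y_le s : 0 <= s <= T -> mean_storage s <= a + Pint (lebT s) Pr stopped_gain.
Proof. by move=> sT; rewrite -lee_fin (L1E (LV sT)); exact: stopped_storage_le. Qed.

Let y0 s : 0 <= mean_storage s.
Proof. by apply: Rintegral_ge0 => o _; rewrite mulr_ge0. Qed.

Let yC s : mean_storage s <= a + N%:R.
Proof.
have [sT|sT] := boolP (0 <= s <= T).
  by apply: le_trans (y_le sT) _; rewrite lerD2l; exact: (Lsg sT).2.
have VE o : chi s o * V s o = 0.
  rewrite /V /patched (negbTE sT) /quadf mulmx0 /dotv big1 ?mulr0// => i _.
  by rewrite mxE mul0r.
rewrite /mean_storage; under eq_Rintegral do rewrite VE.
by rewrite Rintegral_prob_cst addr_ge0.
Qed.

Let k0 s : 0 <= mean_gain s.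
Proof.
by rewrite mulr_ge0//; apply: Rintegral_ge0 => o _; exact: sqnorm_ge0.
Qed.

Let mk : measurable_fun setT mean_gain.
Proof.
apply: measurable_funM => //.
exact: (@parameter_integral_measurable _ _ (measurableTypeR R) _ _ Pr
  (fun s o => sqnorm (mc s o))).
Qed.

Let my : measurable_fun setT mean_storage.
Proof.
exact: (@parameter_integral_measurable _ _ (measurableTypeR R) _ _ Pr
  (fun s o => chi s o * V s o) (jmeasM jchi jV)).
Qed.

Let Lk : L1 (lebT T) mean_gain.
Proof.
have := L1Zl (delta ^- 2) (L1prod_inner1 Lsq).
by apply: eq_integrable => // s _ /=; rewrite mulrC.
Qed.

(** For each time the gain is almost surely a constant, as the multiplicative
    controls are deterministic. *)
Let gain_split s : 0 <= s <= T ->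
  \int[Pr]_o stopped_gain s o = mean_gain s * mean_storage s.
Proof.
move=> sT; have [v0 v0P] := det.
have mcE : {ae Pr, forall o, mc s o = v0 s}.
  apply: filterS (v0P s sT) => o <-; apply/matrixP => i j.
  by rewrite !mxE us_in.
have -> : mean_gain s = sqnorm (v0 s) * delta ^- 2.
  rewrite /mean_gain; congr (_ * _).
  rewrite (@Rint_ae _ _ _ Pr _ (fun=> sqnorm (v0 s))).
  - exact: Rintegral_prob_cst.
  - exact: (jmeas1 s jsq).
  - exact: measurable_cst.
  - by apply: filterS mcE => o ->.
rewrite -(RintZ _ (LV sT)); apply: Rint_ae.
- exact: (jmeas1 s jsg).
- by apply: measurable_funM => //; exact: (jmeas1 s (jmeasM jchi jV)).
by apply: filterS mcE => o E; rewrite /stopped_gain /kap E; ring.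
Qed.

Lemma mean_storage_gronwall s : 0 <= s <= T ->
  mean_storage s <= a * expR (\int[lebT T]_r mean_gain r).
Proof.
have yP r : 0 <= r <= T ->
    mean_storage r <= a + runint T (fun v => mean_gain v * mean_storage v) r.
  move=> rT; apply: le_trans (y_le rT) _; rewrite lerD2l; have /andP[r0 r1] := rT.
  have mky : measurable_fun setT (fun v : R => mean_gain v * mean_storage v).
    exact: measurable_funM.
  rewrite -(PintE1 (Lsg rT).1) runint_lebT//.
  apply: le_trans (_ : \int[lebT r]_v (mean_gain v * mean_storage v) <= _) => //.
  have -> // : \int[lebT r]_v \int[Pr]_o stopped_gain v o =
    \int[lebT r]_v (mean_gain v * mean_storage v).
  apply: Rint_ae.
  - exact: L1_measurable (L1prod_inner1 (Lsg rT).1).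
  - exact: mky.
  apply: ae_lebT_imp => v /andP[v0 vr]; apply: gain_split.
  by rewrite v0 (le_trans vr r1).
exact: (gronwall T0 mk my k0 y0 yC Lk yP).
Qed.

End Level.

Let gain_integral : \int[lebT T]_r mean_gain r =
  fine (L2T_sqnorm Pr T (multiplicative_controls sys u)) * delta ^- 2.
Proof.
rewrite -(L2T_patched (f := fun v => \col_i (if `[< forall z, sde_g sys i z = 0 >]
  then 0 else v i 0)) jsq).
have <- := Pint_tonelli (lebT T) Pr jsq (fun s o => sqnorm_ge0 (mc s o)).
rewrite -(PintE1 Lsq) mulrC -(RintZ _ (L1prod_inner1 Lsq)).
by apply: eq_Rintegral => s _; rewrite /mean_gain mulrC.
Qed.

(** The cost is finite on almost every path, so that the stopping does not occur
    for large [N]; truncating the storage allows dominated convergence. *)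
Lemma storage_bound s : 0 <= s <= T ->
  (\int[Pr]_o (V s o)%:E <= (Pint (lebT T) Pr Uc *
    expR (fine (L2T_sqnorm Pr T (multiplicative_controls sys u)) * delta ^- 2))%:E)%E.
Proof.
move=> sT; have /andP[s0 s1] := sT; rewrite -gain_integral.
have mV : measurable_fun setT (V s) by exact: (jmeas1 s jV).
apply: integral_trunc_le => // k.
have mmin : measurable_fun setT (fun o => Num.min (V s o) k%:R).
  exact: measurable_minr.
have min0 o : 0 <= Num.min (V s o) k%:R by rewrite le_min V0/=.
have mink o : Num.min (V s o) k%:R <= k%:R by rewrite ge_min lexx orbT.
have Lmin : L1 Pr (fun o => Num.min (V s o) k%:R).
  by apply: (@L1_bounded _ _ _ _ _ k%:R) => // o; rewrite ger0_norm.
rewrite -(L1E Lmin) lee_fin.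
have mchi N : measurable_fun setT (survival (below T gg N) s).
  exact: (jmeas1 s (below_jmeas T jgg gg_ge0 N)).
have cv : (fun N : nat => \int[Pr]_o (survival (below T gg N) s o * Num.min (V s o) k%:R)) @ \oo
    --> \int[Pr]_o Num.min (V s o) k%:R.
  apply: (@Rdominated_cvg _ _ _ _ _ _ (fun=> k%:R)).
  - by move=> N; exact: measurable_funM.
  - exact: mmin.
  - apply: filterS cost_finite => o fo; apply: cvg_near_cst.
    apply: filterS (below_eventually jgg gg_ge0 s1 fo) => N bN.
    by rewrite /survival bN mul1r.
  - move=> N o; rewrite normrM (ger0_norm (min0 o)).
    apply: le_trans (mink o); apply: ler_piMl => //.
    by rewrite /survival normr_nat lern1 leq_b1.
  - exact: L1_cst.
apply: (cvgr_to_le cv); apply: nearW => N.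
apply: le_trans (mean_storage_gronwall N sT).
have LVN : L1 Pr (fun o => survival (below T gg N) s o * V s o).
  apply: L1_ge0.
  - exact: measurable_funM.
  - by move=> o; rewrite mulr_ge0// /survival ler0n.
  - by apply: le_lt_trans (stopped_storage_le N sT) _; exact: ltry.
apply: Rint_le => //.
  apply: (L1_le _ _ LVN); first exact: measurable_funM.
  move=> o; rewrite ger0_norm; last by rewrite mulr_ge0// /survival ler0n.
  by apply: ler_wpM2l; [rewrite /survival ler0n|rewrite ge_min lexx].
by move=> o; apply: ler_wpM2l; [rewrite /survival ler0n|rewrite ge_min lexx].
Qed.

Lemma control_energyE :
  (Pint (lebT T) Pr Uc)%:E = L2T_sqnorm Pr T (fun t o => sqrtmx calU *m u t o).
Proof.
rewrite -(L2T_patched (f := fun v => sqrtmx calU *m v) jUc).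
rewrite (Pint_tonelli (lebT T) Pr jUc Uc0) fineK// ge0_fin_numE.
  have /integrable21ltyP : (lebT T \x Pr)%E.-integrable setT (fun z => (Uc z.1 z.2)%:E).
    exact: LUc.
  move=> /(_ _); under eq_integral do under eq_integral do rewrite /= ger0_norm//.
  by apply; exact/measurable_EFinP.
by apply: integral_ge0 => o _; apply: integral_ge0 => s _; rewrite lee_fin.
Qed.

Lemma multiplicative_fin_num :
  L2T_sqnorm Pr T (multiplicative_controls sys u) \is a fin_num.
Proof.
rewrite -(L2T_patched (f := fun v => \col_i (if `[< forall z, sde_g sys i z = 0 >]
  then 0 else v i 0)) jsq) ge0_fin_numE.
  have /integrable21ltyP : (lebT T \x Pr)%E.-integrable setT
    (fun z => (sqnorm (mc z.1 z.2))%:E) by exact: Lsq.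
  move=> /(_ _); under eq_integral do under eq_integral do
    rewrite /= ger0_norm ?sqnorm_ge0//.
  by apply; exact/measurable_EFinP.
by apply: integral_ge0 => o _; apply: integral_ge0 => s _; rewrite lee_fin sqnorm_ge0.
Qed.

Lemma component_bound (p : 'cV[R]_n) (lambda : R) s : 0 <= s <= T ->
  dotv p p = 1 -> P *m p = lambda *: p -> 0 < lambda ->
  ('E_Pr[fun o => (dotv (x s o) p ^+ 2)%R] <= lambda%:E
    * expeR (L2T_sqnorm Pr T (multiplicative_controls sys u) * (delta ^- 2)%:E)
    * L2T_sqnorm Pr T (fun t o => sqrtmx calU *m u t o))%E.
Proof.
move=> sT pp Pp l0; rewrite unlock -control_energyE.
rewrite -(fineK multiplicative_fin_num) -EFinM /=.
set L := fine _.
have -> : (lambda * expR (L * delta ^- 2) * Pint (lebT T) Pr Uc)%:E =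
    (lambda%:E * (Pint (lebT T) Pr Uc * expR (L * delta ^- 2))%:E)%E.
  by rewrite -EFinM; congr EFin; ring.
have mV : measurable_fun setT (V s) by exact: (jmeas1 s jV).
apply: le_trans (lee_wpmul2l _ (storage_bound sT)); last by rewrite lee_fin ltW.
rewrite -ge0_integralZl//; last by rewrite lee_fin ltW.
- apply: ge0_le_integral => //.
  + by move=> o _; rewrite lee_fin sqr_ge0.
  + apply/measurable_EFinP; apply: measurable_funX; apply: measurable_sum => i.
    apply: measurable_funM => //.
    apply: eq_measurable_fun (jmeas1 s (jx i)) => o _.
    by rewrite xs_in.
  + by apply/measurable_EFinP; apply: measurable_funM.
  move=> o _; rewrite -EFinM lee_fin /V xs_in//.
  exact: eigenvector_bound (gramian_posdef GR) pp Pp l0.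
- exact/measurable_EFinP.
- by move=> o _; rewrite lee_fin.
Qed.

End ReachabilityEnergy.

Theorem theorem3p9 (R : realType) (d : measure_display)
    (Omega : measurableType d) (Pr : probability Omega R)
    (F : R -> set (set Omega)) (n m q : nat) (K : 'M[R]_q)
    (w : R -> Omega -> 'cV[R]_q) (sys : sde_coeffs R n m q)
    (T delta : R) (calU : 'M[R]_m) (P : 'M[R]_n)
    (u : R -> Omega -> 'cV[R]_m) (x0 : 'cV[R]_n) (x : R -> Omega -> 'cV[R]_n)
    (p : 'I_n -> 'cV[R]_n) (lambda : 'I_n -> R) :
  usual_filtration Pr F ->
  wiener_process Pr F K w ->
  sde_standing_assumptions Pr F sys w ->
  0 < T ->
  simplified_reachability_gramian sys K calU delta P ->
  admissible_control Pr F T u ->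
  sde_solution Pr F sys w T x0 u x ->
  (forall k l, dotv (p k) (p l) = (k == l)%:R) ->
  (forall k, P *m p k = lambda k *: p k) ->
  (forall k, 0 < lambda k) ->
  x0 = 0 ->
  deterministic_on Pr T (multiplicative_controls sys u) ->
  forall k : 'I_n,
    (ereal_sup [set 'E_Pr[fun omega => (dotv (x t omega) (p k) ^+ 2)%R]
                | t in `[0%R, T]]
     <= (lambda k)%:E
        * expeR (L2T_sqnorm Pr T (multiplicative_controls sys u)
                 * (delta ^- 2)%:E)
        * L2T_sqnorm Pr T (fun t omega => sqrtmx calU *m u t omega))%E.
Proof.
move=> uF W A T0 GR adm sol pp Pp l0 x00 det k; subst x0.
apply: ge_ereal_sup => _ [t tT <-].
have tT' : 0 <= t <= T by move: tT; rewrite /= in_itv.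
apply: (component_bound uF W A T0 GR adm sol det tT') => //.
by rewrite pp eqxx.
Qed.
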